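(* Let $\mathcal X$ be a translation invariant simple random point process in the plane $\mathbb R^2\cong\mathbb C$ whose one- and two-point correlation functions satisfy $\rho_1\equiv 1$ and $\rho_2(x,y)=1-T_2(x-y)$ for some function $T_2:\mathbb R^2\to\mathbb R$. Assume $$\int_{\mathbb R^2}|v|^k|T_2(v)|\,dv<\infty\qquad\text{for }k=1,2,3 .$$ Then the following hold. (a) If $\int_{\mathbb R^2}T_2(v)\,dv=c\ne 1$, then $\mathbb E\,\mathcal W_N\to\infty$ as $N\to\infty$. (b) If $\int_{\mathbb R^2}T_2(v)\,dv=1$ and $1-\int_{[-N,N]^2}T_2(v)\,dv=o\big((\log N)^{-1}\big)$, then $\lim_{N\to\infty}\mathbb E\,\mathcal W_N$ exists and is finite if and only if $\int_{\mathbb R^2}T_2(v)\log|v|\,dv$ converges, and in that case $$\lim_{N\to\infty}\mathbb E\,\mathcal W_N=\int_{\mathbb R^2}\log|v|\,T_2(v)\,dv .$$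
   Context: A simple random point process in $\mathbb R^2$ is a random locally finite set $\{a_i\}$ of mutually distinct points of $\mathbb R^2$. Its $k$-point correlation function $\rho_k$ is characterized by $\mathbb E\sum_{i_1,\dots,i_k\text{ pairwise distinct}}F(a_{i_1},\dots,a_{i_k})=\int_{(\mathbb R^2)^k}F\rho_k\,dx_1\cdots dx_k$ for suitable test functions $F$. The correlation functions are assumed to exist (absolutely continuous correlation measures). The plane is identified with $\mathbb C$. For $N\ge1$ and $x\in\mathbb C$ let $$E_N(x)=\sum_{(m,n)\in\mathbb Z^2\setminus\{0\}}e^{2i\pi\left(m\,\mathrm{Re}(x)/N+n\,\mathrm{Im}(x)/N\right)}\frac{1}{m^2+n^2}$$ (the series is understood as the Fourier series of an $(N\mathbb Z)^2$-periodic $L^2_{loc}$ function, which is smooth away from $(N\mathbb Z)^2$; equivalently, $\frac1{2\pi}E_N$ is the zero-average solution $G$ of $-\Delta G=2\pi(\delta_0-\frac1{N^2})$ on $\mathbb R^2/(N\mathbb Z)^2$). Let $\eta$ be the Dedekind eta function, $\eta(\tau)=q^{1/24}\prod_{k\ge1}(1-q^k)$ with $q=e^{2i\pi\tau}$. For a configuration $\{a_i\}\subset\mathbb C$, the renormalized energy at scale $N$ is $$\mathcal W_N=\frac1{2\pi N^2}\sum_{i\neq j,\ a_i,a_j\in[0,N]^2}E_N(a_i-a_j)+\log\frac{N}{2\pi\eta(i)^2},$$ where in $\eta(i)$ the symbol $i$ is the imaginary unit. *)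

(* Defs.v *)
From HB Require Import structures.
From mathcomp Require Import all_boot all_order all_algebra.
From mathcomp Require Import complex.
From mathcomp Require Import all_classical all_reals all_analysis measurable_realfun.

Set Implicit Arguments.
Unset Strict Implicit.
Unset Printing Implicit Defensive.
Import Order.TTheory GRing.Theory Num.Theory.
Import numFieldNormedType.Exports.

Local Open Scope classical_set_scope.
Local Open Scope ring_scope.

(* Makes [f =o_ +oo g] available for functions of a real variable. *)
Canonical pinfty_filter_on (R : realType) := @FilterType R (pinfty_nbhs R) _.

(* The plane is [R * R].  The library norm on a product is the sup norm, hence
   the separate Euclidean norm. *)
Definition enorm (R : realType) (v : R * R) : R :=
  Num.sqrt (v.1 ^+ 2 + v.2 ^+ 2).

Notation leb2 R := (@lebesgue_measure R \x @lebesgue_measure R)%E.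

Definition square (R : realType) (a b : R) : set (R * R) :=
  `[a, b] `*` `[a, b].

(* The sigma-algebra on configurations generated by the counting maps
   S |-> #(S `&` A), A Borel. *)
Definition config_sigma (R : realType) : set (set (set (R * R))) :=
  <<s [set C | exists A : set (R * R), measurable A /\
        exists k : nat, C = [set S | (S `&` A #= `I_k)%card]] >>.

Definition locally_finite (R : realType) (S : set (R * R)) : Prop :=
  forall r : R, finite_set (S `&` [set a | enorm a <= r]).

Definition simple_point_process (d : measure_display) (Omega : measurableType d)
    (R : realType) (X : Omega -> set (R * R)) : Prop :=
  (forall w, locally_finite (X w)) /\
  (forall C, config_sigma C -> measurable (X @^-1` C)).

Definition translation_invariant (d : measure_display)
    (Omega : measurableType d) (R : realType) (P : probability Omega R)
    (X : Omega -> set (R * R)) : Prop :=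
  forall (u : R * R) (C : set (set (R * R))), config_sigma C ->
    P [set w | C [set a + u | a in X w]] = P (X @^-1` C).

Definition distinct_pairs (T : Type) (S : set T) : set (T * T) :=
  [set p | [/\ S p.1, S p.2 & p.1 <> p.2]].

(* k-point correlation functions for k = 1, 2, tested against all nonnegative
   Borel functions; this determines rho up to a null set and forces rho >= 0
   almost everywhere. *)
Definition one_point_correlation (d : measure_display)
    (Omega : measurableType d) (R : realType) (P : probability Omega R)
    (X : Omega -> set (R * R)) (rho : R * R -> R) : Prop :=
  measurable_fun setT rho /\
  forall F : R * R -> \bar R, measurable_fun setT F ->
    (forall x, 0 <= F x)%E ->
    (\int[P]_w (\esum_(a in X w) F a) = \int[leb2 R]_x (F x * (rho x)%:E))%E.

Definition two_point_correlation (d : measure_display)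
    (Omega : measurableType d) (R : realType) (P : probability Omega R)
    (X : Omega -> set (R * R)) (rho : (R * R) * (R * R) -> R) : Prop :=
  measurable_fun setT rho /\
  forall F : (R * R) * (R * R) -> \bar R, measurable_fun setT F ->
    (forall p, 0 <= F p)%E ->
    (\int[P]_w (\esum_(p in distinct_pairs (X w)) F p) =
     \int[leb2 R \x leb2 R]_p (F p * (rho p)%:E))%E.

Definition lattice (R : realType) (N : R) : set (R * R) :=
  [set x | exists m n : int, x = (m%:~R * N, n%:~R * N)].

Definition fourier_phase (R : realType) (N : R) (m n : int) (x : R * R) : R :=
  2 * pi * (m%:~R * x.1 / N + n%:~R * x.2 / N).

(* [E] is the function whose Fourier series is
     \sum_((m, n) != 0) e^(2 i pi (m x.1 / N + n x.2 / N)) / (m^2 + n^2) :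
   it is (N Z)^2-periodic, locally L^2, regular off the lattice, and has these
   Fourier coefficients (real and imaginary parts being listed separately).
   Such an [E] is unique off the lattice, already when regular only means
   continuous; its values on the lattice are left arbitrary. *)
Definition is_torus_energy (R : realType) (N : R) (E : R * R -> R) : Prop :=
  [/\ measurable_fun setT E,
      forall (m n : int) (x : R * R), E (x + (m%:~R * N, n%:~R * N)) = E x,
      (leb2 R).-integrable (square 0 N) (fun x => (E x ^+ 2)%:E),
      (forall x, ~ lattice N x -> {for x, continuous E}) &
      forall m n : int,
        \int[leb2 R]_(x in square 0 N) (E x * cos (fourier_phase N m n x)) / N ^+ 2
          = (if (m == 0) && (n == 0) then 0
             else ((m%:~R : R) ^+ 2 + n%:~R ^+ 2)^-1) /\
        \int[leb2 R]_(x in square 0 N) (E x * sin (fourier_phase N m n x)) / N ^+ 2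
          = 0].

Definition cexp (R : realType) (z : R[i]) : R[i] :=
  ((expR (complex.Re z) * cos (complex.Im z)) +i*
   (expR (complex.Re z) * sin (complex.Im z)))%C.

Definition dedekind_eta (R : realType) (tau : R[i]) : R[i] :=
  let e (t : R[i]) := cexp (2 * 'i%C * pi%:C%C * t) in
  e (tau / 24) *
    limn (fun n => \prod_(1 <= k < n) (1 - e tau ^+ k) : (R[i] : numFieldType)).

(* [complex.Re] only serves to land in [R]: eta(i) is real. *)
Definition W (R : realType) (E : R -> R * R -> R) (N : R) (S : set (R * R)) : R :=
  (2 * pi * N ^+ 2)^-1 *
    (\sum_(p \in distinct_pairs (S `&` square 0 N)) E N (p.1 - p.2)) +
  ln (N / (2 * pi * complex.Re (dedekind_eta ('i%C : R[i]) ^+ 2))).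

(* Main.v *)
From HB Require Import structures.
Require Import Defs.
From mathcomp Require Import all_boot all_order all_algebra.
From mathcomp Require Import finmap complex ring lra.
From mathcomp Require Import all_classical all_reals all_analysis measurable_realfun.
Set Implicit Arguments.
Unset Strict Implicit.
Unset Printing Implicit Defensive.
Import Order.TTheory GRing.Theory Num.Theory.
Import numFieldNormedType.Exports.

Local Open Scope classical_set_scope.
Local Open Scope ring_scope.

(** The two-point function turns the expected pair sum into an integral over differences. With
    [tent2 N v] the area of the overlap of [0,N]^2 with its translate by v, the expectation of W_N
    is (2 pi N^2)^-1 times the integral of tent2(v) E_N(v) (1 - T2(v)), plus ln N - K, where K =
    [torus_const] = ln(2 pi eta(i)^2) ([expect_W_eq], [ln_torus_const]). The translates of the tent
    by the lattice add up to the constant N^2, and E_N is periodic of mean zero, so the term coming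
    from 1 vanishes ([integral_tent_torus]). There remains -(2 pi)^-1 times the integral of taper
    E_N T2, with taper = tent2 / N^2.

    To use this, E_N must be known near the origin. Kronecker's second limit formula gives a closed
    form [kfun] as a Bernoulli polynomial plus logarithms of the factors of a theta product. Its
    Fourier coefficients are computed ([coef_kfun]), and Fourier uniqueness at points of continuity
    ([wave_coef_inj]) identifies it with the rescaled E_N ([torus_kfun]). The closed form shows that
    [defect], which is taper (E_N + 2 pi ln(|v|/N)), is bounded uniformly in N, because the taper
    vanishes where E_N has its other singularities, and that it tends to -2 pi K ([defect_bound],
    [defect_cvg]); K is computed from the product for eta(i) ([dedekind_eta_i]).

    Write c for the integral of T2. If T2 ln|v| is integrable, [expect_W_finite] and dominated
    convergence give: expectation = K c + integral of T2 ln|v| - K + ln N (1 - integral of taper T2)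
    + o(1). The variance of the number of points in [0,N]^2 is nonnegative, which forces c <= 1
    ([total_correlation_le1]); so c <> 1 means c < 1 and the logarithm drives the expectation to
    +oo. If c = 1, the two K cancel, and the decay hypothesis together with the first moment removes
    the ln N term ([cvg_log_defect]), leaving the integral of T2 ln|v|.

    If T2 ln|v| is not integrable, the failure occurs near the origin, where the taper is bounded
    below. Since T2 <= 1 almost everywhere ([ae_T2_le1]) and E_N is bounded below where the taper
    lives, the negative part of the integrand stays integrable, so the expectation is +oo for every
    N >= 1 ([expect_W_infinite]). This settles both the remaining case of (a) and the converse in
    (b). *)

(** * The cosine series of ln |1 - r e^(i th)|^2, with an explicit remainder *)

Section log_kernel.
Context {R : realType}.
Implicit Types (r s x t th b : R) (M : nat).
Local Notation mu := (@lebesgue_measure R).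

Lemma Rintegral_FTC (F f : R -> R) a b : a < b ->
  (forall x : R, is_derive x 1 F (f x)) -> continuous f ->
  \int[mu]_(x in `[a, b]) f x = F b - F a.
Proof.
move=> ab dF cf.
have cF : continuous F.
  by move=> x; apply/differentiable_continuous/derivable1_diffP; exact: ex_derive.
rewrite /Rintegral (@continuous_FTC2 _ _ F)//.
- exact: continuous_subspaceT.
- split => //.
  + by apply: cvg_at_right_filter; exact: cF.
  + by apply: cvg_at_left_filter; exact: cF.
- by move=> x _; rewrite derive1E; exact: derive_val.
Qed.

Lemma integrable_continuous_itv (f : R -> R) a b : continuous f ->
  mu.-integrable `[a, b] (EFin \o f).
Proof.
move=> cf; apply: continuous_compact_integrable; first exact: segment_compact.
exact: continuous_subspaceT.
Qed.

(** This is |1 - r e^(i th)|^2. *)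
Definition logarg r th : R := 1 - 2 * r * cos th + r ^+ 2.

Lemma logarg_ge r th : 0 <= r -> (1 - r) ^+ 2 <= logarg r th.
Proof. by move=> r0; rewrite /logarg; have := cos_le1 th; nra. Qed.

Lemma logarg_le r th : 0 <= r -> logarg r th <= (1 + r) ^+ 2.
Proof. by move=> r0; rewrite /logarg; have := cos_geN1 th; nra. Qed.

Lemma logarg_gt0 r th : 0 <= r -> r < 1 -> 0 < logarg r th.
Proof.
by move=> r0 r1; apply: lt_le_trans (logarg_ge th r0); rewrite exprn_gt0// subr_gt0.
Qed.

(** Closed form of the remainder in the truncated Poisson-type series. It is what the derivative in
    s of the error in [log_partial_err] reduces to; the induction uses cos((M+1) th + th) and
    cos((M+1) th - th). *)
Lemma poisson_partial_sum s th M :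
  (s - cos th) + logarg s th * \sum_(j < M) (s ^+ j * cos (j.+1%:R * th)) =
  s ^+ M.+1 * cos (M%:R * th) - s ^+ M * cos (M.+1%:R * th).
Proof.
elim: M => [|M IH].
  by rewrite big_ord0 mulr0 addr0 expr1 expr0 mul0r cos0 mulr1 !mul1r.
rewrite big_ord_recr/= mulrDr addrA IH.
have -> : M.+2%:R * th = M.+1%:R * th + th by rewrite -(natr1 M.+1); ring.
have -> : M%:R * th = M.+1%:R * th - th by rewrite -(natr1 M); ring.
by rewrite cosB cosD /logarg !exprS; ring.
Qed.

Definition log_partial r th M : R :=
  \sum_(j < M) (r ^+ j.+1 / j.+1%:R * cos (j.+1%:R * th)).

Lemma is_derive_sum_fun (V : nat -> R -> R) (dV : nat -> R) (x : R) M :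
  (forall j, is_derive x 1 (V j) (dV j)) ->
  is_derive x 1 (fun y => \sum_(j < M) V j y) (\sum_(j < M) dV j).
Proof.
move=> h; elim: M => [|M IH].
  under eq_fun do rewrite big_ord0.
  by rewrite big_ord0; exact: is_derive_cst.
under eq_fun do rewrite big_ord_recr/=.
by rewrite big_ord_recr/=; exact: is_deriveD.
Qed.

Lemma etrans_derive (f g : R -> R) x d : f =1 g -> is_derive x 1 f d -> is_derive x 1 g d.
Proof. by move=> /funext ->. Qed.

(** The limiting identity is ln |1 - r e^(i th)|^2 = -2 times the sum of r^j cos(j th) / j. The
    error vanishes at r = 0 and its derivative in r is, by [poisson_partial_sum], a remainder of
    size 4 r^M / (1 - r)^2, so the mean value theorem on [0, r] suffices. *)
Lemma log_partial_err r th M : 0 <= r -> r < 1 ->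
  `|ln (logarg r th) + 2 * log_partial r th M| <= 4 * r ^+ M.+1 / (1 - r) ^+ 2.
Proof.
move=> r0 r1.
pose f s := ln (logarg s th) + 2 * log_partial s th M.
pose g s := 2 * (s ^+ M.+1 * cos (M%:R * th) - s ^+ M * cos (M.+1%:R * th)) / logarg s th.
have df s : 0 <= s -> s < 1 -> is_derive s 1 f (g s).
  move=> s0 s1; have D0 := logarg_gt0 th s0 s1.
  have d1 : is_derive s 1 (fun s => logarg s th) (2 * (s - cos th)).
    rewrite /logarg; apply: is_derive_eq.
    rewrite !scaler0 !add0r /GRing.scale/= ; ring.
  have d2 : is_derive s 1 (fun s => ln (logarg s th)) ((2 * (s - cos th)) / logarg s th).
    have hl := is_derive1_ln D0.
    by rewrite mulrC; exact: (@is_derive1_comp _ (@ln R) (fun s => logarg s th) _ _ _ hl d1).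
  have d3 : is_derive s 1 (fun s => log_partial s th M)
     (\sum_(j < M) (s ^+ j * cos (j.+1%:R * th))).
    apply: (@is_derive_sum_fun (fun j s => s ^+ j.+1 / j.+1%:R * cos (j.+1%:R * th))
       (fun j => s ^+ j * cos (j.+1%:R * th))) => j.
    pose k := cos (j.+1%:R * th) / j.+1%:R.
    have dX : is_derive s 1 (fun y : R => y ^+ j.+1) ((j.+1%:R * s ^+ j) *: 1).
      have := @is_deriveX _ _ id j.+1 s 1 _ (is_derive_id _ _).
      by rewrite fctE.
    have := @is_deriveZ _ _ _ (fun y : R => y ^+ j.+1) k _ _ _ dX.
    have -> : k *: ((j.+1%:R * s ^+ j) *: 1) = s ^+ j * cos (j.+1%:R * th).
      rewrite /k /GRing.scale/=; field; by rewrite nat1r.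
    apply: etrans_derive => y.
    change (k * y ^+ j.+1 = y ^+ j.+1 / j.+1%:R * cos (j.+1%:R * th)).
    by rewrite /k; field; rewrite nat1r.
  rewrite /g -poisson_partial_sum.
  have := is_deriveD d2 (@is_deriveZ _ _ _ _ 2 _ _ _ d3).
  have -> : 2 * (s - cos th + logarg s th * \sum_(j < M) s ^+ j * cos (j.+1%:R * th)) / logarg s th
    = 2 * (s - cos th) / logarg s th + 2 *: (\sum_(j < M) s ^+ j * cos (j.+1%:R * th)).
    rewrite /GRing.scale/=; field.
    exact: lt0r_neq0.
  exact: etrans_derive.
have f0 : f 0 = 0.
  rewrite /f /logarg mulr0 mul0r subr0 expr0n addr0 ln1 add0r /log_partial.
  by rewrite big1 ?mulr0// => j _; rewrite expr0n/= !mul0r.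
have [->|rn0] := eqVneq r 0.
  by rewrite -/(f 0) f0 normr0 expr0n/= mulr0 mul0r.
have rp : 0 < r by rewrite lt_def rn0.
have [||c] := @MVT R f g 0 r rp.
- by move=> x; rewrite in_itv/= => /andP[x0 xr]; apply: df; [exact: ltW|exact: lt_trans r1].
- apply: derivable_within_continuous => x; rewrite in_itv/= => /andP[x0 xr].
  by have h := df x x0 (le_lt_trans xr r1); exact: ex_derive.
rewrite in_itv/= => /andP[c0 cr].
rewrite f0 !subr0 => Hf; rewrite -/(f r) Hf normrM (gtr0_norm rp).
have Dge : (1 - r) ^+ 2 <= logarg c th.
  apply: le_trans (logarg_ge th (ltW c0)); rewrite ler_sqr ?nnegrE; lra.
have Dr : 0 < (1 - r) ^+ 2 by rewrite exprn_gt0// subr_gt0.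
have cM : c ^+ M <= r ^+ M by apply: lerXn2r; rewrite ?nnegrE; lra.
rewrite /g normrM normrV ?unitfE ?(lt0r_neq0 (lt_le_trans Dr Dge))//.
rewrite (gtr0_norm (lt_le_trans Dr Dge)) [in leRHS]exprSr.
have -> : 4 * (r ^+ M * r) / (1 - r) ^+ 2 = (4 * r ^+ M / (1 - r) ^+ 2) * r.
  by rewrite mulrA mulrAC.
apply: ler_wpM2r => //.
have D0 := lt_le_trans Dr Dge.
apply: ler_pM => //; [by rewrite invr_ge0 ltW| |by rewrite lef_pV2 ?posrE].
rewrite normrM gtr0_norm//.
have -> : 4 * r ^+ M = 2 * (r ^+ M + r ^+ M) by ring.
apply: ler_wpM2l => //; apply: (le_trans (ler_normB _ _)).
have c1 : c ^+ M.+1 <= r ^+ M.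
  rewrite exprS; apply: le_trans cM; apply: ler_piMl; first by rewrite exprn_ge0// ltW.
  lra.
apply: lerD; rewrite normrM ger0_norm ?exprn_ge0 ?(ltW c0)//.
- by apply: le_trans c1; apply: ler_piMr; rewrite ?cos_max// exprn_ge0// ltW.
- by apply: le_trans cM; apply: ler_piMr; rewrite ?cos_max// exprn_ge0// ltW.
Qed.

End log_kernel.

(** * Fourier coefficients of the logarithmic kernel on one period *)

Section log_fourier.
Context {R : realType}.
Implicit Types (r s x t th b : R) (M : nat).
Local Notation mu := (@lebesgue_measure R).

Lemma sin_int (k : int) b : sin (2 * pi * k%:~R + b) = sin b.
Proof.
have P n c : sin (c + (pi *+ 2) *+ n) = sin c := periodicn (@sinD2pi R) n c.
have E : 2 * pi * k%:~R = (pi *+ 2) * k%:~R :> R by rewrite -[pi *+ 2]mulr_natl.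
rewrite E; case: k {E} => n; first by rewrite addrC -pmulrn mulr_natr P.
rewrite NegzE mulrNz mulrN -pmulrn mulr_natr addrC.
by rewrite -[in RHS](subrK ((pi *+ 2) *+ n.+1) b) P.
Qed.

Lemma cos_int (k : int) b : cos (2 * pi * k%:~R + b) = cos b.
Proof. by rewrite -!sinDpihalf -addrA sin_int. Qed.

Lemma continuous_cos_affine (a b : R) : continuous (fun x : R => cos (a * x + b)).
Proof.
move=> x; apply: (@continuous_comp _ _ _ (fun x : R => a * x + b) (@cos R)); last exact: continuous_cos.
by apply: cvgD; [apply: cvgM; [exact: cvg_cst|exact: cvg_id]|exact: cvg_cst].
Qed.

Lemma continuous_cos_lin (a : R) : continuous (fun x : R => cos (a * x)).
Proof.
have -> : (fun x : R => cos (a * x)) = (fun x => cos (a * x + 0)).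
  by apply/funext => x; rewrite addr0.
exact: continuous_cos_affine.
Qed.

Lemma continuous_log_partial (r : R) M :
  continuous (fun x : R => log_partial r (2 * pi * x) M).
Proof.
elim: M => [|M IH].
  have -> : (fun x : R => log_partial r (2 * pi * x) 0) = (fun=> 0).
    by apply/funext => x; rewrite /log_partial big_ord0.
  by move=> x; exact: cvg_cst.
have -> : (fun x : R => log_partial r (2 * pi * x) M.+1) =
  (fun x => log_partial r (2 * pi * x) M + r ^+ M.+1 / M.+1%:R * cos (M.+1%:R * (2 * pi) * x)).
  by apply/funext => x; rewrite /log_partial big_ord_recr/= -(mulrA M.+1%:R).
move=> x; apply: cvgD; first exact: IH.
by apply: cvgM; [exact: cvg_cst|exact: continuous_cos_lin].
Qed.

Lemma Rintegral_cos_int (k : int) b :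
  \int[mu]_(x in `[0, 1]) cos (2 * pi * k%:~R * x + b) = if k == 0 then cos b else 0.
Proof.
case: eqVneq => [->|k0].
  under eq_Rintegral do rewrite mulr0 mul0r add0r.
  rewrite Rintegral_cst//.
  by rewrite [X in fine X](_ : _ = 1%E) ?mulr1//= lebesgue_measure_itv/= lte01/= oppr0 adde0.
have a0 : 2 * pi * k%:~R != 0 :> R.
  by rewrite !mulf_neq0 ?intr_eq0// gt_eqF// pi_gt0.
set a := 2 * pi * k%:~R; pose F x := a^-1 * sin (a * x + b).
have dF (x : R) : is_derive x 1 F (cos (a * x + b)).
  have d1 : is_derive x 1 (fun x => a * x + b) a.
    apply: is_derive_eq; rewrite ?scaler0 ?addr0 ?add0r /GRing.scale/=; ring.
  have d2 : is_derive x 1 (fun x => sin (a * x + b)) (cos (a * x + b) * a).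
    by apply: (@is_derive1_comp _ (@sin R) (fun x => a * x + b)).
  have := @is_deriveZ _ _ _ _ a^-1 _ _ _ d2.
  suff -> : a^-1 *: (cos (a * x + b) * a) = cos (a * x + b) by exact: etrans_derive.
  by rewrite /GRing.scale/= mulrCA mulVf// mulr1.
rewrite (Rintegral_FTC ltr01 dF); last exact: continuous_cos_affine.
by rewrite /F mulr1 mulr0 add0r sin_int subrr.
Qed.

(** Product-to-sum gives the frequencies m + j and m - j; as j > 0, at most one of them is zero. *)
Lemma Rintegral_cos_cos (j : nat) (m : int) b : (0 < j)%N ->
  \int[mu]_(x in `[0, 1]) (cos (j%:R * (2 * pi * x)) * cos (2 * pi * m%:~R * x + b))
   = if `|m|%N == j then cos b / 2 else 0.
Proof.
move=> j0.
have E x : cos (j%:R * (2 * pi * x)) * cos (2 * pi * m%:~R * x + b) =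
  2^-1 * cos (2 * pi * (j%:Z + m)%:~R * x + b) + 2^-1 * cos (2 * pi * (m - j%:Z)%:~R * x + b).
  rewrite !rmorphD/= rmorphN/= -!pmulrn.
  have -> : 2 * pi * (j%:R + m%:~R) * x + b = j%:R * (2 * pi * x) + (2 * pi * m%:~R * x + b) by ring.
  have -> : 2 * pi * (m%:~R - j%:R) * x + b = (2 * pi * m%:~R * x + b) - j%:R * (2 * pi * x) by ring.
  move: (j%:R * _) (_ * x + b) => A B.
  by rewrite cosB cosD; field.
have I c := integrable_continuous_itv 0 1 (@continuous_cos_affine c b).
have I2 c : mu.-integrable `[0, 1] (EFin \o (fun x => 2^-1 * cos (c * x + b))).
  by apply: (@integrableZl _ _ _ mu _ _ (2^-1) (EFin \o (fun x => cos (c * x + b)))).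
under eq_Rintegral do rewrite E.
rewrite RintegralD// !RintegralZl// !Rintegral_cos_int.
have -> : (j%:Z + m == 0) = (m == - j%:Z) by rewrite addrC addr_eq0.
have -> : (m - j%:Z == 0) = (m == j%:Z) by rewrite subr_eq0.
case: m {E} => n.
  have -> : (Posz n == - j%:Z) = false by case: j j0.
  rewrite mulr0 add0r absz_nat eqz_nat; case: ifP => _; rewrite ?mulr0//; ring.
have -> : (Negz n == j%:Z) = false by [].
have -> : (Negz n == - j%:Z) = (n.+1 == j) by rewrite NegzE eqr_opp.
rewrite mulr0 addr0 /=; case: ifP => _; rewrite ?mulr0//; ring.
Qed.


(** Exact identities between limits are obtained below from truncation errors: a fixed distance
    dominated by C r^M for all large M is zero. *)
Lemma geometric_bound_eq (x y C r : R) N : 0 <= r -> r < 1 ->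
  (forall M, (N <= M)%N -> `|x - y| <= C * r ^+ M) -> x = y.
Proof.
move=> r0 r1 h; apply/eqP; rewrite -subr_eq0 -normr_eq0; apply/eqP.
have c : C * r ^+ M @[M --> \oo] --> 0.
  rewrite -(mulr0 C); apply: cvgM; first exact: cvg_cst.
  by apply: cvg_expr; rewrite ger0_norm.
apply/eqP; rewrite eq_le normr_ge0 andbT.
apply: (cvgr_to_ge c).
by near=> M; apply: h; near: M; exact: nbhs_infty_ge.
Unshelve. all: by end_near. Qed.

Lemma continuous_logarg r : 0 <= r -> r < 1 ->
  continuous (fun x : R => ln (logarg r (2 * pi * x))).
Proof.
move=> r0 r1 x; apply: (@continuous_comp _ _ _ (fun x : R => logarg r (2 * pi * x)) (@ln R)).
  rewrite /logarg; apply: cvgD; last exact: cvg_cst.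
  apply: cvgB; first exact: cvg_cst.
  apply: cvgM; first exact: cvg_cst.
  exact: continuous_cos_lin.
by apply: continuous_ln; exact: logarg_gt0.
Qed.

Lemma Rintegral_log_partial r (m : int) b M :
  \int[mu]_(x in `[0, 1]) (log_partial r (2 * pi * x) M * cos (2 * pi * m%:~R * x + b)) =
  if (0 < `|m| <= M)%N then r ^+ `|m|%N / `|m|%:R * (cos b / 2) else 0.
Proof.
have ccc (j : nat) : continuous (fun x : R => cos (j%:R * (2 * pi * x)) * cos (2 * pi * m%:~R * x + b)).
  have -> : (fun x : R => cos (j%:R * (2 * pi * x)) * cos (2 * pi * m%:~R * x + b)) =
    (fun x => cos (j%:R * (2 * pi) * x) * cos (2 * pi * m%:~R * x + b)).
    by apply/funext => y; rewrite (mulrA j%:R).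
  by move=> x; apply: cvgM; [exact: continuous_cos_lin|exact: continuous_cos_affine].
have cl N : continuous (fun x : R => log_partial r (2 * pi * x) N * cos (2 * pi * m%:~R * x + b)).
  by move=> x; apply: cvgM; [exact: continuous_log_partial|exact: continuous_cos_affine].
elim: M => [|M IH].
  rewrite (@eq_Rintegral _ _ _ mu _ (fun=> 0)); last by move=> x _; rewrite /log_partial big_ord0 mul0r.
  by rewrite Rintegral_cst// mul0r leqn0; case: `|m|%N.
rewrite (@eq_Rintegral _ _ _ mu _ (fun x => log_partial r (2 * pi * x) M * cos (2 * pi * m%:~R * x + b) +
   r ^+ M.+1 / M.+1%:R * (cos (M.+1%:R * (2 * pi * x)) * cos (2 * pi * m%:~R * x + b)))); last first.
  by move=> x _; rewrite /log_partial big_ord_recr/= mulrDl -!mulrA.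
rewrite RintegralD//; last 2 first.
- exact: integrable_continuous_itv.
- by apply: integrable_continuous_itv => x; apply: cvgM; [exact: cvg_cst|exact: ccc].
rewrite RintegralZl//; last exact: integrable_continuous_itv.
rewrite IH Rintegral_cos_cos//.
case: (ltngtP `|m|%N M.+1) => [mM|mM|->].
- by rewrite mulr0 addr0; move: mM; rewrite ltnS => ->.
- by rewrite mulr0 addr0 (leqNgt _ M) (ltn_trans (ltnSn M) mM).
- by rewrite ltnn andbF add0r.
Qed.

(** Once the truncation order M reaches |m|, the coefficient of [log_partial] no longer depends on
    M, while the error is geometric in M. The free phase [b] treats cosine and sine coefficients
    together. *)
Lemma Rintegral_log_cos r (m : int) b : 0 <= r -> r < 1 ->
  \int[mu]_(x in `[0, 1]) (ln (logarg r (2 * pi * x)) * cos (2 * pi * m%:~R * x + b)) =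
  if m == 0 then 0 else - (r ^+ `|m|%N / `|m|%:R * cos b).
Proof.
move=> r0 r1.
pose C := 4 / (1 - r) ^+ 2.
apply: (@geometric_bound_eq _ _ C r `|m|%N) => // M mM.
pose g x := cos (2 * pi * m%:~R * x + b).
have cg : continuous g by exact: continuous_cos_affine.
have cL : continuous (fun x => ln (logarg r (2 * pi * x)) * g x).
  by move=> x; apply: cvgM; [exact: continuous_logarg|exact: cg].
have cP : continuous (fun x => log_partial r (2 * pi * x) M * g x).
  by move=> x; apply: cvgM; [exact: continuous_log_partial|exact: cg].
have -> : (if m == 0 then 0 else - (r ^+ `|m|%N / `|m|%:R * cos b)) =
   - 2 * \int[mu]_(x in `[0, 1]) (log_partial r (2 * pi * x) M * g x).
  rewrite Rintegral_log_partial mM andbT absz_gt0; case: eqVneq => _/=.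
    by rewrite mulr0.
  by rewrite mulNr mulrCA [2 * (cos b / 2)]mulrCA divff// mulr1.
rewrite mulNr opprK -RintegralZl//; last exact: integrable_continuous_itv.
have c2P : continuous (fun x => 2 * (log_partial r (2 * pi * x) M * g x)).
  by move=> x; apply: cvgM; [exact: cvg_cst|exact: cP].
rewrite -RintegralD//; [|exact: integrable_continuous_itv..].
apply: le_trans (le_normr_Rintegral _ _) _ => //.
  by apply: integrable_continuous_itv => x; apply: cvgD; [exact: cL|exact: c2P].
have -> : C * r ^+ M = \int[mu]_(x in `[0, 1]) (C * r ^+ M).
  by rewrite Rintegral_cst// [X in fine X](_ : _ = 1%E) ?mulr1//= lebesgue_measure_itv/= lte01/= oppr0 adde0.
apply: le_Rintegral => //.
- apply: integrable_continuous_itv => x; apply: cvg_norm.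
  by apply: cvgD; [exact: cL|exact: c2P].
- by apply: integrable_continuous_itv => x; exact: cvg_cst.
move=> x _.
rewrite mulrA -mulrDl normrM.
have := log_partial_err (2 * pi * x) M r0 r1.
have : r ^+ M.+1 <= r ^+ M by rewrite exprS; apply: ler_piMl; rewrite ?exprn_ge0// ltW.
have : 0 < ((1 - r) ^+ 2)^-1 by rewrite invr_gt0 exprn_gt0// subr_gt0.
rewrite /C; move: ((1 - r) ^+ 2)^-1 => i i0 rr h.
apply: (@le_trans _ _ (4 * r ^+ M.+1 * i * 1)).
  by apply: ler_pM => //; exact: cos_max.
by nra.
Qed.

End log_fourier.

(** * Fubini on the unit square from bounds on horizontal slices *)

Section fubini_square.
Context {R : realType}.
Local Notation mu := (@lebesgue_measure R).

Lemma measurable_fun_patch d (T : measurableType d) (D : set T) (f : T -> \bar R) :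
  measurable D -> measurable_fun setT f -> measurable_fun setT (f \_ D).
Proof. by move=> mD mf; apply/(measurable_restrictT f mD); exact: measurable_funTS. Qed.

(** The slices y = 0 and y = 1 are removed because the kernels below degenerate there (the radius r
    reaches 1). The two edges are null, so integrals over the closed square are unchanged. *)
Definition half_open_square : set (R * R) := `[0, 1] `*` `]0, 1[.

Lemma measurable_half_open_square : measurable half_open_square.
Proof. exact: measurableX. Qed.

Lemma measurable_square (a b : R) : measurable (square a b).
Proof. exact: measurableX. Qed.

Definition horizontal_edges : set (R * R) :=
  (setT : set R) `*` [set 0] `|` (setT : set R) `*` [set 1].

Lemma leb2_null_slice (c : R) : (leb2 R) ((setT : set R) `*` [set c]) = 0%E.
Proof. 
rewrite product_measure1E//.
by rewrite [X in (_ * X)%E](_ : _ = 0%E) ?mule0//; exact: lebesgue_measure_set1.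
Qed.

Lemma square_setD : half_open_square = square 0 1 `\` horizontal_edges.
Proof.
apply/seteqP; split => -[x y]; rewrite /half_open_square /square /=.
  rewrite !in_itv/= => -[/andP[x0 x1] /andP[y0 y1]].
  rewrite x0 x1 (ltW y0) (ltW y1); split => //.
  by move=> [[_ /= e]|[_ /= e]]; [move: y0|move: y1]; rewrite e ltxx.
rewrite !in_itv/= => -[[/andP[x0 x1] /andP[y0 y1]] h].
rewrite x0 x1; split => //; rewrite !lt_neqAle y0 y1 !andbT.
by apply/andP; split; apply/eqP => e; apply: h; [left|right].
Qed.

Lemma measurable_null2 : measurable horizontal_edges.
Proof. by apply: measurableU; exact: measurableX. Qed.

Lemma leb2_null2 : (leb2 R) horizontal_edges = 0%E.
Proof.
by apply: null_set_setU; [exact: measurableX..| exact: leb2_null_slice|exact: leb2_null_slice].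
Qed.

Lemma integral_xslice (g : R * R -> \bar R) (A B : set R) y :
  (\int[mu]_x (g \_ (A `*` B)) (x, y) =
  ((fun y => \int[mu]_(x in A) g (x, y)) \_ B) y)%E.
Proof.
rewrite {2}/patch; case: ifPn => yB.
  rewrite [RHS]integral_mkcond; apply: eq_integral => x _.
  by rewrite /patch in_setX/= yB andbT.
rewrite integral0_eq// => x _.
by rewrite /patch in_setX/= (negbTE yB) andbF.
Qed.

(** By Tonelli: a bound M on the L1 norms of all slices with 0 < y < 1 bounds the double integral by
    M. *)
Lemma integrable_half_open (f : R * R -> R) (M : R) : measurable_fun setT f ->
  (forall y, 0 < y < 1 -> (\int[mu]_(x in `[0%R, 1%R]) `|f (x, y)|%:E <= M%:E)%E) ->
  (leb2 R).-integrable half_open_square (EFin \o f).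
Proof.
move=> mf hM.
apply/integrable_mkcond; first exact: measurable_half_open_square.
have mp : measurable_fun setT ((EFin \o f) \_ half_open_square).
  by apply: measurable_fun_patch; [exact: measurable_half_open_square|exact/measurable_EFinP].
apply/integrable21ltyP => //.
apply: (@le_lt_trans _ _ (\int[mu]_y (((fun=> M%:E) \_ `]0%R, 1%R[) y))%E).
  apply: ge0_le_integral => //.
  - by move=> y _; exact: integral_ge0.
  - have := @measurable_fun_fubini_tonelli_G _ _ _ _ R mu (fun z => `|((EFin \o f) \_ half_open_square) z|%E).
    by apply => //; exact: measurableT_comp.
  - exact: measurable_fun_patch.
  move=> y _.
  have -> : (\int[mu]_x `|((EFin \o f) \_ half_open_square) (x, y)| =
     \int[mu]_x (((fun z => `|f z|%:E) \_ half_open_square) (x, y)))%E.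
    by apply: eq_integral => x _; rewrite /patch; case: ifP => _; rewrite ?abse0.
  rewrite integral_xslice /patch; case: ifPn => //.
  by rewrite inE/= in_itv/= => h; exact: hM.
rewrite -integral_mkcond integral_cst//= [X in (_ * X)%E](_ : _ = 1%E) ?mule1 ?ltry//.
by rewrite lebesgue_measure_itv/= lte01/= oppr0 adde0.
Qed.

Lemma integrable_square (f : R * R -> R) (M : R) : measurable_fun setT f ->
  (forall y, 0 < y < 1 -> (\int[mu]_(x in `[0%R, 1%R]) `|f (x, y)|%:E <= M%:E)%E) ->
  (leb2 R).-integrable (square 0 1) (EFin \o f).
Proof.
move=> mf hM; apply/(negligible_integrable _ _ _ leb2_null2).
- exact: measurable_null2.
- exact: measurable_square.
- by apply: measurable_funTS; exact/measurable_EFinP.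
- by rewrite -square_setD; exact: integrable_half_open hM.
Qed.

Lemma Fubini_square (f : R * R -> R) (h : R -> R) :
  (leb2 R).-integrable (square 0 1) (EFin \o f) ->
  (forall y, 0 < y < 1 -> (\int[mu]_(x in `[0%R, 1%R]) (f (x, y))%:E = (h y)%:E)%E) ->
  \int[leb2 R]_(z in square 0 1) f z = \int[mu]_(y in `]0, 1[) h y.
Proof.
move=> intf hh; congr fine.
have intf' : (leb2 R).-integrable half_open_square (EFin \o f).
  rewrite square_setD.
  have mf : measurable_fun (square 0 1) (EFin \o f) by move/integrableP : intf => [].
  by have [H _] := negligible_integrable (mu := leb2 R) measurable_null2 (measurable_square 0 1) mf leb2_null2; exact: H.
rewrite (negligible_integral (mu := leb2 R) measurable_null2 (measurable_square 0 1) intf leb2_null2) -square_setD.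
have intP : (leb2 R).-integrable setT ((EFin \o f) \_ half_open_square).
  by have [H _] := integrable_mkcond (mu := leb2 R) (EFin \o f) measurable_half_open_square; exact: H.
rewrite integral_mkcond -(integral21_prod_meas1 intP).
rewrite [RHS]integral_mkcond; apply: eq_integral => y _.
rewrite /fubini_G integral_xslice /patch; case: ifPn => //.
by rewrite inE/= in_itv/= => hy; exact: hh.
Qed.

End fubini_square.

(** * Kronecker's closed form for the periodic Green function *)

Section kernel.
Context {R : realType}.
Implicit Types (r s x y t th b : R) (M n : nat).
Local Notation mu := (@lebesgue_measure R).

Lemma ln_logarg_le2 r th : 0 <= r -> r < 1 -> ln (logarg r th) <= 2 * r.
Proof.
move=> r0 r1.
apply: (@le_trans _ _ (ln ((1 + r) ^+ 2))).
  rewrite ler_ln ?posrE ?exprn_gt0 ?logarg_gt0 ?logarg_le//; lra.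
rewrite lnXn; last lra.
by rewrite mulr2n mulrDl mul1r; apply: lerD; apply: le_ln1Dx; lra.
Qed.

Lemma ln_sqr_onem_ge r : 0 <= r -> r <= 2^-1 -> - (4 * r) <= ln ((1 - r) ^+ 2).
Proof.
move=> r0 r1; rewrite lnXn; last lra.
have : ln (1 + r / (1 - r)) <= r / (1 - r).
  by apply: le_ln1Dx; apply: (@lt_le_trans _ _ 0); [lra|apply: divr_ge0; lra].
have -> : 1 + r / (1 - r) = (1 - r)^-1 by field; lra.
rewrite lnV ?posrE; last lra.
have : r / (1 - r) <= 2 * r by rewrite ler_pdivrMr; [nra|lra].
by rewrite mulr2n; lra.
Qed.

Lemma normr_ln_logarg r th : 0 <= r -> r <= 2^-1 -> `|ln (logarg r th)| <= 4 * r.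
Proof.
move=> r0 r1; rewrite ler_norml; apply/andP; split; last first.
  by have := ln_logarg_le2 th r0; lra.
apply: le_trans (ln_sqr_onem_ge r0 r1) _.
by rewrite ler_ln ?posrE ?exprn_gt0 ?logarg_gt0 ?logarg_ge//; lra.
Qed.

Lemma integral_itv01_cst (c : R) : \int[mu]_(x in `[0, 1]) c = c.
Proof.
rewrite Rintegral_cst// [X in fine X](_ : _ = 1%E) ?mulr1//=.
by rewrite lebesgue_measure_itv/= lte01/= oppr0 adde0.
Qed.

(* The mean of the kernel over a period vanishes, so its L1 norm is twice the
   integral of its positive part. *)
Lemma Rintegral_norm_log r : 0 <= r -> r < 1 ->
  (\int[mu]_(x in `[0%R, 1%R]) `|ln (logarg r (2 * pi * x))|%:E <= 4%:E)%E.
Proof.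
move=> r0 r1.
have cl := continuous_logarg r0 r1.
have cn : continuous (fun x => `|ln (logarg r (2 * pi * x))|).
  by move=> x; apply: cvg_norm; exact: cl.
have int0 : \int[mu]_(x in `[0, 1]) ln (logarg r (2 * pi * x)) = 0.
  rewrite -[RHS](Rintegral_log_cos 0 0 r0 r1).
  by apply: eq_Rintegral => x _; rewrite mulr0 mul0r addr0 cos0 mulr1.
have fi : (\int[mu]_(x in `[0%R, 1%R]) `|ln (logarg r (2 * pi * x))|%:E)%E \is a fin_num.
  by apply: integrable_fin_num => //; exact: (integrable_continuous_itv 0 1 cn).
rewrite -(fineK fi) lee_fin.
(* The logarithm l is at most 2, so |l| <= 4 - l whatever its sign; l then integrates to zero. *)
apply: (@le_trans _ _ (\int[mu]_(x in `[0, 1]) (4 - ln (logarg r (2 * pi * x))))).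
  apply: le_Rintegral => //.
  - exact: integrable_continuous_itv.
  - by apply: integrable_continuous_itv => x; apply: cvgB; [exact: cvg_cst|exact: cl].
  move=> x _; have := ln_logarg_le2 (2 * pi * x) r0 r1.
  by case: (ger0P (ln (logarg r (2 * pi * x)))) => h; lra.
rewrite RintegralB//; last 2 first.
- by apply: integrable_continuous_itv => x; exact: cvg_cst.
- exact: integrable_continuous_itv.
by rewrite int0 subr0 integral_itv01_cst.
Qed.

(** The power q^t of the nome q = e^(-2 pi), that is q = e^(2 i pi tau) at tau = i. *)
Definition decay t : R := expR (- (2 * pi * t)).

Lemma decay_gt0 t : 0 < decay t. Proof. exact: expR_gt0. Qed.

Lemma decay_lt1 t : 0 < t -> decay t < 1.
Proof. by move=> t0; rewrite expR_lt1 oppr_lt0 !mulr_gt0// pi_gt0. Qed.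

Lemma decay_le t u : t <= u -> decay u <= decay t.
Proof. by move=> tu; rewrite ler_expR lerN2 ler_pM2l// mulr_gt0// pi_gt0. Qed.

Lemma decayD t u : decay (t + u) = decay t * decay u.
Proof. by rewrite /decay mulrDr opprD expRD. Qed.

Lemma decay1_le : decay 1 <= 2^-1.
Proof.
rewrite /decay mulr1 expRN lef_pV2 ?posrE ?expR_gt0//.
by apply: le_trans (expR_ge1Dx _); have := @pi_ge2 R; lra.
Qed.

Lemma decay_nat n : decay n%:R = decay 1 ^+ n.
Proof.
elim: n => [|n IH]; first by rewrite /decay mulr0 oppr0 expR0.
by rewrite -natr1 decayD IH exprSr.
Qed.

Lemma decay_nat_le n : decay n%:R <= (2^-1) ^+ n.
Proof. by rewrite decay_nat; apply: lerXn2r; rewrite ?nnegrE ?invr_ge0 ?decay1_le// ltW// decay_gt0. Qed.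

(** With z = x + i t this is ln |1 - e^(2 i pi z)|^2. *)
Definition logker x t : R := ln (logarg (decay t) (2 * pi * x)).

Lemma logker_bound x t n : n.+1%:R <= t -> `|logker x t| <= 4 * (2^-1) ^+ n.+1.
Proof.
move=> nt; have h : decay t <= (2^-1) ^+ n.+1.
  by apply: le_trans (decay_le nt) _; exact: decay_nat_le.
apply: (@le_trans _ _ (4 * decay t)); last lra.
apply: normr_ln_logarg; first exact/ltW/decay_gt0.
apply: le_trans h _; rewrite exprS; apply: ler_piMr; first lra.
by apply: exprn_ile1; lra.
Qed.

(** Logarithm of the pair of theta factors |1 - q^(n+1) e^(2 i pi z)|^2 and |1 - q^(n+1) e^(-2 i pi
    z)|^2, with z = x + i y. *)
Definition kterm x y n : R := logker x (n.+1%:R + y) + logker x (n.+1%:R - y).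

(** Index 0 is left out: it contains [logker x (1 - y)] and [logker x (1 + y)], one of which is
    singular when |y| = 1 and x is an integer. This is why truncations are counted from [n.+1] in
    the error bounds. *)
Lemma kterm_bound x y n : `|y| <= 1 -> `|kterm x y n.+1| <= 8 * (2^-1) ^+ n.+1.
Proof.
rewrite ler_norml => /andP[y0 y1].
apply: le_trans (ler_normD _ _) _.
have -> : 8 * (2^-1) ^+ n.+1 = 4 * (2^-1) ^+ n.+1 + 4 * (2^-1) ^+ n.+1 :> R by ring.
by apply: lerD; apply: logker_bound; rewrite -(natr1 n.+1); lra.
Qed.

Definition ksum n x y : R := \sum_(k < n) kterm x y k.
Definition klim x y : R := limn (fun n => ksum n x y).

Lemma ksum_cauchy n p x y : `|y| <= 1 ->
  `|ksum (n.+1 + p) x y - ksum n.+1 x y| <= 16 * (2^-1) ^+ n.+1 * (1 - (2^-1) ^+ p).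
Proof.
move=> y1; elim: p => [|p IH].
  by rewrite addn0 subrr normr0 expr0 subrr mulr0.
rewrite addnS /ksum big_ord_recr/= -/(ksum _ _ _) addrAC.
apply: le_trans (ler_normD _ _) _.
have h := kterm_bound x (n + p) y1.
apply: le_trans (lerD IH h) _.
rewrite -addSn exprD (exprS _ p); lra.
Qed.

Lemma ksum_dist n m x y : `|y| <= 1 -> (n.+1 <= m)%N ->
  `|ksum m x y - ksum n.+1 x y| <= 16 * (2^-1) ^+ n.+1.
Proof.
move=> y1 nm; rewrite -(subnKC nm); apply: le_trans (ksum_cauchy _ _ _ y1) _.
apply: ler_piMr; first by rewrite mulr_ge0// exprn_ge0// invr_ge0.
by rewrite gerBl exprn_ge0// invr_ge0.
Qed.

Lemma half_expn_cvg (C : R) : C * (2^-1) ^+ n @[n --> \oo] --> (0 : R).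
Proof.
rewrite -[X in _ --> X](mulr0 C); apply: cvgM; first exact: cvg_cst.
by apply: cvg_expr; rewrite ger0_norm; lra.
Qed.

Lemma is_cvg_ksum x y : `|y| <= 1 -> cvgn (fun n => ksum n x y).
Proof.
move=> y1; apply/cauchy_cvgP/cauchy_ballP => e e0.
have /cvgrPdist_lt/(_ _ (divr_gt0 e0 (ltr0n _ 2)))[N _ hN] := half_expn_cvg 16.
have hb : 16 * 2^-1 ^+ N.+1 < e / 2.
  have := hN N.+1 (leqnSn N); rewrite sub0r normrN ger0_norm// mulr_ge0// exprn_ge0// invr_ge0//.
pose B := [set z : R | `|z - ksum N.+1 x y| < e / 2].
exists (B, B); first by split; exists N.+1 => //= m hm; apply: le_lt_trans hb; exact: ksum_dist.
move=> [z1 z2] /= [h1 h2]; rewrite -ball_normE/= [e]splitr.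
apply: le_lt_trans (ltrD h1 h2).
by rewrite [ `|z2 - _|]distrC; exact: ler_distD.
Qed.

Lemma klim_err n x y : `|y| <= 1 -> `|klim x y - ksum n.+1 x y| <= 16 * (2^-1) ^+ n.+1.
Proof.
move=> y1; have c : `|ksum m x y - ksum n.+1 x y| @[m --> \oo] --> `|klim x y - ksum n.+1 x y|.
  by apply: cvg_norm; apply: cvgB; [exact: is_cvg_ksum|exact: cvg_cst].
apply: (cvgr_to_le c); near=> m; apply: ksum_dist => //.
by near: m; exact: nbhs_infty_ge.
Unshelve. all: by end_near. Qed.

(** 2 pi^2 times the second Bernoulli polynomial; the constant 1/6 makes its mean over [0,1]
    zero. *)
Definition kpoly y : R := 2 * pi ^+ 2 * (y ^+ 2 - y + 6^-1).
(** Kronecker's second limit formula at tau = i: the candidate for E_1 at x + i y, valid in the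
    strip 0 < y < 1. *)
Definition kfun x y : R := kpoly y - pi * (logker x y + klim x y).
Definition kfunn n x y : R := kpoly y - pi * (logker x y + ksum n x y).

Lemma kfun_err n x y : `|y| <= 1 -> `|kfun x y - kfunn n.+1 x y| <= pi * 16 * (2^-1) ^+ n.+1.
Proof.
move=> y1; rewrite /kfun /kfunn.
have -> : kpoly y - pi * (logker x y + klim x y) - (kpoly y - pi * (logker x y + ksum n.+1 x y))
  = - (pi * (klim x y - ksum n.+1 x y)) by ring.
rewrite normrN normrM gtr0_norm ?pi_gt0// -mulrA ler_pM2l ?pi_gt0//.
exact: klim_err.
Qed.

Lemma logkerN x t : logker (- x) t = logker x t.
Proof. by rewrite /logker /logarg mulrN cosN. Qed.

Lemma logkerD1 x t : logker (x + 1) t = logker x t.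
Proof.
rewrite /logker /logarg mulrDr mulr1.
by have -> : 2 * pi = pi *+ 2 :> R; [rewrite mulr_natl|rewrite cosD2pi].
Qed.

Lemma kfunN x y : kfun (- x) y = kfun x y.
Proof.
rewrite /kfun /klim logkerN.
have -> // : (fun n => ksum n (- x) y) = (fun n => ksum n x y).
by apply/funext => n; apply: eq_bigr => k _; rewrite /kterm !logkerN.
Qed.

Lemma kfunD1 x y : kfun (x + 1) y = kfun x y.
Proof.
rewrite /kfun /klim logkerD1.
have -> // : (fun n => ksum n (x + 1) y) = (fun n => ksum n x y).
by apply/funext => n; apply: eq_bigr => k _; rewrite /kterm !logkerD1.
Qed.

(** Replacing y by 1 - y exchanges the two families of factors with a shift of one index, so the
    truncated sums differ only by two boundary factors, which decay in n. *)
Lemma ksum_reflect n x y : logker x (1 - y) + ksum n x (1 - y) =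
  logker x y + ksum n x y + logker x (n.+1%:R - y) - logker x (n%:R + y).
Proof.
elim: n => [|n IH].
  rewrite /ksum !big_ord0 add0r; ring.
rewrite /ksum !big_ord_recr/= addrA -/(ksum n x (1 - y)) IH /kterm -/(ksum n x y).
have -> : n.+1%:R + (1 - y) = n.+2%:R - y by rewrite -(natr1 n.+1); ring.
have -> : n.+1%:R - (1 - y) = n%:R + y by rewrite -(natr1 n); ring.
ring.
Qed.

(** [kpoly] is symmetric about 1/2, and the boundary factors left by [ksum_reflect] are
    exponentially small. *)
Lemma kfun_reflect x y : 0 <= y -> y <= 1 -> kfun x (1 - y) = kfun x y.
Proof.
move=> y0 y1.
(* Any constant from 40 pi on would do: two truncation errors contribute 16 pi each and the boundary
   factors 8 pi. *)
apply: (@geometric_bound_eq _ _ _ (100 * pi) 2^-1 2); [lra|lra|] => -[|[|M]]// _.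
have a1 : `|y| <= 1 by rewrite ger0_norm.
have a2 : `|1 - y| <= 1 by rewrite ler_norml; lra.
have h1 := kfun_err M.+1 x a1; have h2 := kfun_err M.+1 x a2.
have h3 : `|logker x (M.+3%:R - y)| <= 4 * 2^-1 ^+ M.+2.
  by apply: logker_bound; rewrite -(natr1 M.+2); lra.
have h4 : `|logker x (M.+2%:R + y)| <= 4 * 2^-1 ^+ M.+2 by apply: logker_bound; lra.
have E : kfunn M.+2 x (1 - y) - kfunn M.+2 x y = - pi * (logker x (M.+3%:R - y) - logker x (M.+2%:R + y)).
  have -> : kfunn M.+2 x (1 - y) - kfunn M.+2 x y =
    kpoly (1 - y) - kpoly y - pi * ((logker x (1 - y) + ksum M.+2 x (1 - y)) - (logker x y + ksum M.+2 x y)).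
    by rewrite /kfunn; ring.
  rewrite ksum_reflect /kpoly; ring.
have -> : kfun x (1 - y) - kfun x y = (kfun x (1 - y) - kfunn M.+2 x (1 - y)) - (kfun x y - kfunn M.+2 x y)
   + (kfunn M.+2 x (1 - y) - kfunn M.+2 x y) by ring.
apply: le_trans (ler_normD _ _) _.
apply: le_trans (lerD (ler_normB _ _) (lexx _)) _.
have h5 : `|kfunn M.+2 x (1 - y) - kfunn M.+2 x y| <= pi * (8 * 2^-1 ^+ M.+2).
  rewrite E normrM normrN (gtr0_norm (pi_gt0 R)); apply: ler_wpM2l; first exact: pi_ge0.
  apply: le_trans (ler_normB _ _) _; lra.
have p0 : 0 < pi * 2^-1 ^+ M.+2 :> R by rewrite mulr_gt0 ?pi_gt0// exprn_gt0// invr_gt0.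
lra.
Qed.

End kernel.

(** * Fourier coefficients of the logarithmic factors on the square *)

Section kernel_coef.
Context {R : realType}.
Implicit Types (r s x y t th b c : R) (M n : nat).
Local Notation mu := (@lebesgue_measure R).

Lemma measurable_logker c s : measurable_fun setT (fun z : R * R => logker z.1 (c + s * z.2)).
Proof.
have m1 : measurable_fun setT (fun z : R * R => decay (c + s * z.2)).
  rewrite /decay; apply: measurableT_comp => //; apply: measurableT_comp => //.
  apply: measurable_funM => //; apply: measurable_funD => //.
  by apply: measurable_funM => //; exact: measurable_snd.
have m2 : measurable_fun setT (fun z : R * R => cos (2 * pi * z.1)).
  apply: measurableT_comp; first exact: continuous_measurable_fun (@continuous_cos R).
  by apply: measurable_funM => //; exact: measurable_fst.
rewrite /logker /logarg; apply: measurableT_comp; first exact: measurable_ln.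
apply: measurable_funD; last exact: measurable_funX.
by apply: measurable_funB => //; do 2 apply: measurable_funM => //.
Qed.

Lemma integrable_addr d (T : measurableType d) (nu : {measure set T -> \bar R})
    (D : set T) (f g : T -> R) : measurable D -> nu.-integrable D (EFin \o f) ->
  nu.-integrable D (EFin \o g) -> nu.-integrable D (EFin \o (fun z => f z + g z)).
Proof.
move=> mD mf mg; rewrite (_ : EFin \o _ = ((EFin \o f) \+ (EFin \o g))%E)//.
exact: integrableD.
Qed.

(** A phased character: b = 0 gives the cosine and b = pi/2 the sine, so this one family encodes
    real and imaginary parts of all Fourier coefficients. *)
Definition wave (m n : int) (b : R) (z : R * R) : R :=
  cos (2 * pi * m%:~R * z.1 + (2 * pi * n%:~R * z.2 - b)).

Lemma measurable_wave (m n : int) b : measurable_fun setT (wave m n b).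
Proof.
apply: measurableT_comp; first exact: continuous_measurable_fun (@continuous_cos R).
apply: measurable_funD.
  by apply: measurable_funM => //; exact: measurable_fst.
apply: measurable_funB => //.
by apply: measurable_funM => //; exact: measurable_snd.
Qed.

Lemma integrable_mul_wave (f : R * R -> R) (m n : int) b : 
  (leb2 R).-integrable (square 0 1) (EFin \o f) ->
  (leb2 R).-integrable (square 0 1) (EFin \o (fun z => f z * wave m n b z)).
Proof.
move=> intf; have mf : measurable_fun (square 0 1) f by apply/measurable_EFinP; move/integrableP : intf => [].
apply: le_integrable intf.
- exact: measurable_square.
- apply/measurable_EFinP; apply: measurable_funM => //.
  by apply: measurable_funTS; exact: measurable_wave.
move=> z _ /=; rewrite lee_fin normrM ler_piMr//; exact: cos_max.
Qed.

Lemma integrable_logker c s : (forall y, 0 < y < 1 -> 0 < c + s * y) ->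
  (leb2 R).-integrable (square 0 1) (EFin \o (fun z => logker z.1 (c + s * z.2))).
Proof.
move=> h; apply: (@integrable_square _ _ 4); first exact: measurable_logker.
move=> y /h cy; rewrite /logker /=.
exact: (@Rintegral_norm_log R _ (ltW (decay_gt0 _)) (decay_lt1 cy)).
Qed.

Lemma decayX t n : decay t ^+ n = decay (n%:R * t).
Proof.
elim: n => [|n IH]; first by rewrite mul0r /decay mulr0 oppr0 expR0 expr0.
by rewrite exprSr IH -natr1 mulrDl mul1r decayD.
Qed.

(** An explicit antiderivative of exponential times cosine; s is the sign +1 or -1, and s^2 = 1
    makes the denominator a^2 + w^2. *)
Lemma integral_decay_cos (a w c s b : R) : s ^+ 2 = 1 -> 0 < a ->
  \int[mu]_(y in `]0, 1[) (expR (- (a * (c + s * y))) * cos (w * y - b)) =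
  (expR (- (a * (c + s))) * (w * sin (w - b) - a * s * cos (w - b))
    + expR (- (a * c)) * (w * sin b + a * s * cos b)) / (a ^+ 2 + w ^+ 2).
Proof.
move=> s1 a0; have D0 : a ^+ 2 + w ^+ 2 != 0.
  by apply: lt0r_neq0; rewrite ltr_pwDl ?exprn_gt0// sqr_ge0.
pose F y := (a ^+ 2 + w ^+ 2)^-1 * (expR (- (a * (c + s * y))) * (w * sin (w * y - b) - a * s * cos (w * y - b))).
have dF y : is_derive y 1 F (expR (- (a * (c + s * y))) * cos (w * y - b)).
  have d1 : is_derive y 1 (fun y => w * y - b) w.
    by apply: is_derive_eq; rewrite ?scaler0 ?addr0 ?add0r ?subr0 /GRing.scale/=; ring.
  have d2 : is_derive y 1 (fun y => - (a * (c + s * y))) (- (a * s)).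
    by apply: is_derive_eq; rewrite ?scaler0 ?addr0 ?add0r ?subr0 /GRing.scale/=; ring.
  have ds := @is_derive1_comp _ (@sin R) _ _ _ _ (is_derive_sin _) d1.
  have dc := @is_derive1_comp _ (@cos R) _ _ _ _ (is_derive_cos _) d1.
  have de := @is_derive1_comp _ (@expR R) _ _ _ _ (is_derive_expR _) d2.
  have dz := is_deriveB (@is_deriveZ _ _ _ _ w _ _ _ ds) (@is_deriveZ _ _ _ _ (a * s) _ _ _ dc).
  have dm := @is_deriveZ _ _ _ _ (a ^+ 2 + w ^+ 2)^-1 _ _ _ (is_deriveM de dz).
  move: dm; set d := (X in is_derive _ _ _ X -> _).
  suff -> : d = expR (- (a * (c + s * y))) * cos (w * y - b) by exact: etrans_derive.
  rewrite /d /GRing.scale/=.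
  have -> : forall e S C : R, (a ^+ 2 + w ^+ 2)^-1 * (e * (w * (C * w) - a * s * (- S * w)) + (w * S - a * s * C) * (e * - (a * s))) = e * C * ((a ^+ 2 * s ^+ 2 + w ^+ 2) / (a ^+ 2 + w ^+ 2)).
    by move=> e S C; ring.
  by rewrite s1 mulr1 divff// mulr1.
have cf : continuous (fun y => expR (- (a * (c + s * y))) * cos (w * y - b)).
  move=> y; apply: cvgM; last exact: (@continuous_cos_affine _ w (- b)).
  apply: (@continuous_comp _ _ _ (fun y => - (a * (c + s * y))) expR); last exact: continuous_expR.
  apply: cvgN; apply: cvgM; first exact: cvg_cst.
  apply: cvgD; first exact: cvg_cst.
  by apply: cvgM; [exact: cvg_cst|exact: cvg_id].
have intf : mu.-integrable `[0, 1] (EFin \o (fun y => expR (- (a * (c + s * y))) * cos (w * y - b))).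
  exact: integrable_continuous_itv.
have into : mu.-integrable `]0, 1] (EFin \o (fun y => expR (- (a * (c + s * y))) * cos (w * y - b))).
  by apply: integrableS intf => //; apply: subset_itv_oc_cc.
have intoo : mu.-integrable `]0, 1[ (EFin \o (fun y => expR (- (a * (c + s * y))) * cos (w * y - b))).
  by apply: integrableS intf => //; apply: subset_itv_oo_cc.
rewrite Rintegral_itv_bndo_bndc// Rintegral_itv_obnd_cbnd//.
rewrite (Rintegral_FTC ltr01 dF cf) /F !mulr1 !mulr0 addr0 sub0r sinN cosN.
by field.
Qed.

Lemma open_itv_Rintegral (f : R -> R) : continuous f ->
  \int[mu]_(y in `]0, 1[) f y = \int[mu]_(y in `[0, 1]) f y.
Proof.
move=> cf; have intf := integrable_continuous_itv 0 1 cf.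
rewrite Rintegral_itv_bndo_bndc; last by apply: integrableS intf => //; apply: subset_itv_oo_cc.
by rewrite Rintegral_itv_obnd_cbnd//; apply: integrableS intf => //; apply: subset_itv_oc_cc.
Qed.


(** Integrating in x first leaves the |m|-th power of the radius, an exponential in y. The phase in
    y has integer frequency, so both endpoints see the same [b] and only a difference of two
    exponentials survives. *)
Lemma coef_logker c s (m n : int) b : s ^+ 2 = 1 ->
  (forall y, 0 < y < 1 -> 0 < c + s * y) ->
  \int[leb2 R]_(z in square 0 1) (logker z.1 (c + s * z.2) * wave m n b z) =
  if m == 0 then 0 else
  - (`|m|%:R^-1 * (decay (`|m|%:R * c) - decay (`|m|%:R * (c + s))) *
     (2 * pi * n%:~R * sin b + 2 * pi * `|m|%:R * s * cos b)
     / ((2 * pi * `|m|%:R) ^+ 2 + (2 * pi * n%:~R) ^+ 2)).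
Proof.
move=> s1 h.
pose H y := if m == 0 then 0 else
  - (`|m|%:R^-1 * (expR (- (2 * pi * `|m|%:R * (c + s * y))) * cos (2 * pi * n%:~R * y - b))).
rewrite (@Fubini_square _ _ H); last 2 first.
- exact/integrable_mul_wave/integrable_logker.
- move=> y /h cy.
  have r0 := ltW (decay_gt0 (c + s * y)); have r1 := decay_lt1 cy.
  have cf : continuous (fun x => logker x (c + s * y) * wave m n b (x, y)).
    by move=> x; apply: cvgM; [exact: continuous_logarg|exact: continuous_cos_affine].
  have fi : (\int[mu]_(x in `[0%R, 1%R]) (logker x (c + s * y) * wave m n b (x, y))%:E)%E \is a fin_num.
    by apply: integrable_fin_num => //; exact: (integrable_continuous_itv 0 1 cf).
  rewrite -(fineK fi); congr EFin.
  rewrite -[LHS]/(\int[mu]_(x in `[0, 1]) (logker x (c + s * y) * wave m n b (x, y))).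
  apply: etrans (Rintegral_log_cos m (2 * pi * n%:~R * y - b) r0 r1) _.
  rewrite /H; case: ifP => // _.
  by rewrite decayX /decay mulrAC mulrC; congr (- (_ * (expR (- _) * _))); ring.
rewrite /H; case: eqVneq => [_|m0]; first by rewrite Rintegral_cst// mul0r.
have a0 : 0 < 2 * pi * `|m|%:R :> R by rewrite !mulr_gt0 ?pi_gt0// ltr0n absz_gt0.
have cf : continuous (fun y : R => expR (- (2 * pi * `|m|%:R * (c + s * y))) * cos (2 * pi * n%:~R * y - b)).
  move=> y; apply: cvgM; last exact: (@continuous_cos_affine _ (2 * pi * n%:~R) (- b)).
  apply: (@continuous_comp _ _ _ (fun y => - (2 * pi * `|m|%:R * (c + s * y))) expR); last exact: continuous_expR.
  apply: cvgN; apply: cvgM; first exact: cvg_cst.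
  apply: cvgD; first exact: cvg_cst.
  by apply: cvgM; [exact: cvg_cst|exact: cvg_id].
under eq_Rintegral do rewrite -mulNr.
rewrite RintegralZl//; last first.
  by apply: integrableS (integrable_continuous_itv 0 1 cf) => //; apply: subset_itv_oo_cc.
rewrite integral_decay_cos// sin_int cos_int sinN cosN /decay.
have -> : forall t, 2 * pi * (`|m|%:R * t) = 2 * pi * `|m|%:R * t :> R by move=> t; ring.
have -> : forall t, 2 * pi * (`|m|%:R * t) = 2 * pi * `|m|%:R * t :> R by move=> t; ring.
by rewrite !mulNr; congr (- _); ring.
Qed.

Lemma integrable_kterm k :
  (leb2 R).-integrable (square 0 1) (EFin \o (fun z => kterm z.1 z.2 k)).
Proof.
have h1 : forall y, 0 < y < 1 -> 0 < k.+1%:R + 1 * y.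
  by move=> y /andP[y0 _]; rewrite mul1r ltr_wpDl.
have h2 : forall y, 0 < y < 1 -> 0 < k.+1%:R + -1 * y.
  move=> y /andP[_ y1]; rewrite mulN1r subr_gt0; apply: lt_le_trans y1 _.
  by rewrite ler1n.
have -> : (fun z : R * R => kterm z.1 z.2 k) =
    (fun z => logker z.1 (k.+1%:R + 1 * z.2) + logker z.1 (k.+1%:R + -1 * z.2)).
  by apply/funext => z; rewrite /kterm mul1r mulN1r.
exact: (integrable_addr (nu := leb2 R) (measurable_square 0 1) (integrable_logker h1) (integrable_logker h2)).
Qed.

Lemma integrable_ksum M :
  (leb2 R).-integrable (square 0 1) (EFin \o (fun z => ksum M z.1 z.2)).
Proof.
elim: M => [|M IH].
  have -> : EFin \o (fun z : R * R => ksum 0 z.1 z.2) = cst 0%E.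
    by apply/funext => z; rewrite /ksum /= big_ord0.
  exact: integrable0.
have -> : EFin \o (fun z : R * R => ksum M.+1 z.1 z.2) = ((EFin \o (fun z => ksum M z.1 z.2)) \+ (EFin \o (fun z => kterm z.1 z.2 M)))%E.
  by apply/funext => z; rewrite /ksum /= big_ord_recr.
by apply: integrableD; [exact: measurable_square|exact: IH|exact: integrable_kterm].
Qed.

(** As the index runs, the arguments n + y and n - y tile an interval of the half-line, so the
    endpoint exponentials of [coef_logker] telescope. The factors in + y cover [0, M+1] because of
    the extra [logker x y], those in - y cover [0, M]. *)
Lemma coef_ksum M (m n : int) b : m != 0 ->
  \int[leb2 R]_(z in square 0 1) ((logker z.1 z.2 + ksum M z.1 z.2) * wave m n b z) =
  - (`|m|%:R^-1 *
    ((1 - decay `|m|%:R ^+ M.+1) * (2 * pi * `|m|%:R * cos b + 2 * pi * n%:~R * sin b)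
    + (1 - decay `|m|%:R ^+ M) * (2 * pi * `|m|%:R * cos b - 2 * pi * n%:~R * sin b))
    / ((2 * pi * `|m|%:R) ^+ 2 + (2 * pi * n%:~R) ^+ 2)).
Proof.
move=> m0.
have mS := @measurable_square R 0 1.
have dX c k : decay (`|m|%:R * (c + k%:R)) = decay (`|m|%:R * c) * decay `|m|%:R ^+ k :> R.
  by rewrite mulrDr decayD decayX mulrC [k%:R * _]mulrC mulrC.
have dX0 k : decay (`|m|%:R * k%:R) = decay `|m|%:R ^+ k :> R by rewrite decayX mulrC.
elim: M => [|M IH].
  have -> : (fun z : R * R => (logker z.1 z.2 + ksum 0 z.1 z.2) * wave m n b z) =
    (fun z => logker z.1 (0 + 1 * z.2) * wave m n b z).
    by apply/funext => z; rewrite /ksum big_ord0 addr0 add0r mul1r.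
  rewrite coef_logker ?expr1n// ?(negbTE m0); last by move=> y /andP[y0 _]; rewrite add0r mul1r.
  rewrite add0r mulr1 mulr0 expr0 subrr mul0r addr0 expr1 [decay 0]/decay mulr0 oppr0 expR0.
  by congr (- (_ / _)); ring.
have i1 : (leb2 R).-integrable (square 0 1) (EFin \o (fun z : R * R => logker z.1 z.2)).
  have -> : (fun z : R * R => logker z.1 z.2) = (fun z => logker z.1 (0 + 1 * z.2)).
    by apply/funext => z; rewrite add0r mul1r.
  by apply: integrable_logker => y /andP[y0 _]; rewrite add0r mul1r.
have i2 : (leb2 R).-integrable (square 0 1) (EFin \o (fun z : R * R => logker z.1 z.2 + ksum M z.1 z.2)).
  by apply: (integrable_addr (nu := leb2 R) mS i1); exact: integrable_ksum.
have h1 : forall y, 0 < y < 1 -> 0 < M.+1%:R + 1 * y.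
  by move=> y /andP[y0 _]; rewrite mul1r ltr_wpDl.
have h2 : forall y, 0 < y < 1 -> 0 < M.+1%:R + -1 * y.
  move=> y /andP[_ y1]; rewrite mulN1r subr_gt0; apply: lt_le_trans y1 _.
  by rewrite ler1n.
have -> : (fun z : R * R => (logker z.1 z.2 + ksum M.+1 z.1 z.2) * wave m n b z) =
  (fun z => (logker z.1 z.2 + ksum M z.1 z.2) * wave m n b z +
    (logker z.1 (M.+1%:R + 1 * z.2) * wave m n b z + logker z.1 (M.+1%:R + -1 * z.2) * wave m n b z)).
  by apply/funext => z; rewrite /ksum big_ord_recr/= /kterm mul1r mulN1r; ring.
have j1 := integrable_mul_wave m n b (integrable_logker h1).
have j2 := integrable_mul_wave m n b (integrable_logker h2).
rewrite RintegralD//; last 2 first.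
- exact: integrable_mul_wave.
- exact: (integrable_addr (nu := leb2 R) mS j1 j2).
rewrite IH RintegralD// !coef_logker ?expr1n ?sqrrN ?expr1n// ?(negbTE m0).
have e2 : M.+1%:R + -1 = M%:R :> R by rewrite -(natr1 M); ring.
have e1 : M.+1%:R + 1 = M.+2%:R :> R by rewrite natr1.
rewrite e1 e2 !dX0 -!opprD -!mulrDl; congr (- (_ / _)).
rewrite -!mulrA -!mulrDr; congr (_ * _); rewrite !exprS; ring.
Qed.

End kernel_coef.

(** * Fourier coefficients of the closed form *)

Section kfun_coef.
Context {R : realType}.
Implicit Types (r s x y t th b c : R) (M n : nat).
Local Notation mu := (@lebesgue_measure R).
Local Notation mu2 := (leb2 R).

Lemma integrable_scaler d (T : measurableType d) (nu : {measure set T -> \bar R})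
    (D : set T) (f : T -> R) (k : R) : measurable D -> nu.-integrable D (EFin \o f) ->
  nu.-integrable D (EFin \o (fun z => k * f z)).
Proof.
move=> mD mf; rewrite (_ : EFin \o _ = (fun z => k%:E * (EFin \o f) z)%E)//.
exact: integrableZl.
Qed.

Lemma integrable_normr d (T : measurableType d) (nu : {measure set T -> \bar R})
    (D : set T) (f : T -> R) : measurable D -> nu.-integrable D (EFin \o f) ->
  nu.-integrable D (EFin \o (fun z => `|f z|)).
Proof.
move=> mD mf; rewrite (_ : EFin \o _ = (fun z => `|(EFin \o f) z|)%E)//.
exact: integrable_abse.
Qed.

Lemma integrable_const d (T : measurableType d) (nu : {measure set T -> \bar R})
    (D : set T) (k : R) : measurable D -> (nu D < +oo)%E ->
  nu.-integrable D (EFin \o (fun=> k)).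
Proof.
move=> mD fD; apply: measurable_bounded_integrable => //.
by exists `|k|; split; [exact: num_real|move=> x kx z _; exact: ltW].
Qed.

Lemma integrable_logker0 : mu2.-integrable (square 0 1) (EFin \o (fun z : R * R => logker z.1 z.2)).
Proof.
have -> : (fun z : R * R => logker z.1 z.2) = (fun z => logker z.1 (0 + 1 * z.2)).
  by apply/funext => z; rewrite add0r mul1r.
by apply: integrable_logker => y /andP[y0 _]; rewrite add0r mul1r.
Qed.

Lemma integrable_logker_ksum M :
  mu2.-integrable (square 0 1) (EFin \o (fun z : R * R => logker z.1 z.2 + ksum M z.1 z.2)).
Proof.
exact: (integrable_addr (nu := leb2 R) (measurable_square 0 1) integrable_logker0 (integrable_ksum M)).
Qed.

(** Each logarithmic factor has mean zero in x, so the modes with m = 0 receive nothing from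
    them. *)
Lemma coef_ksum0 M (n : int) b :
  \int[mu2]_(z in square 0 1) ((logker z.1 z.2 + ksum M z.1 z.2) * wave 0 n b z) = 0.
Proof.
have mS := @measurable_square R 0 1.
elim: M => [|M IH].
  have -> : (fun z : R * R => (logker z.1 z.2 + ksum 0 z.1 z.2) * wave 0 n b z) =
    (fun z => logker z.1 (0 + 1 * z.2) * wave 0 n b z).
    by apply/funext => z; rewrite /ksum big_ord0 addr0 add0r mul1r.
  by rewrite coef_logker ?expr1n//; move=> y /andP[y0 _]; rewrite add0r mul1r.
have h1 : forall y, 0 < y < 1 -> 0 < M.+1%:R + 1 * y.
  by move=> y /andP[y0 _]; rewrite mul1r ltr_wpDl.
have h2 : forall y, 0 < y < 1 -> 0 < M.+1%:R + -1 * y.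
  move=> y /andP[_ y1]; rewrite mulN1r subr_gt0; apply: lt_le_trans y1 _.
  by rewrite ler1n.
have -> : (fun z : R * R => (logker z.1 z.2 + ksum M.+1 z.1 z.2) * wave 0 n b z) =
  (fun z => (logker z.1 z.2 + ksum M z.1 z.2) * wave 0 n b z +
    (logker z.1 (M.+1%:R + 1 * z.2) * wave 0 n b z + logker z.1 (M.+1%:R + -1 * z.2) * wave 0 n b z)).
  by apply/funext => z; rewrite /ksum big_ord_recr/= /kterm mul1r mulN1r; ring.
have j1 := integrable_mul_wave 0 n b (integrable_logker h1).
have j2 := integrable_mul_wave 0 n b (integrable_logker h2).
rewrite RintegralD//; last 2 first.
- by apply: integrable_mul_wave; exact: integrable_logker_ksum.
- exact: (integrable_addr (nu := leb2 R) mS j1 j2).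
by rewrite IH RintegralD// !coef_logker ?expr1n ?sqrrN ?expr1n// !addr0.
Qed.

Lemma kpoly_bound y : 0 <= y -> y <= 1 -> `|kpoly y| <= 4 * pi ^+ 2.
Proof.
move=> y0 y1; rewrite /kpoly normrM gtr0_norm ?mulr_gt0 ?exprn_gt0 ?pi_gt0//.
have p2 : 0 < pi ^+ 2 :> R by rewrite exprn_gt0// pi_gt0.
have -> : 4 * pi ^+ 2 = 2 * pi ^+ 2 * 2 :> R by ring.
apply: ler_wpM2l; first by rewrite mulr_ge0// ltW.
rewrite ler_norml; apply/andP; split; nra.
Qed.

Lemma continuous_kpoly : continuous (@kpoly R).
Proof.
move=> y; apply: cvgM; first exact: cvg_cst.
apply: cvgD; last exact: cvg_cst.
apply: cvgB; last exact: cvg_id.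
exact: exprn_continuous.
Qed.

Lemma measurable_kpoly2 : measurable_fun setT (fun z : R * R => kpoly z.2).
Proof.
apply: measurableT_comp; first exact: continuous_measurable_fun continuous_kpoly.
exact: measurable_snd.
Qed.

Lemma integrable_kpoly : mu2.-integrable (square 0 1) (EFin \o (fun z : R * R => kpoly z.2)).
Proof.
apply: (@integrable_square _ _ (4 * pi ^+ 2)); first exact: measurable_kpoly2.
move=> y /andP[y0 y1] /=.
have m1 : mu `[0, 1] = 1%E by rewrite lebesgue_measure_itv/= lte01/= oppr0 adde0.
rewrite integral_cst//= [X in (_ * X)%E](_ : _ = 1%E)// mule1 lee_fin.
by apply: kpoly_bound; exact: ltW.
Qed.

Lemma derive_kpoly_wave (w b y : R) : w != 0 ->
  is_derive y 1 (fun y => kpoly y * sin (w * y - b) / w + 2 * pi ^+ 2 * (2 * y - 1) * cos (w * y - b) / w ^+ 2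
     - 4 * pi ^+ 2 * sin (w * y - b) / w ^+ 3) (kpoly y * cos (w * y - b)).
Proof.
move=> w0.
have d1 : is_derive y 1 (fun y => w * y - b) w.
  by apply: is_derive_eq; rewrite ?scaler0 ?addr0 ?add0r ?subr0 /GRing.scale/=; ring.
have ds := @is_derive1_comp _ (@sin R) _ _ _ _ (is_derive_sin _) d1.
have dc := @is_derive1_comp _ (@cos R) _ _ _ _ (is_derive_cos _) d1.
have dp : is_derive y 1 (@kpoly R) (2 * pi ^+ 2 * (2 * y - 1)).
  by rewrite /kpoly; apply: is_derive_eq; rewrite ?scaler0 ?addr0 ?add0r ?subr0 /GRing.scale/=; ring.
have dl : is_derive y 1 (fun y => 2 * pi ^+ 2 * (2 * y - 1)) (4 * pi ^+ 2).
  by apply: is_derive_eq; rewrite ?scaler0 ?addr0 ?add0r ?subr0 /GRing.scale/=; ring.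
have D1 := @is_deriveZ _ _ _ _ w^-1 _ _ _ (is_deriveM dp ds).
have D2 := @is_deriveZ _ _ _ _ (w ^+ 2)^-1 _ _ _ (is_deriveM dl dc).
have D3 := @is_deriveZ _ _ _ _ (4 * pi ^+ 2 / w ^+ 3) _ _ _ ds.
have := is_deriveB (is_deriveD D1 D2) D3.
set d := (X in is_derive _ _ _ X -> _).
suff -> : d = kpoly y * cos (w * y - b).
  apply: etrans_derive => u.
  change (w^-1 * (kpoly u * sin (w * u - b)) +
    (w ^+ 2)^-1 * (2 * pi ^+ 2 * (2 * u - 1) * cos (w * u - b))
    - 4 * pi ^+ 2 / w ^+ 3 * sin (w * u - b) =
    kpoly u * sin (w * u - b) / w + 2 * pi ^+ 2 * (2 * u - 1) * cos (w * u - b) / w ^+ 2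
     - 4 * pi ^+ 2 * sin (w * u - b) / w ^+ 3).
  by field.
rewrite /d /GRing.scale/=; field.
by [].
Qed.


Lemma Rintegral_kpoly : \int[mu]_(y in `[0, 1]) @kpoly R y = 0.
Proof.
pose F y : R := 2 * pi ^+ 2 * (y ^+ 3 / 3 - y ^+ 2 / 2 + y / 6).
have dF y : is_derive y 1 F (kpoly y).
  have d3 : is_derive y 1 (fun y : R => y ^+ 3) (3 * y ^+ 2).
    by apply: is_derive_eq; rewrite ?scaler0 ?addr0 ?add0r /GRing.scale/=; ring.
  have d2 : is_derive y 1 (fun y : R => y ^+ 2) (2 * y).
    by apply: is_derive_eq; rewrite ?scaler0 ?addr0 ?add0r /GRing.scale/=; ring.
  have D3 := @is_deriveZ _ _ _ _ (2 * pi ^+ 2 / 3) _ _ _ d3.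
  have D2 := @is_deriveZ _ _ _ _ (2 * pi ^+ 2 / 2) _ _ _ d2.
  have D1 := @is_deriveZ _ _ _ _ (2 * pi ^+ 2 / 6) _ _ _ (is_derive_id y (1 : R)).
  have := is_deriveD (is_deriveB D3 D2) D1.
  set d := (X in is_derive _ _ _ X -> _).
  suff -> : d = kpoly y.
    apply: etrans_derive => u.
    change (2 * pi ^+ 2 / 3 * u ^+ 3 - 2 * pi ^+ 2 / 2 * u ^+ 2 + 2 * pi ^+ 2 / 6 * u = F u).
    by rewrite /F; field.
  by rewrite /d /kpoly /GRing.scale/=; field.
by rewrite (Rintegral_FTC ltr01 dF continuous_kpoly) /F; field.
Qed.

(** The polynomial depends on y only and carries exactly the modes m = 0, n <> 0, with the Bernoulli
    coefficients 1/n^2. *)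
Lemma coef_kpoly (m n : int) b :
  \int[mu2]_(z in square 0 1) (kpoly z.2 * wave m n b z) =
  if m == 0 then (if n == 0 then 0 else cos b / n%:~R ^+ 2) else 0.
Proof.
pose H y := if m == 0 then kpoly y * cos (2 * pi * n%:~R * y - b) else 0.
rewrite (@Fubini_square _ _ H); last 2 first.
- exact: integrable_mul_wave integrable_kpoly.
- move=> y hy.
  have cf : continuous (fun x => wave m n b (x, y)) by rewrite /wave/=; exact: continuous_cos_affine.
  have cf' : continuous (fun x => kpoly y * wave m n b (x, y)).
    by move=> x; apply: cvgM; [exact: cvg_cst|exact: cf].
  have fi : (\int[mu]_(x in `[0%R, 1%R]) (kpoly y * wave m n b (x, y))%:E)%E \is a fin_num.
    by apply: integrable_fin_num => //; exact: (integrable_continuous_itv 0 1 cf').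
  rewrite -(fineK fi); congr EFin.
  rewrite -[LHS]/(\int[mu]_(x in `[0, 1]) (kpoly y * wave m n b (x, y))).
  rewrite RintegralZl//; last exact: integrable_continuous_itv.
  rewrite (_ : \int[mu]_(x in `[0, 1]) wave m n b (x, y) = if m == 0 then cos (2 * pi * n%:~R * y - b) else 0); last exact: (Rintegral_cos_int m (2 * pi * n%:~R * y - b)).
  by rewrite /H; case: ifP => // _; rewrite mulr0.
rewrite /H; case: eqVneq => [_|m0]; last by rewrite Rintegral_cst// mul0r.
have cf : continuous (fun y : R => kpoly y * cos (2 * pi * n%:~R * y - b)).
  move=> y; apply: cvgM; first exact: continuous_kpoly.
  exact: (@continuous_cos_affine _ (2 * pi * n%:~R) (- b)).
rewrite open_itv_Rintegral//.
case: eqVneq => [n0|n0].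
  rewrite (@eq_Rintegral _ _ _ mu _ (fun y => cos b * kpoly y)); last first.
    by move=> y _; rewrite n0 mulr0 mul0r sub0r cosN mulrC.
  rewrite RintegralZl ?Rintegral_kpoly ?mulr0//.
  exact: integrable_continuous_itv continuous_kpoly.
have w0 : 2 * pi * n%:~R != 0 :> R.
  by rewrite !mulf_neq0 ?intr_eq0// gt_eqF// pi_gt0.
have n0' : n%:~R != 0 :> R by rewrite intr_eq0.
have p0 : pi != 0 :> R by rewrite gt_eqF// pi_gt0.
rewrite (Rintegral_FTC ltr01 (fun y => derive_kpoly_wave b y w0) cf).
rewrite mulr1 mulr0 sub0r sin_int cos_int sinN cosN /kpoly.
by move: p0; move: (pi : R) => p p0; field; rewrite n0' p0.
Qed.

Lemma measurable_kfunn M : measurable_fun setT (fun z : R * R => kfunn M z.1 z.2).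
Proof.
apply: measurable_funB; first exact: measurable_kpoly2.
apply: measurable_funM => //; apply: measurable_funD.
  have -> : (fun z : R * R => logker z.1 z.2) = (fun z => logker z.1 (0 + 1 * z.2)).
    by apply/funext => z; rewrite add0r mul1r.
  exact: measurable_logker.
rewrite /ksum; apply: measurable_sum => k.
apply: measurable_funD.
  have -> : (fun z : R * R => logker z.1 (k.+1%:R + z.2)) = (fun z => logker z.1 (k.+1%:R + 1 * z.2)).
    by apply/funext => z; rewrite mul1r.
  exact: measurable_logker.
have -> : (fun z : R * R => logker z.1 (k.+1%:R - z.2)) = (fun z => logker z.1 (k.+1%:R + -1 * z.2)).
  by apply/funext => z; rewrite mulN1r.
exact: measurable_logker.
Qed.

Lemma square01_norm (z : R * R) : square 0 1 z -> `|z.2| <= 1.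
Proof. by move=> [_]; rewrite /= in_itv/= => /andP[y0 y1]; rewrite ger0_norm. Qed.

Lemma kfunn_cvg x y : `|y| <= 1 -> kfunn n x y @[n --> \oo] --> kfun x y.
Proof.
move=> y1; apply: cvgB; first exact: cvg_cst.
apply: cvgM; first exact: cvg_cst.
apply: cvgD; first exact: cvg_cst.
exact: is_cvg_ksum.
Qed.

Lemma measurable_kfun : measurable_fun (square 0 1) (fun z : R * R => kfun z.1 z.2).
Proof.
apply: (@measurable_fun_cvg _ _ _ (square 0 1) (fun n (z : R * R) => kfunn n z.1 z.2)).
- by move=> n; apply: measurable_funTS; exact: measurable_kfunn.
- by move=> z /square01_norm; exact: kfunn_cvg.
Qed.

Lemma integrable_kfunn M : mu2.-integrable (square 0 1) (EFin \o (fun z : R * R => kfunn M z.1 z.2)).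
Proof.
have h := integrable_scaler (nu := leb2 R) (- pi) (@measurable_square R 0 1) (integrable_logker_ksum M).
have -> : (fun z : R * R => kfunn M z.1 z.2) = (fun z => kpoly z.2 + - pi * (logker z.1 z.2 + ksum M z.1 z.2)).
  by apply/funext => z; rewrite /kfunn mulNr.
exact: (integrable_addr (nu := leb2 R) (measurable_square 0 1) integrable_kpoly h).
Qed.

Lemma leb2_square01 : mu2 (square 0 1) = 1%E.
Proof.
rewrite /square product_measure1E//.
have m1 : mu `[0, 1] = 1%E by rewrite lebesgue_measure_itv/= lte01/= oppr0 adde0.
by rewrite [X in (X * _)%E](_ : _ = 1%E)// [X in (_ * X)%E](_ : _ = 1%E)// mule1.
Qed.

Lemma integrable_kfun : mu2.-integrable (square 0 1) (EFin \o (fun z : R * R => kfun z.1 z.2)).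
Proof.
have mS := @measurable_square R 0 1.
pose C : R := pi * 16 * 2^-1 ^+ 1.
have ic : mu2.-integrable (square 0 1) (EFin \o (fun z : R * R => C)).
  have fS : (mu2 (square 0 1) < +oo)%E by rewrite leb2_square01 ltry.
  exact: (integrable_const (nu := leb2 R) C mS fS).
have ia := integrable_addr (nu := leb2 R) mS (integrable_normr (nu := leb2 R) mS (integrable_kfunn 1)) ic.
apply: le_integrable ia => //.
  by apply/measurable_EFinP; exact: measurable_kfun.
move=> z /square01_norm z1 /=; rewrite lee_fin.
rewrite [leRHS]ger0_norm; last by rewrite addr_ge0// /C !mulr_ge0 ?pi_ge0// exprn_ge0// invr_ge0.
have := kfun_err 0 z.1 z1; rewrite -/C => h.
rewrite -[kfun _ _](subrK (kfunn 1 z.1 z.2)) addrC.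
by apply: le_trans (ler_normD _ _) _; rewrite lerD2l.
Qed.

Lemma Rintegral_kfun_err M (m n : int) b :
  `|\int[mu2]_(z in square 0 1) (kfun z.1 z.2 * wave m n b z) -
    \int[mu2]_(z in square 0 1) (kfunn M.+1 z.1 z.2 * wave m n b z)| <= pi * 16 * 2^-1 ^+ M.+1.
Proof.
have mS := @measurable_square R 0 1.
have i1 := integrable_mul_wave m n b integrable_kfun.
have i2 := integrable_mul_wave m n b (integrable_kfunn M.+1).
rewrite -RintegralB//.
have i3 : mu2.-integrable (square 0 1) (EFin \o (fun z : R * R => kfun z.1 z.2 * wave m n b z - kfunn M.+1 z.1 z.2 * wave m n b z)).
  have -> : (fun z : R * R => kfun z.1 z.2 * wave m n b z - kfunn M.+1 z.1 z.2 * wave m n b z) =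
    (fun z => kfun z.1 z.2 * wave m n b z + -1 * (kfunn M.+1 z.1 z.2 * wave m n b z)).
    by apply/funext => z; rewrite mulN1r.
  exact: (integrable_addr (nu := leb2 R) mS i1 (integrable_scaler (nu := leb2 R) (-1) mS i2)).
apply: le_trans (le_normr_Rintegral _ _) _ => //.
have fS : (mu2 (square 0 1) < +oo)%E by rewrite leb2_square01 ltry.
set C := (X in _ <= X).
have -> : C = \int[mu2]_(z in square 0 1) C.
  rewrite Rintegral_cst//; first by rewrite [X in fine X](_ : _ = 1%E) ?mulr1//; exact: leb2_square01.
apply: le_Rintegral => //.
- exact: (integrable_normr (nu := leb2 R) mS i3).
- exact: (integrable_const (nu := leb2 R) C mS fS).
move=> z /square01_norm z1; rewrite -mulrBl normrM.
apply: le_trans (kfun_err M z.1 z1); apply: ler_piMr => //; exact: cos_max.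
Qed.

Lemma coef_kfunn M (m n : int) b :
  \int[mu2]_(z in square 0 1) (kfunn M z.1 z.2 * wave m n b z) =
  \int[mu2]_(z in square 0 1) (kpoly z.2 * wave m n b z)
  - pi * \int[mu2]_(z in square 0 1) ((logker z.1 z.2 + ksum M z.1 z.2) * wave m n b z).
Proof.
have mS := @measurable_square R 0 1.
have i1 := integrable_mul_wave m n b integrable_kpoly.
have i2 := integrable_mul_wave m n b (integrable_logker_ksum M).
rewrite -RintegralZl// -RintegralB//; last exact: (integrable_scaler (nu := leb2 R) pi mS i2).
by apply: eq_Rintegral => z _; rewrite /kfunn; ring.
Qed.

(** The modes m = 0 come from [kpoly] alone and the modes m <> 0 from the logarithms alone; in the
    latter case q^(|m| M) tends to 0 in [coef_ksum]. The result is 1 / (m^2 + n^2), as required of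
    E_1. *)
Lemma coef_kfun (m n : int) b :
  \int[mu2]_(z in square 0 1) (kfun z.1 z.2 * wave m n b z) =
  if (m == 0) && (n == 0) then 0 else cos b / (m%:~R ^+ 2 + n%:~R ^+ 2).
Proof.
have [m0|m0] := eqVneq m 0.
  apply: (@geometric_bound_eq _ _ _ (pi * 16) 2^-1 1); [lra|lra|] => -[//|M] _.
  have := Rintegral_kfun_err M m n b.
  rewrite coef_kfunn {3}m0 coef_ksum0 mulr0 subr0 coef_kpoly m0/= => h.
  by rewrite expr0n/= add0r.
pose a : R := 2 * pi * `|m|%:R; pose w : R := 2 * pi * n%:~R.
pose D := a ^+ 2 + w ^+ 2.
pose Q : R := decay `|m|%:R.
pose A := a * cos b + w * sin b; pose B := a * cos b - w * sin b.
pose k := pi * (`|m|%:R^-1 / D).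
have mp : 0 < `|m|%:R :> R by rewrite ltr0n absz_gt0.
have a0 : 0 < a by rewrite !mulr_gt0 ?pi_gt0.
have D0 : 0 < D by rewrite ltr_pwDl ?exprn_gt0// sqr_ge0.
have k0 : 0 < k by rewrite mulr_gt0 ?pi_gt0// divr_gt0// invr_gt0.
have Q0 : 0 < Q by exact: decay_gt0.
have Q1 : Q <= 2^-1.
  apply: le_trans decay1_le; apply: decay_le; rewrite ler1n absz_gt0//.
apply: (@geometric_bound_eq _ _ _ (pi * 16 + k * (`|A| + `|B|)) 2^-1 1); [lra|lra|] => -[//|M] _.
set I := (X in `|X - _|).
have h : `|I - _| <= _ := Rintegral_kfun_err M m n b.
rewrite coef_kfunn coef_kpoly coef_ksum// (negbTE m0) -/a -/w -/D -/Q -/A -/B in h *.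
(* In A + B the sine parts cancel, leaving 2 a cos b; the factors of pi and |m| in k and D then
   simplify. *)
have -> : cos b / (m%:~R ^+ 2 + n%:~R ^+ 2) = k * (A + B).
  have -> : m%:~R ^+ 2 = `|m|%:R ^+ 2 :> R.
    by rewrite natr_absz intr_norm -normrX ger0_norm ?sqr_ge0.
  have M0 : `|m|%:R != 0 :> R by rewrite gt_eqF.
  have E0 : `|m|%:R ^+ 2 + n%:~R ^+ 2 != 0 :> R.
    by rewrite gt_eqF// ltr_pwDl ?exprn_gt0// sqr_ge0.
  rewrite /k /A /B.
  have -> : D = 4 * pi ^+ 2 * (`|m|%:R ^+ 2 + n%:~R ^+ 2) by rewrite /D /a /w; ring.
  rewrite /a; have p0 : pi != 0 :> R by rewrite gt_eqF// pi_gt0.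
  by move: p0; move: (pi : R) => p p0; field; rewrite ?M0 ?E0 ?p0.
have -> : I - k * (A + B) = (I - (0 - pi * - (`|m|%:R^-1 * ((1 - Q ^+ M.+2) * A + (1 - Q ^+ M.+1) * B) / D)))
  - k * (Q ^+ M.+2 * A + Q ^+ M.+1 * B).
  by rewrite /k; ring.
have QM : Q ^+ M.+1 <= 2^-1 ^+ M.+1 by apply: lerXn2r; rewrite ?nnegrE; lra.
have QM0 : 0 <= Q ^+ M.+1 by rewrite exprn_ge0// ltW.
have QM1 : Q ^+ M.+2 <= Q ^+ M.+1 by rewrite exprS ler_piMl//; lra.
have QM2 : 0 <= Q ^+ M.+2 by rewrite exprn_ge0// ltW.
apply: le_trans (ler_normB _ _) _; rewrite [in leRHS]mulrDl; apply: lerD => //.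
rewrite normrM gtr0_norm// -mulrA; apply: ler_wpM2l; first exact: ltW.
have nQ j x : `|Q ^+ j * x| = `|x| * Q ^+ j.
  by rewrite normrM ger0_norm ?exprn_ge0 ?(ltW Q0)// mulrC.
apply: le_trans (ler_normD _ _) _; rewrite [in leRHS]mulrDl (nQ M.+2 A) (nQ M.+1 B).
by apply: lerD; apply: ler_wpM2l => //; exact: le_trans QM1 QM.
Qed.

End kfun_coef.

(** * Continuity of the closed form inside the strip 0 < y < 1 *)

Section kfun_continuous.
Context {R : realType}.
Implicit Types (r s x y t th b c : R) (M n : nat).

Lemma continuous_logker2 c s (z : R * R) : 0 < c + s * z.2 ->
  {for z, continuous (fun z : R * R => logker z.1 (c + s * z.2))}.
Proof.
move=> h.
have cc : (cos (2 * pi * u.1) : R) @[u --> z] --> (cos (2 * pi * z.1) : R).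
  apply: (@cvg_comp _ _ _ (fun u : R * R => u.1) (fun x : R => cos (2 * pi * x)) _ (nbhs z.1)).
    exact: cvg_fst.
  exact: continuous_cos_lin.
have cd : (decay (c + s * u.2) : R) @[u --> z] --> (decay (c + s * z.2) : R).
  apply: (@cvg_comp _ _ _ (fun u : R * R => u.2) (fun y : R => decay (c + s * y)) _ (nbhs z.2)).
    exact: cvg_snd.
  apply: (@continuous_comp _ _ _ (fun y : R => - (2 * pi * (c + s * y))) expR); last exact: continuous_expR.
  apply: cvgN; apply: cvgM; first exact: cvg_cst.
  apply: cvgD; first exact: cvg_cst.
  by apply: cvgM; [exact: cvg_cst|exact: cvg_id].
have cl : (logarg (decay (c + s * u.2)) (2 * pi * u.1) : R) @[u --> z] --> (logarg (decay (c + s * z.2)) (2 * pi * z.1) : R).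
  rewrite /logarg; apply: cvgD; last exact: cvgM.
  apply: cvgB; first exact: cvg_cst.
  by apply: cvgM => //; apply: cvgM => //; exact: cvg_cst.
apply: (@cvg_comp _ _ _ (fun u : R * R => logarg (decay (c + s * u.2)) (2 * pi * u.1)) (@ln R) _ _ _ cl).
by apply: continuous_ln; apply: logarg_gt0; [exact/ltW/decay_gt0|exact: decay_lt1].
Qed.

Lemma continuous_kfunn M (z : R * R) : 0 < z.2 < 1 ->
  {for z, continuous (fun z : R * R => kfunn M z.1 z.2)}.
Proof.
move=> /andP[z0 z1].
have cL : {for z, continuous (fun z : R * R => logker z.1 z.2)}.
  have -> : (fun z : R * R => logker z.1 z.2) = (fun z => logker z.1 (0 + 1 * z.2)).
    by apply/funext => u; rewrite add0r mul1r.
  by apply: continuous_logker2; rewrite add0r mul1r.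
have cS : {for z, continuous (fun z : R * R => ksum M z.1 z.2)}.
  elim: M => [|M IH].
    have -> : (fun z : R * R => ksum 0 z.1 z.2) = (fun=> 0).
      by apply/funext => u; rewrite /ksum big_ord0.
    exact: cvg_cst.
  have -> : (fun z : R * R => ksum M.+1 z.1 z.2) =
     (fun z => ksum M z.1 z.2 + (logker z.1 (M.+1%:R + 1 * z.2) + logker z.1 (M.+1%:R + -1 * z.2))).
    by apply/funext => u; rewrite /ksum big_ord_recr/= /kterm mul1r mulN1r.
  apply: cvgD; first exact: IH.
  apply: cvgD; apply: continuous_logker2.
    by rewrite mul1r ltr_wpDl.
  by rewrite mulN1r subr_gt0; apply: lt_le_trans z1 _; rewrite ler1n.
apply: cvgB.
  apply: (@cvg_comp _ _ _ (fun u : R * R => u.2) (@kpoly R) _ (nbhs z.2)); first exact: cvg_snd.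
  exact: continuous_kpoly.
apply: cvgM; first exact: cvg_cst.
by apply: cvgD; [exact: cL|exact: cS].
Qed.

(** A uniform limit, by [kfun_err], of truncations that are continuous because in the open strip
    every radius is strictly less than 1. *)
Lemma continuous_kfun (z : R * R) : 0 < z.2 < 1 ->
  {for z, continuous (fun z : R * R => kfun z.1 z.2)}.
Proof.
move=> hz; apply/cvgrPdist_lt => e e0.
have e3 : 0 < e / 3 by rewrite divr_gt0.
have /cvgrPdist_lt/(_ _ e3)[M _ hM] := half_expn_cvg (pi * 16 : R).
have hb : pi * 16 * 2^-1 ^+ M.+1 < e / 3.
  have := hM M.+1 (leqnSn M); rewrite sub0r normrN ger0_norm// mulr_ge0 ?exprn_ge0 ?invr_ge0//.
  by rewrite mulr_ge0// pi_ge0.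
have /cvgrPdist_lt/(_ _ e3) hc := @continuous_kfunn M.+1 z hz.
have ho : \forall u \near z, 0 < (u : R * R).2 < 1.
  have : \forall y \near z.2, 0 < y < 1.
    have z01 : z.2 \in `]0, 1[ by rewrite in_itv.
    by apply: filterS (near_in_itvoo z01) => y; rewrite in_itv.
  by apply: (@cvg_snd _ _ (nbhs z.1) (nbhs z.2)).
near=> u.
have h1 : `|kfunn M.+1 z.1 z.2 - kfunn M.+1 u.1 u.2| < e / 3 by near: u; exact: hc.
have /andP[u0 u1] : 0 < u.2 < 1 by near: u; exact: ho.
have h2 : `|kfun u.1 u.2 - kfunn M.+1 u.1 u.2| <= pi * 16 * 2^-1 ^+ M.+1.
  by apply: kfun_err; rewrite gtr0_norm// ltW.
have h3 : `|kfun z.1 z.2 - kfunn M.+1 z.1 z.2| <= pi * 16 * 2^-1 ^+ M.+1.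
  by apply: kfun_err; case/andP: hz => z0 z1; rewrite gtr0_norm// ltW.
move: h1 h2 h3; move: (kfun _ _) (kfunn _ _ _) (kfun _ _) (kfunn _ _ _) => p1 p2 p3 p4 h1 h2 h3.
have -> : p1 - p3 = (p1 - p4) + (p4 - p2) - (p3 - p2) by ring.
apply: le_lt_trans (ler_normB _ _) _.
apply: le_lt_trans (lerD (ler_normD _ _) (lexx _)) _.
lra.
Unshelve. all: by end_near. Qed.

End kfun_continuous.

(** * Fourier coefficients determine the value at an interior point of continuity *)

Section uniqueness.
Context {R : realType}.
Local Notation mu := (@lebesgue_measure R).
Local Notation mu2 := (leb2 R).

(** Finite real combinations of phased characters. The product formula [waveM] keeps products, hence
    powers of [peak], inside the class. *)
Inductive trigpoly : (R * R -> R) -> Prop :=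
| trigpoly_wave m n b : trigpoly (wave m n b)
| trigpolyD f g : trigpoly f -> trigpoly g -> trigpoly (fun z => f z + g z)
| trigpolyZ k f : trigpoly f -> trigpoly (fun z => k * f z).

Lemma waveM m n (b : R) m' n' b' z : wave m n b z * wave m' n' b' z =
  2^-1 * wave (m + m') (n + n') (b + b') z + 2^-1 * wave (m - m') (n - n') (b - b') z.
Proof.
rewrite /wave !rmorphD/= !rmorphN/=.
set A := 2 * pi * m%:~R * z.1 + (2 * pi * n%:~R * z.2 - b).
set B := 2 * pi * m'%:~R * z.1 + (2 * pi * n'%:~R * z.2 - b').
have -> : 2 * pi * (m%:~R + m'%:~R) * z.1 + (2 * pi * (n%:~R + n'%:~R) * z.2 - (b + b')) = A + B.
  by rewrite /A /B; ring.
have -> : 2 * pi * (m%:~R - m'%:~R) * z.1 + (2 * pi * (n%:~R - n'%:~R) * z.2 - (b - b')) = A - B.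
  by rewrite /A /B; ring.
by move: A B => A B; rewrite cosB cosD; field.
Qed.

Lemma trigpoly_ext f g : f =1 g -> trigpoly f -> trigpoly g.
Proof. by move=> /funext ->. Qed.

Lemma trigpolyM f g : trigpoly f -> trigpoly g -> trigpoly (fun z => f z * g z).
Proof.
move=> tf tg; elim: tf => [m n b|f1 f2 _ h1 _ h2|k f1 _ h1].
- elim: tg => [m' n' b'|g1 g2 _ h1 _ h2|k g1 _ h1].
  + apply: trigpoly_ext (trigpolyD (trigpolyZ 2^-1 (trigpoly_wave (m + m') (n + n') (b + b'))) (trigpolyZ 2^-1 (trigpoly_wave (m - m') (n - n') (b - b')))) => z.
    by rewrite waveM.
  + by apply: trigpoly_ext (trigpolyD h1 h2) => z; rewrite mulrDr.
  + by apply: trigpoly_ext (trigpolyZ k h1) => z; rewrite mulrCA.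
- by apply: trigpoly_ext (trigpolyD h1 h2) => z; rewrite mulrDl.
- by apply: trigpoly_ext (trigpolyZ k h1) => z; rewrite mulrA.
Qed.

Lemma trigpoly1 : trigpoly (fun=> 1).
Proof.
by apply: trigpoly_ext (trigpoly_wave 0 0 0) => z; rewrite /wave !(mulr0, mul0r) subr0 addr0 cos0.
Qed.

Lemma trigpolyX f k : trigpoly f -> trigpoly (fun z => f z ^+ k).
Proof.
move=> tf; elim: k => [|k IH]; first by apply: trigpoly_ext trigpoly1 => z; rewrite expr0.
by apply: trigpoly_ext (trigpolyM tf IH) => z; rewrite exprS.
Qed.

Section orthogonal.
Variable f : R * R -> R.
Hypothesis intf : mu2.-integrable (square 0 1) (EFin \o f).
Hypothesis f_orth : forall m n b, \int[mu2]_(z in square 0 1) (f z * wave m n b z) = 0.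

Lemma trigpoly_orth p : trigpoly p ->
  mu2.-integrable (square 0 1) (EFin \o (fun z => f z * p z)) /\
  \int[mu2]_(z in square 0 1) (f z * p z) = 0.
Proof.
have mS := @measurable_square R 0 1.
elim=> [m n b|g1 g2 _ [i1 h1] _ [i2 h2]|k g _ [i h]].
- by split; [exact: integrable_mul_wave|exact: f_orth].
- have -> : (fun z => f z * (g1 z + g2 z)) = (fun z => f z * g1 z + f z * g2 z).
    by apply/funext => z; rewrite mulrDr.
  split; first exact: (integrable_addr (nu := leb2 R) mS i1 i2).
  by rewrite RintegralD// h1 h2 addr0.
- have -> : (fun z => f z * (k * g z)) = (fun z => k * (f z * g z)).
    by apply/funext => z; rewrite mulrCA.
  split; first exact: (integrable_scaler (nu := leb2 R) k mS i).
  by rewrite RintegralZl// h mulr0.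
Qed.

(** A trigonometric polynomial with values in [0,1] that equals 1 only at (a, b) modulo integers;
    its powers concentrate at that point. *)
Definition peak (a b : R) (z : R * R) : R :=
  4^-1 * (2 + (cos (2 * pi * (z.1 - a)) + cos (2 * pi * (z.2 - b)))).

Lemma trigpoly_peak a b : trigpoly (peak a b).
Proof.
have h := trigpolyZ 4^-1 (trigpolyD (trigpolyZ 2 trigpoly1) (trigpolyD (trigpoly_wave 1 0 (2 * pi * a)) (trigpoly_wave 0 1 (2 * pi * b)))).
apply: trigpoly_ext h => z; rewrite /peak /wave mulr1.
by congr (_ * (_ + (cos _ + cos _))); ring.
Qed.

Lemma half_pi_itv (u : R) : 0 <= u -> u <= 2^-1 -> 2 * pi * u \in `[0, pi].
Proof.
move=> u0 u1; rewrite in_itv/=; have := pi_ge0 R; move: (pi : R) => p p0.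
by apply/andP; split; nra.
Qed.

Lemma cos_mono (u v : R) : 0 <= u -> u <= v -> v <= 2^-1 ->
  cos (2 * pi * v) <= cos (2 * pi * u).
Proof.
move=> u0 uv v1; rewrite leNgt ltr_cos -?leNgt.
- by apply: ler_wpM2l => //; rewrite mulr_ge0// pi_ge0.
- by apply: half_pi_itv; lra.
- by apply: half_pi_itv; lra.
Qed.

(** Because a keeps distance d from both ends of [0,1], the distance |x - a| is also at most 1 - d,
    so x stays away from the next maximum of the periodic cosine. *)
Lemma cos_far (d x a : R) : 0 < d -> d <= a -> a <= 1 - d -> 0 <= x -> x <= 1 ->
  d <= `|x - a| -> cos (2 * pi * (x - a)) <= cos (2 * pi * d).
Proof.
move=> d0 da a1 x0 x1 dx.
have -> : cos (2 * pi * (x - a)) = cos (2 * pi * `|x - a|).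
  by case: (ger0P (x - a)) => _ //; rewrite mulrN cosN.
have h1 : `|x - a| <= 1 - d by clear dx; rewrite ler_norml; apply/andP; split; lra.
move: dx h1; move: `|x - a| => t dt t1.
case: (lerP t 2^-1) => ht; first by apply: cos_mono => //; lra.
have -> : cos (2 * pi * t) = cos (2 * pi * (1 - t)).
  rewrite -(cos_int (-1) (2 * pi * t)) -[RHS]cosN; congr cos; rewrite rmorphN/=; ring.
by apply: cos_mono; lra.
Qed.

Lemma cos_close (d x a : R) : 0 < d -> d <= 1 -> `|x - a| <= d / 2 ->
  cos (pi * d) <= cos (2 * pi * (x - a)).
Proof.
move=> d0 d1 dx; have -> : cos (2 * pi * (x - a)) = cos (2 * pi * `|x - a|).
  by case: (ger0P (x - a)) => _ //; rewrite mulrN cosN.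
have -> : pi * d = 2 * pi * (d / 2) by move: (pi : R) => p; field.
by apply: cos_mono => //; lra.
Qed.

(** If one coordinate is at distance at least d, the peak is at most (3 + cos(2 pi d)) / 4, which
    equals (1 + cos(pi d)^2) / 2. *)
Lemma peak_far (d a b : R) (z : R * R) : square 0 1 z -> 0 < d ->
  d <= a <= 1 - d -> d <= b <= 1 - d ->
  (d <= `|z.1 - a|) || (d <= `|z.2 - b|) -> peak a b z <= (1 + cos (pi * d) ^+ 2) / 2.
Proof.
move=> [] /=; rewrite !in_itv/= => /andP[x0 x1] /andP[y0 y1] d0 /andP[a0 a1] /andP[b0 b1] h.
have e : cos (2 * pi * d) = 2 * cos (pi * d) ^+ 2 - 1.
  by rewrite -mulrA mulr_natl cos_mulr2n mulr_natl.
rewrite /peak; case/orP: h => h.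
- have := cos_far d0 a0 a1 x0 x1 h; have := cos_le1 (2 * pi * (z.2 - b)); lra.
- have := cos_far d0 b0 b1 y0 y1 h; have := cos_le1 (2 * pi * (z.1 - a)); lra.
Qed.

Lemma peak_close (d a b : R) (z : R * R) : 0 < d -> d <= 1 ->
  `|z.1 - a| <= d / 2 -> `|z.2 - b| <= d / 2 -> (1 + cos (pi * d)) / 2 <= peak a b z.
Proof.
move=> d0 d1 h1 h2; rewrite /peak.
have := cos_close d0 d1 h1; have := cos_close d0 d1 h2; lra.
Qed.

Lemma peak_ge0 (a b : R) z : 0 <= peak a b z.
Proof.
rewrite /peak; have := cos_geN1 (2 * pi * (z.1 - a)).
have := cos_geN1 (2 * pi * (z.2 - b)); lra.
Qed.

Definition box (a b d : R) : set (R * R) := `[a - d, a + d] `*` `[b - d, b + d].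

Lemma measurable_box a b d : measurable (box a b d).
Proof. exact: measurableX. Qed.

Lemma leb2_box a b d : 0 <= d -> mu2 (box a b d) = ((2 * d) ^+ 2)%:E.
Proof.
move=> d0; have m1 c : mu `[c - d, c + d] = (2 * d)%:E.
  rewrite lebesgue_measure_itv/= lte_fin; case: ltP => h.
    by rewrite -EFinB; congr EFin; ring.
  by congr EFin; lra.
transitivity (mu `[(a - d)%R, (a + d)%R] * mu `[(b - d)%R, (b + d)%R])%E.
  exact: product_measure1E.
by rewrite !m1 -EFinM expr2.
Qed.

Lemma half_box (d a x : R) : 0 < d -> d <= a -> a <= 1 - d ->
  a - d / 2 <= x <= a + d / 2 -> 0 <= x <= 1.
Proof. by move=> d0 da a1 /andP[h1 h2]; apply/andP; split; lra. Qed.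

(** Suppose f > 0 at z0. Testing f against the k-th power of a peak at z0 gives zero, yet a small
    box contributes at least a constant times s^k while the far region costs at most a constant
    times r^k with r < s. Letting k grow is a contradiction. *)
Lemma orthogonal_le0 (z0 : R * R) : 0 < z0.1 < 1 -> 0 < z0.2 < 1 ->
  {for z0, continuous f} -> f z0 <= 0.
Proof.
case: z0 => a b /= /andP[a0 a1] /andP[b0 b1] cf; rewrite leNgt; apply/negP => fpos.
pose e := f (a, b) / 2.
have e0 : 0 < e by rewrite divr_gt0.
have /cvgrPdist_lt/(_ _ e0) := cf.
move=> /nbhs_ballP[d0 /= d0p hd0].
(* The sup-norm square of radius d about z0 must lie in the unit square and in the ball where f >=
   e; d <= 1/4 makes C = cos(pi d) positive. *)
pose d := Num.min (Num.min (d0 / 2) 4^-1) (Num.min (Num.min a (1 - a)) (Num.min b (1 - b))).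
have dpos : 0 < d by rewrite !lt_min; apply/andP; split; [apply/andP; split; lra|rewrite a0 b0 !subr_gt0 a1 b1].
have [da0 da1 db0 db1] : [/\ d <= a, a <= 1 - d, d <= b & b <= 1 - d].
  rewrite [a <= _]lerBrDr [b <= _]lerBrDr -!lerBrDl.
  by rewrite /d !ge_min !lexx ?orbT.
have d4 : d <= 4^-1 by rewrite /d !ge_min !lexx ?orbT.
have dd0 : d < d0 by apply: (@le_lt_trans _ _ (d0 / 2)); [rewrite /d !ge_min !lexx ?orbT|rewrite ltr_pdivrMr// ltr_pMr// ltr1n].
have dhalf : d / 2 < d by rewrite ltr_pdivrMr// ltr_pMr// ltr1n.
have fbig z : `|z.1 - a| < d -> `|z.2 - b| < d -> e <= f z.
  move=> h1 h2; have : ball (a, b) d0 z.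
    by split; rewrite /= -ball_normE/= distrC; exact: lt_trans dd0.
  move=> /hd0 /=; rewrite ltr_norml => /andP[_]; rewrite /e; lra.
pose C := cos (pi * d).
have C0 : 0 < C.
  apply: cos_gt0_pihalf; have := pi_gt0 R; move: (pi : R) => p p0; apply/andP; split; nra.
have C1 : C < 1.
  have hd : pi * d \in `[0, pi].
    by rewrite in_itv/= mulr_ge0 ?pi_ge0 ?(ltW dpos)//= ler_piMr ?pi_ge0//; lra.
  have h0 : 0 \in `[0, pi :> R] by rewrite in_itv/= lexx pi_ge0.
  by rewrite /C -[ltRHS]cos0 ltr_cos// mulr_gt0// pi_gt0.
(* r bounds the peak from above beyond distance d, s from below within d/2; r < s since 0 < C <
   1. *)
pose r := (1 + C ^+ 2) / 2; pose s := (1 + C) / 2.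
have s0 : 0 < s by rewrite /s; lra.
have rs : r < s by rewrite /r /s ltr_pM2r ?invr_gt0// ltrD2l expr2 gtr_pMl.
have r0 : 0 <= r by rewrite /r divr_ge0// addr_ge0// sqr_ge0.
have mS := @measurable_square R 0 1.
pose M := \int[mu2]_(z in square 0 1) `|f z|.
have key k : e * d ^+ 2 * s ^+ k <= M * r ^+ k.
  have [ik hk] := trigpoly_orth (trigpolyX k (trigpoly_peak a b)).
  have i0 : mu2.-integrable (square 0 1) (EFin \o \1_(box a b (d / 2))).
    apply: (measurable_bounded_integrable (mu := leb2 R)) => //.
    - by rewrite [X in (X < _)%E]leb2_square01 ltry.
    - by apply: measurable_indic; exact: measurable_box.
    - exists 1; split; first exact: num_real.
      by move=> x x1 z _; rewrite /= indicE normr_nat (le_trans _ (ltW x1))// lern1; case: (_ \in _).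
  have i1 := integrable_scaler (nu := leb2 R) (e * s ^+ k) mS i0.
  have i2 := integrable_scaler (nu := leb2 R) (- r ^+ k) mS (integrable_normr (nu := leb2 R) mS intf).
  have : \int[mu2]_(z in square 0 1) (e * s ^+ k * \1_(box a b (d / 2)) z + - r ^+ k * `|f z|)
      <= \int[mu2]_(z in square 0 1) (f z * peak a b z ^+ k).
    apply: (@le_Rintegral _ _ _ (leb2 R)) => //; first exact: (integrable_addr (nu := leb2 R) mS i1 i2).
    move=> z zS; have [zB|zB] := pselect (box a b (d / 2) z).
      rewrite indicE mem_set// mulr1.
      move: zB => [] /=; rewrite !in_itv/= => hx hy.
      have h1 : `|z.1 - a| <= d / 2 by rewrite ler_distl.
      have h2 : `|z.2 - b| <= d / 2 by rewrite ler_distl.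
      have ef : e <= f z by apply: fbig; [exact: le_lt_trans h1 dhalf|exact: le_lt_trans h2 dhalf].
      have sp : s ^+ k <= peak a b z ^+ k.
        by apply: lerXn2r; rewrite ?nnegrE ?peak_ge0 ?(ltW s0)//; apply: peak_close => //; lra.
      apply: (@le_trans _ _ (e * s ^+ k)).
        by rewrite gerDl mulNr oppr_le0 mulr_ge0// exprn_ge0.
      by apply: ler_pM => //; [exact: ltW|rewrite exprn_ge0// ltW].
    rewrite indicE memNset// mulr0 add0r.
    (* Between the box of radius d/2 and the square of radius d the function f is still positive, so
       that region only helps. *)
    have [near0|far0] := boolP ((`|z.1 - a| < d) && (`|z.2 - b| < d)).
      case/andP: near0 => h1 h2; have ef := fbig z h1 h2.
      apply: (@le_trans _ _ 0); first by rewrite mulNr oppr_le0 mulr_ge0// exprn_ge0.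
      by rewrite mulr_ge0 ?exprn_ge0 ?peak_ge0//; apply: le_trans ef; exact: ltW.
    have pr : peak a b z ^+ k <= r ^+ k.
      apply: lerXn2r; rewrite ?nnegrE ?peak_ge0//.
      apply: (@peak_far d) => //; [by rewrite da0 da1|by rewrite db0 db1|].
      by rewrite !leNgt -negb_and.
    rewrite mulNr lerNl; apply: (@le_trans _ _ (`|f z| * peak a b z ^+ k)).
      by rewrite -mulNr; apply: ler_wpM2r; rewrite ?exprn_ge0 ?peak_ge0// lerNl lerNnormlW.
    by rewrite mulrC; apply: ler_wpM2r.
  rewrite hk RintegralD// !RintegralZl//; last first.
    exact: (integrable_normr (nu := leb2 R) mS intf).
  rewrite -/M.
  have -> : \int[mu2]_(z in square 0 1) \1_(box a b (d / 2)) z = d ^+ 2.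
    rewrite /Rintegral integral_indic//; last exact: measurable_box.
    rewrite [X in fine X](_ : _ = mu2 (box a b (d / 2))).
      by rewrite leb2_box ?fineK//= ?divr_ge0 ?(ltW dpos)// mulrC divfK.
    congr (mu2 _); apply/setIidPl => z [] /=; rewrite !in_itv/= => hx hy.
    by split; rewrite /= in_itv/=; [exact: (half_box dpos da0 da1 hx)|exact: (half_box dpos db0 db1 hy)].
  rewrite -subr_le0; lra.
(* [key] reads e d^2 <= M (r/s)^k for all k, with r/s < 1. *)
have : e * d ^+ 2 = 0.
  apply: (@geometric_bound_eq _ _ _ M (r / s) 0).
  - by rewrite divr_ge0// ltW.
  - by rewrite ltr_pdivrMr// mul1r.
  move=> k _; rewrite subr0 ger0_norm; last by rewrite mulr_ge0// ?ltW// exprn_gt0.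
  by rewrite expr_div_n (mulrA M) ler_pdivlMr ?exprn_gt0.
by apply/eqP; rewrite mulf_neq0// ?gt_eqF// exprn_gt0.
Qed.

End orthogonal.

(** [orthogonal_le0] is applied to f - g and to g - f. *)
Lemma wave_coef_inj (f g : R * R -> R) (z0 : R * R) :
  mu2.-integrable (square 0 1) (EFin \o f) -> mu2.-integrable (square 0 1) (EFin \o g) ->
  (forall m n b, \int[mu2]_(z in square 0 1) (f z * wave m n b z) =
                 \int[mu2]_(z in square 0 1) (g z * wave m n b z)) ->
  0 < z0.1 < 1 -> 0 < z0.2 < 1 ->
  {for z0, continuous f} -> {for z0, continuous g} -> f z0 = g z0.
Proof.
have mS := @measurable_square R 0 1.
have le (h k : R * R -> R) : mu2.-integrable (square 0 1) (EFin \o h) -> mu2.-integrable (square 0 1) (EFin \o k) ->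
  (forall m n b, \int[mu2]_(z in square 0 1) (h z * wave m n b z) =
                 \int[mu2]_(z in square 0 1) (k z * wave m n b z)) ->
  0 < z0.1 < 1 -> 0 < z0.2 < 1 ->
  {for z0, continuous h} -> {for z0, continuous k} -> h z0 <= k z0.
  move=> ih ik hk z1 z2 ch ck; rewrite -subr_le0.
  have ihk : mu2.-integrable (square 0 1) (EFin \o (fun z => h z - k z)).
    have -> : (fun z => h z - k z) = (fun z => h z + -1 * k z).
      by apply/funext => z; rewrite mulN1r.
    exact: (integrable_addr (nu := leb2 R) mS ih (integrable_scaler (nu := leb2 R) (-1) mS ik)).
  apply: (orthogonal_le0 ihk) => //; last by apply: cvgB.
  move=> m n b; rewrite (@eq_Rintegral _ _ _ (leb2 R) _ (fun z => h z * wave m n b z - k z * wave m n b z)).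
    by rewrite RintegralB ?hk ?subrr//; exact: integrable_mul_wave.
  by move=> z _; rewrite mulrBl.
move=> iF iG hfg z1 z2 cf cg; apply/eqP; rewrite eq_le; apply/andP; split; exact: le.
Qed.

End uniqueness.

(** * Affine changes of variables for Lebesgue measure in the plane *)

Section affine.
Context {R : realType}.
Local Notation mu := (@lebesgue_measure R).
Local Notation mu2 := (leb2 R).

Definition affine1 (a b : R) (x : measurableTypeR R) : measurableTypeR R := a * x + b.

Lemma measurable_affine1 (a b : R) : measurable_fun setT (affine1 a b).
Proof. by apply: measurable_funD => //; exact: measurable_funM. Qed.

Lemma affine1_preimage_itv (a b : R) x y : 0 < a ->
  affine1 a b @^-1` `]x, y] = [set` `](x - b) / a, (y - b) / a]].
Proof.
move=> a0; apply/seteqP; split => z /=; rewrite !in_itv/= /affine1.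
  by rewrite ltr_pdivrMr// ler_pdivlMr// ltrBlDr lerBrDr mulrC.
by rewrite ltr_pdivrMr// ler_pdivlMr// ltrBlDr lerBrDr mulrC.
Qed.

(** a times the pushforward of Lebesgue measure agrees with Lebesgue measure on half-open intervals,
    hence everywhere by uniqueness. [leb2_affine] repeats the argument with rectangles. *)
Lemma lebesgue_measure_affine (a b : R) (A : set R) : 0 < a -> measurable A ->
  mu (affine1 a b @^-1` A) = (a^-1%:E * mu A)%E.
Proof.
move=> a0 mA.
have a0' : 0 <= a by exact: ltW.
pose push : {measure set (measurableTypeR R) -> \bar R} :=
  measure_function_pushforward__canonical__measure_function_Measure mu (measurable_affine1 a b).
pose nu : {measure set (measurableTypeR R) -> \bar R} := mscale (NngNum a0') push.
have H : mu A = nu A.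
  have Hu : forall X, ocitv X -> mu X = nu X.
    move=> _ [[x y] _ <-].
    rewrite /nu/= /mscale/= /pushforward affine1_preimage_itv//.
    rewrite !lebesgue_measure_itv/= !lte_fin ltr_pM2r ?invr_gt0// ltrD2r.
    case: ifP => _; last by rewrite mule0.
    rewrite -!EFinB -EFinM; congr EFin.
    by field; rewrite gt_eqF.
  exact: (lebesgue_measure_unique Hu mA).
rewrite H /nu/= /mscale/= /pushforward muleA -EFinM mulVf ?mul1e// gt_eqF//.
Qed.

Definition affine2 (a b c : R) (z : measurableTypeR R * measurableTypeR R) : measurableTypeR R * measurableTypeR R :=
  (affine1 a b z.1, affine1 a c z.2).

Lemma measurable_affine2 (a b c : R) : measurable_fun setT (affine2 a b c).
Proof.
exact: (measurable_fun_pair (measurableT_comp (measurable_affine1 a b) measurable_fst)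
  (measurableT_comp (measurable_affine1 a c) measurable_snd)).
Qed.

Lemma leb2_affine (a b c : R) (A : set (R * R)) : 0 < a -> measurable A ->
  mu2 A = ((a ^+ 2)%:E * mu2 (affine2 a b c @^-1` A))%E.
Proof.
move=> a0 mA.
have a0' : 0 <= a ^+ 2 by exact: sqr_ge0.
pose push : {measure set (measurableTypeR R * measurableTypeR R) -> \bar R} :=
  measure_function_pushforward__canonical__measure_function_Measure mu2 (measurable_affine2 a b c).
pose nu : {measure set (measurableTypeR R * measurableTypeR R) -> \bar R} := mscale (NngNum a0') push.
have Hu : forall B C, measurable B -> measurable C -> nu (B `*` C) = (mu B * mu C)%E.
  move=> B C mB mC; rewrite /nu/= /mscale/= /pushforward.
  have mB' : measurable (affine1 a b @^-1` B).
    by rewrite -[X in measurable X]setTI; exact: measurable_affine1.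
  have mC' : measurable (affine1 a c @^-1` C).
    by rewrite -[X in measurable X]setTI; exact: measurable_affine1.
  transitivity ((a ^+ 2)%:E * (mu (affine1 a b @^-1` B) * mu (affine1 a c @^-1` C)))%E.
    by congr (_ * _)%E; rewrite -product_measure1E.
  rewrite !lebesgue_measure_affine//.
  rewrite muleACA !muleA -!EFinM [X in X%:E](_ : _ = 1) ?mul1e//.
  by field; rewrite gt_eqF.
exact: (product_measure_unique Hu mA).
Qed.

Lemma ge0_integral_affine2 (a b c : R) (f : R * R -> \bar R) : 0 < a ->
  measurable_fun setT f -> (forall z, 0 <= f z)%E ->
  (\int[mu2]_z f z = (a ^+ 2)%:E * \int[mu2]_z f (a * z.1 + b, a * z.2 + c)%R)%E.
Proof.
move=> a0 mf f0.
have a0' : 0 <= a ^+ 2 by exact: sqr_ge0.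
pose push : {measure set (measurableTypeR R * measurableTypeR R) -> \bar R} :=
  measure_function_pushforward__canonical__measure_function_Measure mu2 (measurable_affine2 a b c).
transitivity (\int[mscale (NngNum a0') push]_z f z)%E.
  by apply: eq_measure_integral => A mA _; exact: leb2_affine.
have H1 := ge0_integral_mscale push measurableT (NngNum a0') mf (fun z _ => f0 z).
have H2 := ge0_integral_pushforward (measurable_affine2 a b c) mu2 measurableT mf (fun z _ => f0 z).
exact: (etrans H1 (congr1 (mule (a ^+ 2)%:E) H2)).
Qed.


Lemma integrable_affine2 (a b c : R) (f : R * R -> \bar R) : 0 < a ->
  mu2.-integrable setT f ->
  mu2.-integrable setT (fun z => f (a * z.1 + b, a * z.2 + c)).
Proof.
move=> a0 /integrableP[mf fi]; apply/integrableP; split.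
  exact: (measurableT_comp mf (measurable_affine2 a b c)).
have mabs : measurable_fun setT (fun z => `|f z|%E) by exact: measurableT_comp.
have := @ge0_integral_affine2 a b c (fun z => `|f z|%E) a0 mabs (fun z => abse_ge0 (f z)).
move: fi => /[swap] -> h.
rewrite ltNge leye_eq; apply/negP => /eqP E.
by move: h; rewrite E gt0_muley ?ltxx// lte_fin exprn_gt0.
Qed.

Lemma integral_affine2 (a b c : R) (f : R * R -> \bar R) : 0 < a ->
  mu2.-integrable setT f ->
  (\int[mu2]_z f z = (a ^+ 2)%:E * \int[mu2]_z f (a * z.1 + b, a * z.2 + c)%R)%E.
Proof.
move=> a0 fi; have mf : measurable_fun setT f by move/integrableP : fi => [].
have fia := integrable_affine2 b c a0 fi.
rewrite integralE [in RHS]integralE muleBr//; last first.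
  have p1 := integrable_fin_num measurableT (integrable_funepos measurableT fia).
  by apply: fin_num_adde_defr.
congr (_ - _)%E.
- by rewrite (ge0_integral_affine2 b c a0 (measurable_funepos mf) (funepos_ge0 f)); apply: (congr1 (mule _)); apply: eq_integral => z _; rewrite ?funeposE ?funenegE.
- by rewrite (ge0_integral_affine2 b c a0 (measurable_funeneg mf) (funeneg_ge0 f)); apply: (congr1 (mule _)); apply: eq_integral => z _; rewrite ?funeposE ?funenegE.
Qed.

Lemma Rintegral_scale_square (N : R) (f : R * R -> R) : 0 < N ->
  mu2.-integrable (square 0 N) (EFin \o f) ->
  mu2.-integrable (square 0 1) (EFin \o (fun z => f (N * z.1, N * z.2))) /\
  \int[mu2]_(z in square 0 1) f (N * z.1, N * z.2) = \int[mu2]_(z in square 0 N) f z / N ^+ 2.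
Proof.
move=> N0 fi.
pose g := (EFin \o f) \_ (square 0 N).
have gi : mu2.-integrable setT g.
  by have [H _] := integrable_mkcond (mu := mu2) (EFin \o f) (@measurable_square R 0 N); exact: H.
have gE : (fun z : R * R => g (N * z.1 + 0, N * z.2 + 0)) =
    (EFin \o (fun z => f (N * z.1, N * z.2))) \_ (square 0 1).
  apply/funext => -[x y]; rewrite /g /patch /= !addr0.
  congr (if _ then _ else _).
  apply/idP/idP; rewrite !inE /square /= !in_itv/=.
    by rewrite !pmulr_rge0// !ger_pMr.
  by rewrite !pmulr_rge0// !ger_pMr.
have gi' := integrable_affine2 0 0 N0 gi; rewrite gE in gi'.
have gI := integral_affine2 0 0 N0 gi; rewrite gE in gI.
split.
  have [_ H] := integrable_mkcond (mu := mu2) (EFin \o (fun z => f (N * z.1, N * z.2))) (@measurable_square R 0 1).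
  exact: H.
rewrite /Rintegral [in RHS]integral_mkcond -/g gI [in LHS]integral_mkcond.
rewrite fineM//; last exact: integrable_fin_num.
by rewrite /= mulrAC divff ?mul1r// gt_eqF// exprn_gt0.
Qed.

End affine.

(** * Identification of the torus energy with the closed form *)

Section energy.
Context {R : realType}.
Local Notation mu2 := (leb2 R).
Variables (N : R) (E : R * R -> R).
Hypotheses (N1 : 1 <= N) (hE : is_torus_energy N E).

Lemma torus_gt0 : 0 < N. Proof. exact: lt_le_trans N1. Qed.
Hint Resolve torus_gt0 : core.

Lemma measurable_torus : measurable_fun setT E.
Proof. by case: hE. Qed.

Lemma torus_periodic (m n : int) x : E (x + (m%:~R * N, n%:~R * N)) = E x.
Proof. by case: hE. Qed.

Lemma leb2_square (a b : R) : a <= b -> mu2 (square a b) = ((b - a) ^+ 2)%:E.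
Proof.
move=> ab.
have m1 : (@lebesgue_measure R) `[a, b] = (b - a)%:E.
  rewrite lebesgue_measure_itv/= lte_fin; case: ltP => h //.
  by have -> : a = b; [apply/eqP; rewrite eq_le ab|rewrite subrr].
transitivity ((@lebesgue_measure R) `[a, b] * (@lebesgue_measure R) `[a, b])%E.
  exact: product_measure1E.
by rewrite m1 -EFinM expr2.
Qed.

(** The square has finite measure and |E| <= 1 + E^2. *)
Lemma integrable_torus : mu2.-integrable (square 0 N) (EFin \o E).
Proof.
have mS := @measurable_square R 0 N.
case: hE => mE _ i2 _ _.
have fS : (mu2 (square 0 N) < +oo)%E by rewrite leb2_square ?ltry// ltW.
have i3 := integrable_addr (nu := mu2) mS (integrable_const (nu := mu2) 1 mS fS) i2.
apply: le_integrable i3 => //.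
  by apply/measurable_EFinP; apply: measurable_funTS.
move=> z _ /=; rewrite lee_fin [leRHS]ger0_norm; last by rewrite addr_ge0// sqr_ge0.
have := sqr_ge0 (`|E z| - 1); rewrite sqrrB1 real_normK ?num_real//.
by have := normr_ge0 (E z); lra.
Qed.

(** After rescaling to the unit square, E and [kfun] have the same coefficients against every
    [wave], and both are continuous at interior points; [wave_coef_inj] concludes. *)
Lemma torus_kfun (x y : R) : 0 < x < 1 -> 0 < y < 1 -> E (N * x, N * y) = kfun x y.
Proof.
move=> hx hy.
have mS := @measurable_square R 0 N.
case: (hE) => mE per i2 cE coef.
pose f (z : R * R) := E (N * z.1, N * z.2).
have [fi _] := Rintegral_scale_square torus_gt0 integrable_torus.
apply: (@wave_coef_inj R f (fun z => kfun z.1 z.2) (x, y)) => //.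
- exact: integrable_kfun.
- move=> m n b; rewrite coef_kfun.
  pose g (z : R * R) := E z * cos (fourier_phase N m n z - b).
  have bc (c : R * R -> R) : measurable_fun setT c -> (forall z, `|c z| <= 1) ->
     mu2.-integrable (square 0 N) (EFin \o (fun z => E z * c z)).
    move=> mc c1; apply: le_integrable integrable_torus => //.
      apply/measurable_EFinP; apply: measurable_funTS; exact: measurable_funM.
    by move=> z _ /=; rewrite lee_fin normrM ler_piMr.
  have mph : measurable_fun setT (fourier_phase N m n).
    apply: measurable_funM => //; apply: measurable_funD.
      by apply: measurable_funM => //; apply: measurable_funM => //; exact: measurable_fst.
    by apply: measurable_funM => //; apply: measurable_funM => //; exact: measurable_snd.
  have mc : measurable_fun setT (fun z => cos (fourier_phase N m n z)).
    by apply: measurableT_comp => //; exact: continuous_measurable_fun (@continuous_cos R).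
  have ms : measurable_fun setT (fun z => sin (fourier_phase N m n z)).
    by apply: measurableT_comp => //; exact: continuous_measurable_fun (@continuous_sin R).
  have ic := bc _ mc (fun z => cos_max _).
  have is_ := bc _ ms (fun z => sin_max _).
  have gE : g = (fun z => cos b * (E z * cos (fourier_phase N m n z)) + sin b * (E z * sin (fourier_phase N m n z))).
    by apply/funext => z; rewrite /g cosB; ring.
  have jc := integrable_scaler (nu := mu2) (cos b) mS ic.
  have js := integrable_scaler (nu := mu2) (sin b) mS is_.
  have ig : mu2.-integrable (square 0 N) (EFin \o g).
    by rewrite gE; exact: (integrable_addr (nu := mu2) mS jc js).
  have [_ gI] := Rintegral_scale_square torus_gt0 ig.
  transitivity (\int[mu2]_(z in square 0 1) g (N * z.1, N * z.2)).
    apply: eq_Rintegral => z _; rewrite /g /f /wave /fourier_phase/=; congr (_ * cos _).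
    by field; rewrite gt_eqF.
  rewrite gI gE RintegralD// !RintegralZl//.
  have [e1 e2] := coef m n.
  rewrite mulrDl -!mulrA e1 e2 mulr0 addr0.
  by case: ifP => _; rewrite ?mulr0.
- have ns : ~ lattice N (N * x, N * y).
    move=> [m [n [hm _]]]; move: hm; rewrite mulrC => /(mulIf (lt0r_neq0 torus_gt0)) hm.
    move: hx; rewrite hm ltr0z -[1]/(1%:~R) ltr_int; case: m {hm} => [[|m]|m]//.
  have c1 : (N * u.1, N * u.2) @[u --> (x, y)] --> (N * x, N * y).
    have cx : N * u.1 @[u --> (x, y)] --> N * x by apply: cvgM; [exact: cvg_cst|exact: cvg_fst].
    have cy : N * u.2 @[u --> (x, y)] --> N * y by apply: cvgM; [exact: cvg_cst|exact: cvg_snd].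
    exact: (cvg_pair cx cy).
  exact: (@cvg_comp _ _ _ (fun u : R * R => (N * u.1, N * u.2)) E (nbhs (x, y)) (nbhs (N * x, N * y)) (nbhs (E (N * x, N * y))) c1 (cE _ ns)).
- exact: continuous_kfun.
Qed.

(** A period is added to each negative coordinate to reach the open cell. Periodicity of [kfun] in x
    undoes the first shift; the reflection y to 1 - y turns the second into |v.2|. Points on the
    axes would land on the edges of the cell. *)
Lemma torus_kfun_abs (v : R * R) : v.1 != 0 -> v.2 != 0 -> `|v.1| < N -> `|v.2| < N ->
  E v = kfun (v.1 / N) (`|v.2| / N).
Proof.
move=> v1 v2 h1 h2.
pose m : int := if v.1 < 0 then 1 else 0.
pose n : int := if v.2 < 0 then 1 else 0.
have N0 := torus_gt0.
rewrite -(torus_periodic m n v).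
have -> : v + (m%:~R * N, n%:~R * N) = (N * (v.1 / N + m%:~R), N * (v.2 / N + n%:~R)).
  rewrite [v in LHS]surjective_pairing /=; congr pair; rewrite /=; by field; rewrite gt_eqF.
have rng (t : R) : t != 0 -> `|t| < N -> 0 < t / N + (if t < 0 then 1 else 0)%:~R < 1.
  move=> t0; rewrite ltr_norml => /andP[ta tb].
  have ta' : -1 < t / N by rewrite ltr_pdivlMr// mulN1r.
  have tb' : t / N < 1 by rewrite ltr_pdivrMr// mul1r.
  case: (ltP t 0) => ht.
    have : t / N < 0 by rewrite pmulr_llt0 ?invr_gt0.
    by rewrite -[1%:~R]/(1 : R) => ?; apply/andP; split; lra.
  have : 0 < t / N by rewrite divr_gt0// lt_def t0.
  by rewrite -[0%:~R]/(0 : R) => ?; apply/andP; split; lra.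
rewrite torus_kfun; [|exact: rng|exact: rng].
have -> : kfun (v.1 / N + m%:~R) = kfun (v.1 / N) :> (R -> R).
  apply/funext => y; rewrite /m; case: ifP => _; first exact: kfunD1.
  by rewrite addr0.
rewrite /n; case: (ltP v.2 0) => ht; last by rewrite addr0 ger0_norm.
have tN : -1 < v.2 / N < 0.
  rewrite ltr_pdivlMr// mulN1r pmulr_llt0 ?invr_gt0// ht andbT.
  by move: h2; rewrite ltr_norml => /andP[].
have /andP[t0 t1] : 0 <= - (v.2 / N) <= 1.
  by case/andP: tN => ta tb; rewrite oppr_ge0 (ltW tb) lerNl (ltW ta).
rewrite (ltr0_norm ht) mulNr.
transitivity (kfun (v.1 / N) (1 - - (v.2 / N))); last exact: (kfun_reflect _ t0 t1).
by rewrite opprK addrC.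
Qed.

End energy.

(** * Sums over ordered pairs of distinct points of a finite configuration *)

Section pair_sums.
Context {R : realType} {T : choiceType}.
Implicit Types (S : set T) (F : T * T -> R).

Lemma finite_distinct_pairs S : finite_set S -> finite_set (distinct_pairs S).
Proof.
move=> fS; apply: sub_finite_set (finite_setX fS fS).
by move=> [a b] [].
Qed.

Lemma fset_setP S : finite_set S -> forall a, (a \in (fset_set S : seq T)) = (a \in S).
Proof. by move=> fS a; rewrite in_fset_set. Qed.

Lemma fsbig_distinct_pairs S F : finite_set S ->
  \sum_(p \in distinct_pairs S) F p =
  \sum_(a <- fset_set S) \sum_(b <- fset_set S | a != b) F (a, b).
Proof.
move=> fS; pose s : seq T := fset_set S.
pose r := [seq p <- [seq (a, b) | a <- s, b <- s] | p.1 != p.2].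
have ur : uniq r.
  by rewrite filter_uniq// allpairs_uniq// ?fset_uniq// => -[a b] [c d] _ _ [-> ->].
have -> : distinct_pairs S = [set` r].
  apply/seteqP; split => -[a b] /=; rewrite mem_filter /=.
    move=> [/= Sa Sb ab]; apply/andP; split; first exact/eqP.
    by apply/allpairsP; exists (a, b); rewrite /s !fset_setP// !inE.
  move=> /andP[/eqP ab /allpairsP[[c d] [/= cs ds [ac bd]]]].
  move: cs ds; rewrite -ac -bd /s !fset_setP// !inE => Sa Sb.
  by split.
rewrite -fsbig_seq// /r big_filter big_mkcond big_allpairs_dep/=.
by apply: eq_bigr => a _; rewrite [RHS]big_mkcond.
Qed.

(** The full product of sums minus its diagonal. This expresses pair counts on rectangles through
    point counts. *)
Lemma fsbig_rect_pairs S (f g : T -> R) : finite_set S ->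
  \sum_(p \in distinct_pairs S) (f p.1 * g p.2) =
  (\sum_(a \in S) f a) * (\sum_(a \in S) g a) - \sum_(a \in S) (f a * g a).
Proof.
move=> fS; rewrite fsbig_distinct_pairs// !fsbig_finite// mulr_suml -sumrB.
apply: eq_big_seq => a aS.
rewrite mulr_sumr [in RHS](bigD1_seq a)/= ?fset_uniq// addrAC subrr add0r.
by apply: eq_bigl => b; rewrite eq_sym.
Qed.

End pair_sums.

Section limits.
Context {R : realType}.

Lemma cvg_sum_seq (I : Type) (s : seq I) (u : nat -> I -> R) (l : I -> R) :
  (forall i, u n i @[n --> \oo] --> l i) ->
  \sum_(i <- s) u n i @[n --> \oo] --> \sum_(i <- s) l i.
Proof.
move=> h; elim: s => [|i s IH].
  under eq_fun do rewrite big_nil.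
  by rewrite big_nil; exact: cvg_cst.
under eq_fun do rewrite big_cons.
by rewrite big_cons; apply: cvgD.
Qed.

Lemma cvg_indic_bigcup (T : Type) (F : nat -> set T) (p : T) : trivIset setT F ->
  (\sum_(k < n) \1_(F k) p : R) @[n --> \oo] --> (\1_(\bigcup_k F k) p : R).
Proof.
move=> tF; rewrite indicE; case: (boolP (p \in \bigcup_k F k)) => [|/negP hp]; last first.
  have -> : (fun n => \sum_(k < n) \1_(F k) p : R) = (fun=> 0).
    apply/funext => n; rewrite big1// => k _; rewrite indicE; case: (boolP (p \in F k)) => //.
    by rewrite inE => pk; case: hp; rewrite inE; exists k.
  exact: cvg_cst.
rewrite inE => -[k0 _ pk0].
apply: cvg_near_cst; exists k0.+1 => // n /= hn.
rewrite (bigD1 (Ordinal hn))//= indicE mem_set//= big1 ?addr0// => k kk0.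
rewrite indicE memNset// => pk; move/eqP: kk0; apply; apply/val_inj => /=.
by apply: tF => //; exists p.
Qed.

End limits.

(** * Measurability of pair sums of the process in a bounded window *)

Section measurable_sums.
Context {d : measure_display} {Omega : measurableType d} {R : realType}.
Variable X : Omega -> set (R * R).
Hypothesis hX : simple_point_process X.
Variable Q : set (R * R).
Hypotheses (mQ : measurable Q) (finQ : forall w, finite_set (X w `&` Q)).

(** The number of points in Q and A, written as a real sum so that it fits [fsbig_rect_pairs]. *)
Definition npts (A : set (R * R)) (w : Omega) : R := \sum_(a \in X w `&` Q) (\1_A a : R).

Lemma nptsE A w : npts A w = (size (fset_set (X w `&` (Q `&` A))))%:R.
Proof.
have fA : finite_set (X w `&` (Q `&` A)).
  by apply: sub_finite_set (finQ w) => a [Xa [Qa _]].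
transitivity (\sum_(a \in X w `&` (Q `&` A)) (1 : R)).
  rewrite setIA fsbig_mkcondr; apply: eq_fsbigr => a _.
  by rewrite indicE /patch; case: ifP.
by rewrite fsbig_finite// big_const_seq count_predT iter_addr_0.
Qed.

Lemma measurable_npts A : measurable A -> measurable_fun setT (npts A).
Proof.
move=> mA _ B mB; rewrite setTI.
have -> : npts A @^-1` B = \bigcup_(k in [set k | B k%:R])
    (X @^-1` [set S | (S `&` (Q `&` A) #= `I_k)%card]).
  apply/seteqP; split => w /=.
    rewrite nptsE => Bw; exists (size (fset_set (X w `&` (Q `&` A)))) => //=.
    have : finite_set (X w `&` (Q `&` A)).
      by apply: sub_finite_set (finQ w) => a [Xa [Qa _]].
    by move=> [n hn]; rewrite (card_fset_set hn).
  by move=> [k /= Bk hk]; rewrite nptsE (card_fset_set hk).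
apply: bigcup_measurable => k _.
have [_ mX] := hX; apply: mX; apply: sub_sigma_algebra.
by exists (Q `&` A); split; [exact: measurableI|exists k].
Qed.

Definition pair_sum (F : (R * R) * (R * R) -> R) (w : Omega) : R :=
  \sum_(p \in distinct_pairs (X w `&` Q)) F p.

Lemma pair_sumE w : exists s : seq ((R * R) * (R * R)), forall F, pair_sum F w = \sum_(p <- s) F p.
Proof.
have fD : finite_set (distinct_pairs (X w `&` Q)) by exact: finite_distinct_pairs.
by exists (fset_set (distinct_pairs (X w `&` Q))) => G; rewrite /pair_sum fsbig_finite.
Qed.

Lemma measurable_pair_rect A B : measurable A -> measurable B ->
  measurable_fun setT (pair_sum \1_(A `*` B)).
Proof.
move=> mA mB.
have -> : pair_sum \1_(A `*` B) = (fun w => npts A w * npts B w - npts (A `&` B) w).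
  apply/funext => w; rewrite /pair_sum /npts.
  rewrite (eq_fsbigr (fun p : (R * R) * (R * R) => \1_A p.1 * \1_B p.2)); last first.
    by move=> p _; rewrite !indicE in_setX -natrM mulnb.
  rewrite fsbig_rect_pairs//; congr (_ - _).
  by apply: eq_fsbigr => a _; rewrite !indicE in_setI -natrM mulnb.
apply: measurable_funB; last by apply: measurable_npts; exact: measurableI.
by apply: measurable_funM; exact: measurable_npts.
Qed.

(** Dynkin's theorem: rectangles form a pi-system on which pair counts are polynomials in point
    counts. Complements work because the total pair count is finite. *)
Lemma measurable_pair_indic (B : set ((R * R) * (R * R))) : measurable B ->
  measurable_fun setT (pair_sum \1_B).
Proof.
move=> mB.
pose G := [set C : set ((R * R) * (R * R)) | exists A1, measurable A1 /\ exists2 A2, measurable A2 & C = A1 `*` A2].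
have GE : (@measurable _ ((R * R) * (R * R))%type) = <<s G >>.
  rewrite measurable_prod_measurableType; congr (<<s _ >>).
  apply/seteqP; split => C /=.
    by move=> [A1 mA1 [A2 mA2 <-]]; exists A1; split => //; exists A2.
  by move=> [A1 [mA1 [A2 mA2 ->]]]; exists A1 => //; exists A2.
apply: (@dynkin_induction _ _ G (fun B => measurable_fun setT (pair_sum \1_B)) GE).
- move=> _ _ [A1 [mA1 [A2 mA2 ->]]] [B1 [mB1 [B2 mB2 ->]]].
  exists (A1 `&` B1); split; first exact: measurableI.
  by exists (A2 `&` B2); [exact: measurableI|rewrite setXI].
- by rewrite -setXTT; exact: measurable_pair_rect.
- by move=> _ [A1 [mA1 [A2 mA2 ->]]]; exact: measurable_pair_rect.
- move=> C mC hC.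
  have -> : pair_sum \1_(~` C) = (fun w => pair_sum \1_(setT `*` setT) w - pair_sum \1_C w).
    apply/funext => w; have [s hs] := pair_sumE w.
    rewrite !hs -sumrB; apply: eq_bigr => p _.
    by rewrite setXTT !indicE in_setT in_setC; case: (_ \in C); rewrite ?subrr ?subr0.
  by apply: measurable_funB => //; exact: measurable_pair_rect.
- move=> F mF tF hF.
  apply: (@measurable_fun_cvg _ _ _ setT (fun n w => \sum_(k < n) pair_sum \1_(F k) w)).
    by move=> n; apply: measurable_sum => k; exact: hF.
  move=> w _; have [s hs] := pair_sumE w.
  rewrite hs; have -> : (fun n => \sum_(k < n) pair_sum \1_(F k) w) =
      (fun n => \sum_(p <- s) \sum_(k < n) \1_(F k) p).
    by apply/funext => n; rewrite exchange_big/=; apply: eq_bigr => k _; rewrite hs.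
  by apply: cvg_sum_seq => p; exact: cvg_indic_bigcup.
- by rewrite -GE.
Qed.


Import HBNNSimple.

(** Increasing simple approximations of F converge pointwise, and for each outcome only finitely
    many pairs occur, so the limit passes through the sum. *)
Lemma measurable_pair_sum_ge0 (F : (R * R) * (R * R) -> R) :
  measurable_fun setT F -> (forall p, 0 <= F p) -> measurable_fun setT (pair_sum F).
Proof.
move=> mF F0; have mE : measurable_fun setT (EFin \o F) by exact/measurable_EFinP.
pose f := nnsfun_approx measurableT mE.
apply: (@measurable_fun_cvg _ _ _ setT (fun n => pair_sum (f n))).
  move=> n.
  have -> : pair_sum (f n) = (fun w => \sum_(y <- fset_set (range (f n))) y * pair_sum \1_(f n @^-1` [set y]) w).
    apply/funext => w; have [s hs] := pair_sumE w.
    rewrite hs; under [RHS]eq_bigr do rewrite hs mulr_sumr.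
    rewrite exchange_big/=; apply: eq_bigr => p _.
    by rewrite fimfunE fsbig_finite.
  apply: measurable_sum => y; apply: measurable_funM => //.
  by apply: measurable_pair_indic; exact: measurable_funPTI.
move=> w _; have [s hs] := pair_sumE w.
rewrite hs (_ : (fun n => pair_sum (f n) w) = (fun n => \sum_(p <- s) f n p)); last first.
  by apply/funext => n; rewrite hs.
apply: cvg_sum_seq => p.
have h : (EFin \o (fun n => f n p)) n @[n --> \oo] --> (F p)%:E.
  by apply: cvg_nnsfun_approx => // x _; rewrite lee_fin.
by move/fine_cvgP : h => [].
Qed.

Lemma pair_sumB (F G : (R * R) * (R * R) -> R) w :
  pair_sum (fun p => F p - G p) w = pair_sum F w - pair_sum G w.
Proof. by have [s hs] := pair_sumE w; rewrite !hs -sumrB. Qed.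

Lemma pair_sum_ge0 (F : (R * R) * (R * R) -> R) w : (forall p, 0 <= F p) -> 0 <= pair_sum F w.
Proof. by move=> F0; have [s hs] := pair_sumE w; rewrite hs sumr_ge0. Qed.

Lemma esum_pair_sum (F : (R * R) * (R * R) -> R) w : (forall p, 0 <= F p) ->
  (\esum_(p in distinct_pairs (X w)) (\1_(Q `*` Q) p * F p)%:E)%R = (pair_sum F w)%:E.
Proof.
move=> F0.
have E : distinct_pairs (X w `&` Q) = distinct_pairs (X w) `&` (Q `*` Q).
  apply/seteqP; split => -[a b] /=; first by move=> [[Xa Qa] [Xb Qb] ab].
  by move=> [[/= Xa Xb ab] [/= Qa Qb]].
rewrite (eq_esum (b := fun p => if p \in Q `*` Q then (F p)%:E else 0%E)); last first.
  by move=> p _; rewrite indicE; case: ifP => _; rewrite ?mul1r ?mul0r.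
rewrite -esum_mkcondr -E esum_fset; last 2 first.
- exact: finite_distinct_pairs.
- by move=> p _; rewrite lee_fin.
by rewrite fsumEFin//; exact: finite_distinct_pairs.
Qed.

Lemma esum_npts w : (\esum_(a in X w) (\1_Q a)%:E)%R = (npts setT w)%:E.
Proof.
rewrite (eq_esum (b := fun a => if a \in Q then 1%:E else 0%E)); last first.
  by move=> p _; rewrite indicE; case: ifP => _.
rewrite -esum_mkcondr esum_fset//.
rewrite (eq_fsbigr (fun a => (\1_setT a : R)%:E)).
  by rewrite -fsumEFin.
by move=> a _; rewrite indicT.
Qed.

Lemma pair_sum1 w : pair_sum (fun=> 1) w = npts setT w ^+ 2 - npts setT w.
Proof.
rewrite /pair_sum (eq_fsbigr (fun p : (R * R) * (R * R) => \1_(setT : set (R * R)) p.1 * \1_(setT : set (R * R)) p.2)); last first.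
  by move=> p _; rewrite !indicT mulr1.
rewrite fsbig_rect_pairs//; congr (_ - _).
by apply: eq_fsbigr => a _; rewrite !indicT mulr1.
Qed.

End measurable_sums.

(** * From pairs of points in a square to their difference *)

Section difference_law.
Context {R : realType}.
Local Notation mu := (@lebesgue_measure R).
Local Notation mu2 := (leb2 R).

Lemma ge0_integral_shift2 (y : R * R) (f : R * R -> \bar R) :
  measurable_fun setT f -> (forall z, 0 <= f z)%E ->
  (\int[mu2]_z f z = \int[mu2]_z f (z + y)%R)%E.
Proof.
move=> mf f0; rewrite (ge0_integral_affine2 y.1 y.2 ltr01 mf f0) expr1n mul1e.
by apply: eq_integral => z _; congr (f _); rewrite !mul1r.
Qed.

Lemma measurable_addp : measurable_fun setT (fun p : (R * R) * (R * R) => p.1 + p.2).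
Proof.
rewrite (_ : (fun p : (R * R) * (R * R) => p.1 + p.2) = (fun p => (p.1.1 + p.2.1, p.1.2 + p.2.2)))//.
have m1 := @measurable_fst _ _ (R * R)%type (R * R)%type.
have m2 := @measurable_snd _ _ (R * R)%type (R * R)%type.
have n1 := @measurable_fst _ _ R R.
have n2 := @measurable_snd _ _ R R.
apply: measurable_fun_pair; apply: measurable_funD.
- exact: measurableT_comp n1 m1.
- exact: measurableT_comp n1 m2.
- exact: measurableT_comp n2 m1.
- exact: measurableT_comp n2 m2.
Qed.

Lemma measurable_subp : measurable_fun setT (fun p : (R * R) * (R * R) => p.1 - p.2).
Proof.
rewrite (_ : (fun p : (R * R) * (R * R) => p.1 - p.2) = (fun p => (p.1.1 - p.2.1, p.1.2 - p.2.2)))//.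
have m1 := @measurable_fst _ _ (R * R)%type (R * R)%type.
have m2 := @measurable_snd _ _ (R * R)%type (R * R)%type.
have n1 := @measurable_fst _ _ R R.
have n2 := @measurable_snd _ _ R R.
apply: measurable_fun_pair; apply: measurable_funB.
- exact: measurableT_comp n1 m1.
- exact: measurableT_comp n1 m2.
- exact: measurableT_comp n2 m1.
- exact: measurableT_comp n2 m2.
Qed.

(* The library declares no sigma-finiteness instance for the product of two
   Lebesgue measures, which Tonelli's theorem on the plane needs. *)
Definition plane_measure : set (measurableTypeR R * measurableTypeR R) -> \bar R := mu2.

HB.instance Definition _ := Measure.on plane_measure.

Lemma plane_measure_sigma_finite : sigma_finite setT plane_measure.
Proof.
exists (fun n => square (- n%:R) n%:R).
  apply/seteqP; split => // -[x y] _.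
  exists (Num.trunc (`|x| + `|y|)).+1 => //.
  have h : `|x| + `|y| < (Num.trunc (`|x| + `|y|)).+1%:R by rewrite truncnS_gt.
  split; rewrite /= in_itv/= -ler_norml; apply/ltW; apply: le_lt_trans h.
    by rewrite lerDl.
  by rewrite lerDr.
move=> n; split; first exact: measurable_square.
have n0 : - n%:R <= n%:R :> R by apply: (@le_trans _ _ 0); rewrite ?oppr_le0.
by rewrite /plane_measure leb2_square// ltry.
Qed.

HB.instance Definition _ := Measure_isSigmaFinite.Build _ _ _ plane_measure
  plane_measure_sigma_finite.

Lemma ge0_integral_pairs (f : (R * R) * (R * R) -> \bar R) :
  measurable_fun setT f -> (forall p, 0 <= f p)%E ->
  (\int[plane_measure \x plane_measure]_p f p = \int[mu2]_y \int[mu2]_v f ((v + y)%R, y))%E.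
Proof.
move=> mf f0.
apply: (etrans (@fubini_tonelli2 _ _ _ _ _ plane_measure plane_measure f mf f0)).
apply: eq_integral => y _.
apply: (@ge0_integral_shift2 y (fun x => f (x, y))) => //.
exact: measurableT_comp mf (measurable_pair2 y).
Qed.

(** The length of the intersection of [0,N] with its translate by t; [tent2] is the corresponding
    area for the square. *)
Definition tent (N t : R) : R := Num.max 0 (N - `|t|).
Definition tent2 (N : R) (v : R * R) : R := tent N v.1 * tent N v.2.

Lemma tent_ge0 N t : 0 <= tent N t. Proof. by rewrite /tent le_max lexx. Qed.

Lemma tent2_ge0 N v : 0 <= tent2 N v. Proof. by rewrite mulr_ge0// tent_ge0. Qed.

Lemma measurable_tent2 N : measurable_fun setT (tent2 N).
Proof.
have mt : measurable_fun setT (tent N).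
  by apply: measurable_maxr => //; apply: measurable_funB => //; exact: measurableT_comp.
by apply: measurable_funM; apply: measurableT_comp => //.
Qed.

Definition slab (N t : R) : set R := [set y | (0 <= t + y <= N) && (0 <= y <= N)].

Lemma itv_inter_shift (N t : R) : 0 <= N ->
  mu (slab N t) = (tent N t)%:E.
Proof.
move=> N0.
have -> : slab N t = `[Num.max 0 (- t), Num.min N (N - t)]%classic.
  apply/seteqP; split => y /=; rewrite in_itv/= ge_max le_min.
    by move=> /andP[/andP[a b] /andP[c d]]; apply/andP; split; apply/andP; split; lra.
  by move=> /andP[/andP[a b] /andP[c d]]; apply/andP; split; apply/andP; split; lra.
rewrite lebesgue_measure_itv/= lte_fin /tent.
have -> : Num.max 0 (- t) = (`|t| - t) / 2 by case: (ger0P t) => h; [rewrite max_l; lra|rewrite max_r; lra].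
have -> : Num.min N (N - t) = N - (`|t| + t) / 2 by case: (ger0P t) => h; [rewrite min_r; lra|rewrite min_l; lra].
case: ltP => h.
  by rewrite max_r -?EFinB; [congr EFin|]; lra.
by rewrite max_l//; lra.
Qed.

Lemma square_inter_shift (N : R) (v : R * R) : 0 <= N ->
  mu2 [set y | square 0 N (v + y) /\ square 0 N y] = (tent2 N v)%:E.
Proof.
move=> N0.
have -> : [set y | square 0 N (v + y) /\ square 0 N y] =
  slab N v.1 `*` slab N v.2.
  apply/seteqP; split => -[a b] /=; rewrite /square /slab /= !in_itv/=.
    by move=> [[h1 h2] [h3 h4]]; split; apply/andP; split.
  by move=> [/andP[h1 h3] /andP[h2 h4]].
have ms t : measurable (slab N t).
  have -> : slab N t = ((fun y => t + y) @^-1` `[0, N]) `&` `[0, N].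
    by apply/seteqP; split => y /=; rewrite /slab /= !in_itv/=; [move=> /andP[]|move=> [h1 h2]; apply/andP].
  apply: measurableI => //; rewrite -[X in measurable X]setTI.
  by have mt : measurable_fun setT (fun y : R => t + y) by [exact: measurable_funD]; exact: mt.
transitivity (mu (slab N v.1) * mu (slab N v.2))%E.
  by apply: product_measure1E; exact: ms.
by rewrite !itv_inter_shift.
Qed.

(** Substitute x = v + y and integrate in y first: the inner integral is the area of the set of y
    such that y and v + y both lie in the square. *)
Lemma ge0_integral_tent (N : R) (g : R * R -> \bar R) : 0 <= N ->
  measurable_fun setT g -> (forall z, 0 <= g z)%E ->
  (\int[plane_measure \x plane_measure]_p ((\1_(square 0 N `*` square 0 N) p)%:E * g (p.1 - p.2)%R)
   = \int[mu2]_v ((tent2 N v)%:E * g v))%E.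
Proof.
move=> N0 mg g0.
have mS := @measurable_square R 0 N.
have mgs : measurable_fun setT (fun p : (R * R) * (R * R) => g (p.1 - p.2)) by exact: measurableT_comp mg measurable_subp.
have mI : measurable_fun setT (fun p : (R * R) * (R * R) => (\1_(square 0 N `*` square 0 N) p : R)%:E).
  by apply/measurable_EFinP; apply: measurable_indic; exact: measurableX.
rewrite ge0_integral_pairs; last 2 first.
- exact: emeasurable_funM.
- by move=> p; rewrite mule_ge0// lee_fin.
pose f (p : (R * R) * (R * R)) := ((\1_(square 0 N `*` square 0 N) (p.2 + p.1, p.1)%R)%:E * g p.2)%E.
transitivity (\int[mu2]_y \int[mu2]_v f (y, v))%E.
  by apply: eq_integral => y _; apply: eq_integral => v _; rewrite /f /= addrK.
have msw : measurable_fun setT (fun p : (R * R) * (R * R) => (p.2 + p.1, p.1)).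
  apply: measurable_fun_pair; last exact: measurable_fst.
  rewrite (_ : (fun p : (R * R) * (R * R) => p.2 + p.1) = (fun p => p.1 + p.2)); last first.
    by apply/funext => p; rewrite addrC.
  exact: measurable_addp.
rewrite (@fubini_tonelli _ _ _ _ _ plane_measure plane_measure); last 2 first.
- apply: emeasurable_funM; first exact: (measurableT_comp mI msw).
  by apply: measurableT_comp => //; exact: measurable_snd.
- by move=> p; rewrite mule_ge0// lee_fin.
apply: eq_integral => v _.
rewrite /f /=.
have mA : measurable [set y | square 0 N (v + y) /\ square 0 N y].
  apply: measurableI => //; rewrite -[X in measurable X]setTI.
  have : measurable_fun setT (fun y : R * R => v + y).
    rewrite (_ : (fun y : R * R => v + y) = (fun y => (v.1 + y.1, v.2 + y.2)))//.
    by apply: measurable_fun_pair; apply: measurable_funD => //.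
  by apply.
transitivity (\int[mu2]_y (g v * (\1_[set y | square 0 N (v + y) /\ square 0 N y] y)%:E))%E.
  apply: eq_integral => y _; rewrite muleC; congr (mule (g v)); congr EFin.
rewrite ge0_integralZl//; last by apply/measurable_EFinP; exact: measurable_indic.
rewrite muleC integral_indic// setIT; apply: (congr1 (fun t => t * g v)%E); exact: square_inter_shift.
Qed.

End difference_law.

(** * Expected pair sums, the almost sure bound T2 <= 1, and the variance inequality *)

Section process.
Context {R : realType} {d : measure_display} {Omega : measurableType d}.
Variables (P : probability Omega R) (X : Omega -> set (R * R)) (T2 : R * R -> R).
Hypotheses (hX : simple_point_process X)
  (hrho1 : one_point_correlation P X (fun=> 1))
  (hrho2 : two_point_correlation P X (fun p => 1 - T2 (p.1 - p.2)))
  (hT2 : measurable_fun setT T2).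
Local Notation mu := (@lebesgue_measure R).
Local Notation mu2 := (leb2 R).
Local Notation plane := (@plane_measure R).

Lemma two_point_plane (F : (R * R) * (R * R) -> \bar R) :
  measurable_fun setT F -> (forall p, 0 <= F p)%E ->
  (\int[P]_w (\esum_(p in distinct_pairs (X w)) F p) =
   \int[plane \x plane]_p (F p * (1 - T2 (p.1 - p.2))%:E))%E.
Proof. by move=> mF F0; have [_ H] := hrho2; exact: H. Qed.

(** Positive and negative parts of 1 - T2. Nonnegativity of the two-point function is not a
    pointwise assumption; it is recovered almost everywhere through [integral_rho_neg]. *)
Definition rho_pos (v : R * R) : R := Num.max 0 (1 - T2 v).
Definition rho_neg (v : R * R) : R := Num.max 0 (T2 v - 1).

Lemma rho_pos_ge0 v : 0 <= rho_pos v. Proof. by rewrite le_max lexx. Qed.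
Lemma rho_neg_ge0 v : 0 <= rho_neg v. Proof. by rewrite le_max lexx. Qed.

Lemma max_rho_pos (t g : R) v : 0 <= t * g ->
  Num.max (t * g * (1 - T2 v)) 0 = t * (g * rho_pos v).
Proof. by move=> tg; rewrite mulrA /rho_pos maxC maxr_pMr// mulr0. Qed.

Lemma max_rho_neg (t g : R) v : 0 <= t * g ->
  Num.max (- (t * g * (1 - T2 v))) 0 = t * (g * rho_neg v).
Proof. by move=> tg; rewrite mulrA /rho_neg maxC maxr_pMr// mulr0 -mulrN opprB. Qed.

Lemma measurable_rho_pos : measurable_fun setT rho_pos.
Proof. by apply: measurable_maxr => //; exact: measurable_funB. Qed.

Lemma measurable_rho_neg : measurable_fun setT rho_neg.
Proof. by apply: measurable_maxr => //; exact: measurable_funB. Qed.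

Definition excess_set : set (R * R) := [set v | 1 < T2 v].

Lemma rho_negE (t : R) v :
  t * \1_excess_set v * (1 - T2 v) = - (t * rho_neg v).
Proof.
rewrite -mulrA -mulrN; congr (_ * _); rewrite /rho_neg indicE.
case: (ltP 1 (T2 v)) => h.
  by rewrite mem_set// mul1r max_r ?opprB// subr_ge0 ltW.
have hn : ~ excess_set v by move=> /= h'; move: (lt_le_trans h' h); rewrite ltxx.
by rewrite memNset// mul0r max_l ?oppr0// subr_le0.
Qed.

(** Test the two-point correlation on pairs with y in the unit square and T2(x - y) > 1. The
    expectation is nonnegative, while the integral equals minus the integral of [rho_neg]. *)
Lemma integral_rho_neg : (\int[mu2]_v (rho_neg v)%:E = 0)%E.
Proof.
pose S := square (0 : R) 1.
have mS : measurable S := measurable_square 0 1.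
have mB : measurable excess_set.
  have := measurable_fun_ltr (@measurable_cst _ _ (R * R)%type R setT 1) hT2.
  by move=> /(_ measurableT [set true] (@measurableT _ bool)); rewrite setTI.
have mS1 : measurable_fun setT (\1_S : R * R -> R) by exact: measurable_indic.
have mB1 : measurable_fun setT (\1_excess_set : R * R -> R) by exact: measurable_indic.
have m2 := @measurable_snd _ _ (R * R)%type (R * R)%type.
pose F (p : (R * R) * (R * R)) : \bar R := (\1_S p.2 * \1_excess_set (p.1 - p.2))%:E.
have mF : measurable_fun setT F.
  apply/measurable_EFinP; apply: measurable_funM.
    exact: measurableT_comp mS1 m2.
  exact: measurableT_comp mB1 measurable_subp.
have F0 p : (0 <= F p)%E by rewrite lee_fin mulr_ge0.
pose g (p : (R * R) * (R * R)) : \bar R := (\1_S p.2 * rho_neg (p.1 - p.2))%:E.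
have mg : measurable_fun setT g.
  apply/measurable_EFinP; apply: measurable_funM.
    exact: measurableT_comp mS1 m2.
  exact: measurableT_comp measurable_rho_neg measurable_subp.
have g0 p : (0 <= g p)%E by rewrite lee_fin mulr_ge0// rho_neg_ge0.
have := two_point_plane mF F0.
have -> : (\int[plane \x plane]_p (F p * (1 - T2 (p.1 - p.2))%:E) = \int[plane \x plane]_p (- g p))%E.
  apply: eq_integral => p _; exact: (congr1 EFin (rho_negE (\1_S p.2) (p.1 - p.2))).
have -> : (\int[plane \x plane]_p (- g p) = - \int[mu2]_v (rho_neg v)%:E)%E.
  transitivity (- \int[plane \x plane]_p g p)%E.
    by apply: integral_ge0N.
  congr (- _)%E; rewrite ge0_integral_pairs//.
  have m1 : measurable_fun setT (fun v => (rho_neg v)%:E) by apply/measurable_EFinP; exact: measurable_rho_neg.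
  have r0 v : (0 <= (rho_neg v)%:E)%E by rewrite lee_fin rho_neg_ge0.
  transitivity (\int[mu2]_y ((\1_S y)%:E * \int[mu2]_v (rho_neg v)%:E))%E.
    apply: eq_integral => y _.
    have y0 : (0 <= (\1_S y : R)%:E)%E by rewrite lee_fin.
    rewrite -(ge0_integralZl mu2 measurableT m1 (fun v _ => r0 v) y0).
    by apply: eq_integral => v _; rewrite /g /= addrK EFinM.
  have mS2 : measurable_fun setT (fun y => (\1_S y : R)%:E) by exact/measurable_EFinP.
  have y0 y : setT y -> (0 <= (\1_S y : R)%:E)%E by rewrite lee_fin.
  have k0 : (0 <= \int[mu2]_v (rho_neg v)%:E)%E by exact: integral_ge0.
  rewrite (ge0_integralZr mu2 measurableT mS2 y0 k0).
  rewrite integral_indic// setIT.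
  have S1 : mu2 S = 1%E by exact: leb2_square01.
  exact: (etrans (congr1 (fun t => t * _)%E S1) (mul1e _)).
have l0 : (0 <= \int[P]_w \esum_(a in distinct_pairs (X w)) F a)%E.
  by apply: integral_ge0 => w _; exact: esum_ge0.
move=> H; rewrite H oppe_ge0 in l0; apply/eqP; rewrite eq_le l0/=.
by apply: integral_ge0 => v _; rewrite lee_fin rho_neg_ge0.
Qed.

Lemma ae_T2_le1 : {ae mu2, forall v, T2 v <= 1}.
Proof.
have m1 : measurable_fun setT (fun v => (rho_neg v)%:E) by apply/measurable_EFinP; exact: measurable_rho_neg.
have : (\int[mu2]_v `|(rho_neg v)%:E| = 0)%E.
  rewrite -[RHS]integral_rho_neg; apply: eq_integral => v _.
  by rewrite gee0_abs// lee_fin rho_neg_ge0.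
move/(ae_eq_integral_abs mu2 measurableT m1) => h.
apply: filterS h => v /(_ I) [] /eqP; rewrite /rho_neg => h.
by rewrite -subr_le0; move/eqP: h => <-; rewrite le_max lexx orbT.
Qed.

Lemma integral_eq_T2_le1 (f g : R * R -> \bar R) :
  measurable_fun setT f -> measurable_fun setT g ->
  (forall v, T2 v <= 1 -> f v = g v) -> (\int[mu2]_v f v = \int[mu2]_v g v)%E.
Proof.
move=> mf mg h; apply: ae_eq_integral => //.
have [A [mA A0 sA]] := ae_T2_le1; exists A; split => // v /= hv; apply: sA => /= h1.
by apply: hv => _; exact: h.
Qed.

(** Integrate (n - a)^2 >= 0, written as 2 a n <= n (n - 1) + n + a^2, so that every term is a
    nonnegative function of known expectation. *)
Lemma variance_bound (n p : Omega -> R) (a I : R) :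
  measurable_fun setT n -> measurable_fun setT p ->
  (forall w, 0 <= n w) -> (forall w, 0 <= p w) -> (forall w, p w = n w ^+ 2 - n w) ->
  (\int[P]_w (n w)%:E = a%:E)%E -> (\int[P]_w (p w)%:E = (a * a - I)%:E)%E ->
  0 <= a -> I <= a.
Proof.
move=> mn mp n0 p0 pE En Ep a0.
have en0 w : setT w -> (0 <= (n w)%:E)%E by rewrite lee_fin.
have ep0 w : setT w -> (0 <= (p w)%:E)%E by rewrite lee_fin.
have emn : measurable_fun setT (EFin \o n) by exact/measurable_EFinP.
have emp : measurable_fun setT (EFin \o p) by exact/measurable_EFinP.
have a20 (w : Omega) : setT w -> (0 <= (a * a)%:E)%E by rewrite lee_fin mulr_ge0.
have aa0 : (0 <= (2 * a)%:E)%E by rewrite lee_fin mulr_ge0.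
have en2 w : setT w -> (0 <= (n w)%:E + (a * a)%:E)%E by move=> h; rewrite adde_ge0// ?en0 ?(a20 w).
have em2 : measurable_fun setT (fun w => (n w)%:E + (a * a)%:E)%E by exact: emeasurable_funD.
have key : (\int[P]_w ((2 * a)%:E * (n w)%:E) <= \int[P]_w ((p w)%:E + ((n w)%:E + (a * a)%:E)))%E.
  have g0 w : setT w -> (0 <= (2 * a)%:E * (n w)%:E)%E by move=> _; rewrite mule_ge0// lee_fin.
  have mg : measurable_fun setT (fun w => (2 * a)%:E * (n w)%:E)%E by exact: emeasurable_funM.
  have mh : measurable_fun setT (fun w => (p w)%:E + ((n w)%:E + (a * a)%:E))%E by exact: emeasurable_funD.
  apply: (ge0_le_integral P measurableT g0 mg mh).
  move=> w _; rewrite -!EFinM -!EFinD lee_fin pE.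
  by have := sqr_ge0 (n w - a); rewrite !expr2; lra.
move: key; rewrite (ge0_integralZl P measurableT emn en0 aa0).
rewrite (ge0_integralD P measurableT ep0 emp en2 em2).
rewrite (ge0_integralD P measurableT en0 emn a20)//.
have c1 : (\int[P]_(w in setT) (a * a)%:E = (a * a)%:E)%E.
  rewrite integral_cst//.
  exact: (etrans (congr1 (mule _) (probability_setT P)) (mule1 _)).
by rewrite En Ep c1 -EFinM -!EFinD lee_fin; lra.
Qed.

Section window.
Variable N : R.
Hypothesis N0 : 0 < N.

Lemma finite_window w : finite_set (X w `&` square 0 N).
Proof.
have [lf _] := hX; apply: sub_finite_set (lf w (2 * N)) => a [Xa [/= a1 a2]]; split => //=.
move: a1 a2; rewrite !in_itv/= => /andP[h1 h2] /andP[h3 h4].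
rewrite /enorm -[leRHS]ger0_norm; last by rewrite mulr_ge0// ltW.
by rewrite -sqrtr_sqr ler_wsqrtr//; nra.
Qed.

(** The integral against the signed density 1 - T2 splits into two tent integrals, and the one
    carrying [rho_neg] is zero because T2 <= 1 almost everywhere. *)
Lemma expect_pair_sum (G : R * R -> R) : measurable_fun setT G -> (forall v, 0 <= G v) ->
  (\int[P]_w (pair_sum X (square 0 N) (fun p => G (p.1 - p.2)) w)%:E =
   \int[mu2]_v (tent2 N v * (G v * rho_pos v))%:E)%E.
Proof.
move=> mG G0; have mS := @measurable_square R 0 N.
pose SS : set ((R * R) * (R * R)) := square 0 N `*` square 0 N.
pose F (p : (R * R) * (R * R)) : \bar R := (\1_SS p * G (p.1 - p.2))%:E.
have mI : measurable_fun setT (\1_SS : (R * R) * (R * R) -> R).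
  by apply: measurable_indic; exact: measurableX.
have mF : measurable_fun setT F.
  apply/measurable_EFinP; apply: measurable_funM => //.
  exact: measurableT_comp mG measurable_subp.
have F0 p : (0 <= F p)%E by rewrite lee_fin mulr_ge0.
have := two_point_plane mF F0.
have -> : (\int[P]_w (\esum_(p in distinct_pairs (X w)) F p) =
   \int[P]_w (pair_sum X (square 0 N) (fun p => G (p.1 - p.2)) w)%:E)%E.
  apply: eq_integral => w _; rewrite -(esum_pair_sum finite_window)//.
move=> ->.
have mp : measurable_fun setT (fun v => (G v * rho_pos v)%:E).
  by apply/measurable_EFinP; apply: measurable_funM => //; exact: measurable_rho_pos.
have mn : measurable_fun setT (fun v => (G v * rho_neg v)%:E).
  by apply/measurable_EFinP; apply: measurable_funM => //; exact: measurable_rho_neg.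
have p0 v : (0 <= (G v * rho_pos v)%:E)%E by rewrite lee_fin mulr_ge0// rho_pos_ge0.
have n0 v : (0 <= (G v * rho_neg v)%:E)%E by rewrite lee_fin mulr_ge0// rho_neg_ge0.
have Hp := ge0_integral_tent (ltW N0) mp p0.
have Hn := ge0_integral_tent (ltW N0) mn n0.
have Z : (\int[mu2]_v ((tent2 N v)%:E * (G v * rho_neg v)%:E) = 0)%E.
  transitivity (\int[mu2]_v (cst 0%E v : \bar R))%E; last by rewrite integral0.
  apply: integral_eq_T2_le1 => //.
    by apply: emeasurable_funM => //; apply/measurable_EFinP; exact: measurable_tent2.
  by move=> v h; rewrite /rho_neg max_l ?subr_le0// mulr0 mule0.
rewrite integralE.
rewrite [X in (X - _)%E](_ : _ = \int[plane \x plane]_p ((\1_SS p)%:E * (G (p.1 - p.2)%R * rho_pos (p.1 - p.2)%R)%:E))%E; last first.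
  apply: eq_integral => p _; rewrite funeposE.
  have t0 : 0 <= \1_SS p * G (p.1 - p.2) by rewrite mulr_ge0.
  exact: (etrans (esym (EFin_max _ _)) (congr1 EFin (max_rho_pos (p.1 - p.2) t0))).
rewrite [X in (_ - X)%E](_ : _ = \int[plane \x plane]_p ((\1_SS p)%:E * (G (p.1 - p.2)%R * rho_neg (p.1 - p.2)%R)%:E))%E; last first.
  apply: eq_integral => p _; rewrite funenegE.
  have t0 : 0 <= \1_SS p * G (p.1 - p.2) by rewrite mulr_ge0.
  exact: (etrans (esym (EFin_max _ _)) (congr1 EFin (max_rho_neg (p.1 - p.2) t0))).
rewrite Hp Hn Z sube0; apply: eq_integral => v _; by rewrite EFinM.
Qed.

Lemma expect_npts : (\int[P]_w (npts X (square 0 N) setT w)%:E = (N ^+ 2)%:E)%E.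
Proof.
have mS := @measurable_square R 0 N.
have mI : measurable_fun setT (fun v => (\1_(square 0 N) v : R)%:E).
  by apply/measurable_EFinP; exact: measurable_indic.
have [_ /(_ _ mI)] := hrho1.
have -> : (\int[P]_w (\esum_(a in X w) (\1_(square 0 N) a)%:E) = \int[P]_w (npts X (square 0 N) setT w)%:E)%E.
  by apply: eq_integral => w _; rewrite -(esum_npts finite_window).
move=> ->; last by move=> x; rewrite lee_fin.
under eq_integral do rewrite mule1.
rewrite integral_indic// setIT.
by apply: (etrans (leb2_square (ltW N0))); rewrite subr0.
Qed.

Lemma integral_tent2 : (\int[mu2]_v (tent2 N v)%:E = (N ^+ 4)%:E)%E.
Proof.
have mS := @measurable_square R 0 N.
transitivity (\int[mu2]_v ((tent2 N v)%:E * 1))%E; first by apply: eq_integral => v _; rewrite mule1.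
rewrite -(@ge0_integral_tent R N (cst 1%E))//; last exact: ltW.
under eq_integral do rewrite mule1.
transitivity ((plane \x plane) (square 0 N `*` square 0 N))%E.
  by rewrite integral_indic ?setIT//; exact: measurableX.
have e : plane (square 0 N) = (N ^+ 2)%:E.
  by apply: (etrans (leb2_square (ltW N0))); rewrite subr0.
transitivity (plane (square 0 N) * plane (square 0 N))%E; first exact: product_measure1E.
by rewrite e -EFinM -exprD.
Qed.

Lemma tent2_le v : tent2 N v <= N ^+ 2.
Proof.
have h t : tent N t <= N by rewrite /tent ge_max (ltW N0) gerBl normr_ge0.
by rewrite expr2; apply: ler_pM; rewrite ?tent_ge0 ?h.
Qed.

Lemma integrable_tent2M (f : R * R -> R) : mu2.-integrable setT (EFin \o f) ->
  mu2.-integrable setT (EFin \o (fun v => tent2 N v * f v)).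
Proof.
move=> fi; have mf : measurable_fun setT f by apply/measurable_EFinP; move/integrableP : fi => [].
apply: le_integrable (integrable_scaler (nu := mu2) (N ^+ 2) measurableT fi) => //.
  by apply/measurable_EFinP; apply: measurable_funM => //; exact: measurable_tent2.
move=> v _ /=; rewrite lee_fin normrM [leRHS]normrM; apply: ler_wpM2r => //.
by rewrite !ger0_norm ?tent2_ge0 ?sqr_ge0// tent2_le.
Qed.

Lemma integrable_tent2 : mu2.-integrable setT (EFin \o tent2 N).
Proof.
apply/integrableP; split; first by apply/measurable_EFinP; exact: measurable_tent2.
under eq_integral => v _ do rewrite gee0_abs ?lee_fin ?tent2_ge0//.
by rewrite integral_tent2 ltry.
Qed.

(* The number of points in the square has nonnegative variance. *)
Lemma tent_correlation_le : mu2.-integrable setT (EFin \o T2) ->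
  \int[mu2]_v (tent2 N v * T2 v) <= N ^+ 2.
Proof.
move=> iT.
have mn : measurable_fun setT (npts X (square 0 N) setT).
  by apply: measurable_npts => //; [exact: measurable_square|exact: finite_window].
have n0 w : 0 <= npts X (square 0 N) setT w by rewrite (nptsE finite_window).
have mp : measurable_fun setT (pair_sum X (square 0 N) (fun=> 1)).
  by apply: measurable_pair_sum_ge0 => //; [exact: measurable_square|exact: finite_window].
have p0 w : 0 <= pair_sum X (square 0 N) (fun=> 1) w by exact: pair_sum_ge0 finite_window _ _ _.
have E1 := @expect_pair_sum (fun=> 1) (@measurable_cst _ _ _ _ _ _) (fun _ => ler01).
have E2 : (\int[mu2]_v (tent2 N v * (1 * rho_pos v))%:E = (N ^+ 4 - \int[mu2]_v (tent2 N v * T2 v))%:E)%E.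
  have i1 := integrable_tent2.
  have i2 := integrable_tent2M iT.
  have fk : (\int[mu2]_v (tent2 N v * T2 v))%:E = (\int[mu2]_v (tent2 N v * T2 v)%:E)%E.
    by rewrite /Rintegral fineK//; exact: (integrable_fin_num measurableT i2).
  rewrite EFinB fk -integral_tent2 -(integralB (mu := mu2) measurableT i1 i2).
  apply: integral_eq_T2_le1 => //.
  - apply/measurable_EFinP; apply: measurable_funM; first exact: measurable_tent2.
    by apply: measurable_funM => //; exact: measurable_rho_pos.
  - apply: emeasurable_funB; first by apply/measurable_EFinP; exact: measurable_tent2.
    by apply/measurable_EFinP; apply: measurable_funM => //; exact: measurable_tent2.
  move=> v h.
  by rewrite -EFinB; congr EFin; rewrite /rho_pos max_r ?subr_ge0//; ring.
apply: (variance_bound mn mp n0 p0 (pair_sum1 finite_window) expect_npts); last exact: sqr_ge0.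
by rewrite E1 E2 -exprD.
Qed.

End window.
End process.

(** * Elementary estimates comparing the kernel with ln(x^2 + y^2) *)

Section kfun_asymptotics.
Context {R : realType}.
Implicit Types (x y u : R).

Lemma one_sub_expRN_ge u : 0 <= u -> u / (1 + u) <= 1 - expR (- u).
Proof.
move=> u0; have e : expR (- u) <= (1 + u)^-1.
  by rewrite expRN lef_pV2 ?posrE ?expR_gt0 ?expR_ge1Dx//; lra.
have -> : u / (1 + u) = 1 - (1 + u)^-1 by field; lra.
lra.
Qed.

Lemma one_sub_expRN_le u : 1 - expR (- u) <= u.
Proof. by have := expR_ge1Dx (- u); lra. Qed.

Lemma one_sub_decay_ge y : 0 <= y -> y <= 1 -> y / 2 <= 1 - decay y.
Proof.
move=> y0 y1; have := pi_ge2 R; rewrite /decay; move: (pi : R) => p p2.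
apply: le_trans (one_sub_expRN_ge _); last by nra.
have h1 : 0 <= (p - 2) * y by apply: mulr_ge0; lra.
have h2 : 0 <= p * (y * (1 - y)) by apply: mulr_ge0; [lra|apply: mulr_ge0; lra].
have h3 : 0 <= p * y by apply: mulr_ge0; lra.
rewrite ler_pdivlMr; last by lra.
have -> : y / 2 * (1 + 2 * p * y) = y / 2 + p * y - p * (y * (1 - y)) by field.
by move: h1 h2 h3; rewrite mulrBl -mulrA; move: (p * y) (p * (y * (1 - y))) => *; lra.
Qed.

Lemma normr_sin_le u : `|sin u| <= `|u|.
Proof.
wlog u0 : u / 0 <= u => [H|].
  case: (lerP 0 u) => h; first exact: H.
  by rewrite -normrN -[leRHS]normrN -sinN; apply: H; rewrite oppr_ge0 ltW.
have [->|un0] := eqVneq u 0; first by rewrite sin0 normr0.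
have up : 0 < u by rewrite lt_def un0.
have [c _] : exists2 c, c \in `]0, u[ & sin u - sin 0 = cos c * (u - 0).
  apply: (@MVT R (@sin R) (@cos R)) => //.
  exact/continuous_subspaceT/continuous_sin.
rewrite sin0 !subr0 => ->; rewrite normrM; apply: ler_piMl => //; exact: cos_max.
Qed.

Lemma cos_piquarter_ge : 2^-1 <= cos (pi / 4) :> R.
Proof.
have p0 := pi_gt0 R.
have c0 : 0 < cos (pi / 4) :> R.
  by apply: cos_gt0_pihalf; apply/andP; split; move: (pi : R) p0 => p p0; lra.
have e : 2 * cos (pi / 4) ^+ 2 = 1 :> R.
  have := cos_mulr2n (pi / 4 : R).
  have -> : (pi / 4) *+ 2 = pi / 2 :> R by rewrite -mulr_natl; move: (pi : R) => p; field.
  rewrite cos_pihalf -[_ *+ 2]mulr_natl; lra.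
by move: c0 e; move: (cos _) => c c0 e; nra.
Qed.

(** By symmetry it suffices that sin(pi t) >= t on [0,1/2]: up to 1/4 the slope is at least pi/2,
    beyond that the sine exceeds sin(pi/4) >= 1/2. *)
Lemma sin_pi_ge x : 0 <= x -> x <= 1 -> x * (1 - x) <= sin (pi * x).
Proof.
have half (t : R) : 0 <= t -> t <= 2^-1 -> t <= sin (pi * t).
  move=> t0 t1; have p2 := pi_ge2 R; have p0 := pi_gt0 R.
  have q := cos_piquarter_ge.
  have [->|tn0] := eqVneq t 0; first by rewrite mulr0 sin0.
  have tp : 0 < t by rewrite lt_def tn0.
  case: (lerP t 4^-1) => h.
    have [c] : exists2 c, c \in `]0, pi * t[ & sin (pi * t) - sin 0 = cos c * (pi * t - 0).
      apply: (@MVT R (@sin R) (@cos R)) => //; first by rewrite mulr_gt0.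
      exact/continuous_subspaceT/continuous_sin.
    rewrite in_itv/= sin0 !subr0 => /andP[c0 c1] ->.
    have : cos (pi / 4) <= cos c.
      rewrite leNgt ltr_cos ?in_itv/= -?leNgt.
      - by apply: ltW; apply: lt_le_trans c1 _; rewrite ler_pM2l//; lra.
      - by rewrite divr_ge0 ?pi_ge0//=; move: (pi : R) p0 => p p0; lra.
      - rewrite (ltW c0)/=; apply: le_trans (ltW c1) _; rewrite ger_pMr//; lra.
    by move=> qc; move: (pi : R) p2 (cos c) (le_trans q qc) => p p2 k qk; rewrite mulrA ler_peMl//; nra.
  have e : 2 * sin (pi / 4) ^+ 2 = 1 :> R.
    have := cos_mulr2n (pi / 4 : R).
    have -> : (pi / 4) *+ 2 = pi / 2 :> R by rewrite -mulr_natl; move: (pi : R) => p; field.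
    by rewrite cos_pihalf sin2cos2 -[_ *+ 2]mulr_natl; lra.
  have s0 : 0 <= sin (pi / 4) :> R.
    by apply: sin_ge0_pi; rewrite divr_ge0 ?pi_ge0//=; move: (pi : R) p0 => p p0; lra.
  have s2 : 2^-1 <= sin (pi / 4) :> R by move: s0 e; move: (sin _) => c c0 e; nra.
  have pt0 : 0 <= pi * t by rewrite mulr_ge0// ltW.
  have pt : pi * t <= pi / 2 := ler_wpM2l (ltW p0) t1.
  apply: le_trans t1 _; apply: le_trans s2 _.
  rewrite leNgt ltr_sin ?in_itv/= -?leNgt.
  - by rewrite ler_pM2l//; lra.
  - by move: (pi : R) p0 pt0 pt => p p0 pt0 pt; apply/andP; split; lra.
  - by move: (pi : R) p0 => p p0; apply/andP; split; nra.
move=> x0 x1; case: (lerP x 2^-1) => h.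
  by apply: le_trans (half x x0 h); nra.
have -> : sin (pi * x) = sin (pi * (1 - x)).
  by rewrite mulrBr mulr1 sinB sinpi cospi mul0r sub0r mulN1r opprK.
by apply: le_trans (half (1 - x) _ _); [nra|lra|lra].
Qed.

(** Radial and angular parts of |1 - r e^(2 i pi x)|^2, to be compared with y^2 and x^2. *)
Lemma logarg_sin r x : logarg r (2 * pi * x) = (1 - r) ^+ 2 + 4 * r * sin (pi * x) ^+ 2.
Proof.
have -> : 2 * pi * x = (pi * x) *+ 2 by rewrite -[RHS]mulr_natl mulrA.
by rewrite /logarg cos_mulr2n cos2sin2 -[_ *+ 2]mulr_natl; ring.
Qed.

Lemma ln_ge (t : R) : 0 < t -> 1 - t^-1 <= ln t.
Proof.
move=> t0; have := @le_ln1Dx R (t^-1 - 1); rewrite subrKC lnV ?posrE//.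
have : 0 < t^-1 by rewrite invr_gt0.
by move=> h /(_ _); lra.
Qed.

Lemma normr_sqr_enorm (x y : R) : 0 < x -> 2 * ln (enorm (x, y)) = ln (x ^+ 2 + y ^+ 2).
Proof.
move=> x0; have h : 0 < x ^+ 2 + y ^+ 2 by rewrite ltr_pwDl ?exprn_gt0// sqr_ge0.
rewrite /enorm /= mulr_natl -lnXn ?sqrtr_gt0// sqr_sqrtr//; exact: ltW.
Qed.

(** The ratio of the kernel's argument to x^2 + y^2 is bounded above, and below by a multiple of (1
    - x)^2: the periodic copy of the singularity at x = 1 is tamed by the weight 1 - x. *)
Lemma logker_near_bound x y : 0 < x < 1 -> 0 < y < 1 ->
  `|logker x y - ln (x ^+ 2 + y ^+ 2)| * (1 - x) <= 4 * pi ^+ 2 + `|ln (decay 1 / 2)| + 4.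
Proof.
move=> /andP[x0 x1] /andP[y0 y1].
have D0 : 0 < x ^+ 2 + y ^+ 2 by rewrite ltr_pwDl ?exprn_gt0// sqr_ge0.
pose r := decay y; pose L := logarg r (2 * pi * x).
have r0 : 0 < r := decay_gt0 y.
have r1 : r < 1 := decay_lt1 y0.
have L0 : 0 < L by exact: logarg_gt0 (ltW r0) r1.
have -> : logker x y - ln (x ^+ 2 + y ^+ 2) = ln (L / (x ^+ 2 + y ^+ 2)).
  by rewrite ln_div ?posrE.
have hr : y / 2 <= 1 - r by apply: one_sub_decay_ge; exact: ltW.
have hr2 : 1 - r <= 2 * pi * y by exact: one_sub_expRN_le.
have hq : decay 1 <= r by apply: decay_le; exact: ltW.
have hs : x * (1 - x) <= sin (pi * x) by apply: sin_pi_ge; exact: ltW.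
have hs2 : sin (pi * x) ^+ 2 <= pi ^+ 2 * x ^+ 2.
  have := normr_sin_le (pi * x); rewrite -(ler_pXn2r (_ : 0 < 2)%N) ?nnegrE// !real_normK ?num_real//.
  by rewrite exprMn.
have q0 := @decay_gt0 R 1; have q1 := @decay1_le R.
have up : ln (L / (x ^+ 2 + y ^+ 2)) <= 4 * pi ^+ 2.
  have Lup : L <= 4 * pi ^+ 2 * (x ^+ 2 + y ^+ 2).
    rewrite /L logarg_sin.
    have h1 : (1 - r) ^+ 2 <= (2 * pi * y) ^+ 2 by rewrite ler_sqr ?nnegrE; lra.
    have h2 : 4 * r * sin (pi * x) ^+ 2 <= 4 * (pi ^+ 2 * x ^+ 2).
      rewrite -mulrA ler_pM2l//; apply: le_trans hs2; apply: ler_piMl; [exact: sqr_ge0|exact: ltW].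
    by move: h1; rewrite !exprMn; lra.
  have : L / (x ^+ 2 + y ^+ 2) <= 4 * pi ^+ 2 by rewrite ler_pdivrMr.
  have t0 : 0 < L / (x ^+ 2 + y ^+ 2) by rewrite divr_gt0.
  have := @le_ln1Dx R (L / (x ^+ 2 + y ^+ 2) - 1); rewrite subrKC => /(_ _); lra.
(* The radial part is at least (y/2)^2, the angular part at least 4 [decay 1] (x (1 - x))^2. *)
have lo : ln (decay 1 / 2) + 2 * ln (1 - x) <= ln (L / (x ^+ 2 + y ^+ 2)).
  have c0 : 0 < decay 1 / 2 :> R by rewrite divr_gt0.
  have -> : ln (decay 1 / 2) + 2 * ln (1 - x) = ln (decay 1 / 2 * (1 - x) ^+ 2).
    by rewrite [in RHS]lnM ?posrE ?exprn_gt0 ?subr_gt0// lnXn ?subr_gt0// mulr_natl.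
  rewrite ler_ln ?posrE ?mulr_gt0 ?divr_gt0 ?invr_gt0 ?exprn_gt0 ?subr_gt0//.
  rewrite ler_pdivlMr// /L logarg_sin mulrDr.
  have h1 : (y / 2) ^+ 2 <= (1 - r) ^+ 2 by rewrite ler_sqr ?nnegrE; lra.
  have h2 : (x * (1 - x)) ^+ 2 <= sin (pi * x) ^+ 2.
    by rewrite ler_sqr ?nnegrE// ?mulr_ge0// ?(le_trans _ hs)// ?mulr_ge0//; lra.
  have h3 : decay 1 * (x * (1 - x)) ^+ 2 <= r * sin (pi * x) ^+ 2.
    by apply: ler_pM => //; [exact: ltW|exact: sqr_ge0].
  have h4 : decay 1 / 2 * (1 - x) ^+ 2 * y ^+ 2 <= (y / 2) ^+ 2.
    have : (1 - x) ^+ 2 <= 1 by rewrite expr_le1//; lra.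
    move=> hx1; have hy : 0 <= y ^+ 2 := sqr_ge0 y.
    have -> : (y / 2) ^+ 2 = 4^-1 * y ^+ 2 by field.
    apply: ler_wpM2r => //.
    have : 0 <= (1 - x) ^+ 2 := sqr_ge0 _.
    by move: (decay 1 : R) q0 q1 ((1 - x) ^+ 2) hx1 => q q0 q1 z z1 z0; nra.
  have h5 : decay 1 / 2 * (1 - x) ^+ 2 * x ^+ 2 <= 4 * (decay 1 * (x * (1 - x)) ^+ 2).
    rewrite exprMn.
    have : 0 <= decay 1 * (x ^+ 2 * (1 - x) ^+ 2) by apply: mulr_ge0; [exact: ltW|apply: mulr_ge0; exact: sqr_ge0].
    move: (decay 1 : R) => q hz.
    have -> : q / 2 * (1 - x) ^+ 2 * x ^+ 2 = 2^-1 * (q * (x ^+ 2 * (1 - x) ^+ 2)) by field.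
    by move: (q * _) hz => z hz; lra.
  move: h1 h3 h4 h5.
  by move: (decay 1 / 2 * _ * _) (decay 1 / 2 * _ * _) (decay 1 * _) ((y / 2) ^+ 2) ((1 - r) ^+ 2) => *; lra.
(* This keeps (1 - x) ln(1 - x) bounded below. *)
have l1 : 1 - (1 - x)^-1 <= ln (1 - x) by apply: ln_ge; lra.
have i1 : (1 - x)^-1 * (1 - x) = 1 by rewrite mulVf//; lra.
have p2 : 0 <= 4 * pi ^+ 2 :> R by rewrite mulr_ge0// sqr_ge0.
have n1 := ler_norm (- ln (decay 1 / 2) : R); rewrite normrN in n1.
have n0 := normr_ge0 (ln (decay 1 / 2) : R).
move: up lo l1 i1 p2 n1 n0; move: (ln (L / _)) (ln (1 - x)) ((1 - x)^-1) (4 * pi ^+ 2) (ln (decay 1 / 2)) `|ln (decay 1 / 2)| => l a i P q nq up lo l1 i1 p2 n1 n0.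
have a1 : 0 <= 1 - x by lra.
have a2 : 0 <= nq * x by apply: mulr_ge0; lra.
case: (ger0P l) => hl.
  have : l * (1 - x) <= l by apply: ler_piMr => //; lra.
  lra.
have : - l * (1 - x) <= (nq + 2 * i - 2) * (1 - x) by apply: ler_wpM2r => //; lra.
have -> : (nq + 2 * i - 2) * (1 - x) = nq - nq * x + 2 * (i * (1 - x)) - 2 * (1 - x) by ring.
by rewrite i1; lra.
Qed.

End kfun_asymptotics.

(** * Weighted bound and limit of the closed form near the origin *)

Section kfun_asymptotics.
Context {R : realType}.
Implicit Types (x y u : R).

(** Used with t = 1 - y: it handles the factor singular at y = 1, again by a weight vanishing
    there. *)
Lemma logker_mul_bound (x t : R) : 0 < t -> t < 1 -> `|logker x t| * t <= 4.
Proof.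
move=> t0 t1.
have r0 := @decay_gt0 R t; have r1 := decay_lt1 t0.
have up : logker x t <= 2 by apply: le_trans (ln_logarg_le2 _ (ltW r0) r1) _; lra.
have lo : 2 * (1 - (t / 2)^-1) <= logker x t.
  have h : 1 - (t / 2)^-1 <= ln (t / 2) by apply: ln_ge; rewrite divr_gt0.
  apply: (@le_trans _ _ (2 * ln (t / 2))); first by rewrite ler_pM2l.
  rewrite mulr_natl -lnXn ?divr_gt0// ler_ln ?posrE ?exprn_gt0 ?divr_gt0 ?logarg_gt0 ?(ltW r0)//.
  apply: le_trans (logarg_ge _ (ltW r0)).
  have hr : t / 2 <= 1 - decay t by apply: one_sub_decay_ge; exact: ltW.
  by rewrite ler_sqr ?nnegrE; lra.
have i1 : (t / 2)^-1 * t = 2 by field; lra.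
move: (logker x t) (t / 2)^-1 up lo i1 => l i up lo i1.
case: (ger0P l) => hl.
  by have : l * t <= l by [apply: ler_piMr => //; lra]; lra.
have : - l * t <= (2 * i - 2) * t by apply: ler_wpM2r; [exact: ltW|lra].
by rewrite mulrBl -mulrA i1; lra.
Qed.

Lemma weighted_split (k p K A B1 B2 D a b Q : R) : 0 < a <= 1 -> 0 < b <= 1 -> 0 <= p ->
  `|k| <= Q -> `|A| * a <= K -> `|B1| <= 2 -> `|B2| * b <= 4 -> `|D| <= 8 ->
  `|k - p * (A + (B1 + B2 + D))| * (a * b) <= Q + p * (K + 14).
Proof.
move=> /andP[a0 a1] /andP[b0 b1] p0 hk hA hB1 hB2 hD.
have ab0 : 0 <= a * b by rewrite mulr_ge0// ltW.
have ab1 : a * b <= 1 by apply: mulr_ile1 => //; exact: ltW.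
have h : `|k - p * (A + (B1 + B2 + D))| <= `|k| + p * (`|A| + (`|B1| + `|B2| + `|D|)).
  apply: le_trans (ler_normB _ _) _; rewrite lerD2l normrM (ger0_norm p0).
  apply: ler_wpM2l => //; apply: le_trans (ler_normD _ _) _; rewrite lerD2l.
  by apply: le_trans (ler_normD _ _) _; rewrite lerD2r; exact: ler_normD.
apply: le_trans (ler_wpM2r ab0 h) _; rewrite mulrDl; apply: lerD.
  by apply: le_trans hk; apply: ler_piMr.
rewrite -mulrA; apply: ler_wpM2l => //.
have hA' : `|A| * (a * b) <= K.
  by rewrite mulrA; apply: le_trans hA; apply: ler_piMr => //; rewrite mulr_ge0// ltW.
have hB2' : `|B2| * (a * b) <= 4.
  by rewrite mulrCA -[leRHS]mul1r; apply: ler_pM => //; [exact: ltW|rewrite mulr_ge0// ltW].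
have hB1' : `|B1| * (a * b) <= 2 by apply: le_trans hB1; apply: ler_piMr.
have hD' : `|D| * (a * b) <= 8 by apply: le_trans hD; apply: ler_piMr.
by rewrite !mulrDl; lra.
Qed.

(** Subtracting the logarithm removes the singularity at the origin; the weight (1 - |x|)(1 - y),
    which is the rescaled taper, absorbs those at |x| = 1 and y = 1. The factors [logker x (1 + y)]
    and the tail from index 1 on are bounded outright. *)
Lemma kfun_bound : exists C : R, forall x y : R, 0 < `|x| < 1 -> 0 < y < 1 ->
  `|kfun x y + 2 * pi * ln (enorm (x, y))| * ((1 - `|x|) * (1 - y)) <= C.
Proof.
exists (4 * pi ^+ 2 + pi * (4 * pi ^+ 2 + `|ln (decay 1 / 2)| + 4 + 14)) => x y.
wlog x0 : x / 0 <= x => [H hx hy|].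
  case: (lerP 0 x) => h; first exact: H.
  have := H (- x); rewrite oppr_ge0 normrN kfunN => /(_ (ltW h) hx hy).
  by rewrite /enorm/= sqrrN.
rewrite ger0_norm// => /andP[xp x1] /andP[y0 y1].
have -> : kfun x y + 2 * pi * ln (enorm (x, y)) = kpoly y - pi *
    ((logker x y - ln (x ^+ 2 + y ^+ 2)) +
     (logker x (1 + y) + logker x (1 - y) + (klim x y - ksum 1 x y))).
  have -> : ksum 1 x y = logker x (1 + y) + logker x (1 - y) by rewrite /ksum big_ord1.
  rewrite -(normr_sqr_enorm y xp) /kfun.
  by move: (kpoly y) (pi : R) (logker x y) (klim x y) (ln _) (logker _ _) (logker _ _) => *; ring.
have y1' : `|y| <= 1 by rewrite ger0_norm ltW.
apply: weighted_split.
- by rewrite subr_gt0 x1 gerBl.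
- by rewrite subr_gt0 y1 gerBl ltW.
- exact: pi_ge0.
- by apply: kpoly_bound; exact: ltW.
- by apply: logker_near_bound; rewrite ?xp ?y0.
- by apply: le_trans (@logker_bound _ x (1 + y) 0 _) _; lra.
- by apply: logker_mul_bound; lra.
- by apply: le_trans (klim_err 0 x y1') _; lra.
Qed.

Lemma cvg_inv_pinfty0 : N^-1 @[N --> +oo] --> (0 : R).
Proof. by apply/gtr0_cvgV0; [exact: nbhs_pinfty_gt|exact: cvg_id]. Qed.

Lemma cvg_div_pinfty0 (a : R) : a / N @[N --> +oo] --> (0 : R).
Proof. by rewrite -[X in _ --> X](mulr0 a); apply: cvgM; [exact: cvg_cst|exact: cvg_inv_pinfty0]. Qed.

(** The difference quotient at 0 read along the step 1/N. *)
Lemma cvg_slope_pinfty (f : R -> R) (l : R) : f 0 = 0 -> is_derive (0 : R) 1 f l ->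
  N * f N^-1 @[N --> +oo] --> l.
Proof.
move=> f0 [df dl].
have h : h^-1 * f h @[h --> (0 : R)^'] --> l.
  have := df; rewrite /derivable => /cvg_ex[/= l' hl'].
  have el : l' = l by rewrite -dl; apply/esym; apply: cvg_lim => //.
  rewrite -el; apply: cvg_trans hl'; apply: near_eq_cvg; near=> t.
  by rewrite /= f0 subr0 addr0 [t *: 1]mulr1.
have c : N^-1 @[N --> +oo] --> (0 : R)^'.
  move=> A /= [e e0 hA]; have := cvg_inv_pinfty0 => /cvgrPdist_lt/(_ _ e0) h1.
  suff : \forall N \near +oo, A (N^-1) by [].
  near=> N.
  have i0 : 0 < N^-1 by rewrite invr_gt0; near: N; exact: nbhs_pinfty_gt.
  apply: hA; last exact: lt0r_neq0.
  by rewrite /=; near: N.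
have ch := @cvg_comp _ _ _ (fun N : R => N^-1) (fun t => t^-1 * f t) _ _ _ c h.
have -> : (fun N => N * f N^-1) = (fun t => t^-1 * f t) \o (fun N : R => N^-1).
  by apply/funext => N /=; rewrite invrK.
exact: ch.
Unshelve. all: by end_near. Qed.

Lemma cvg_sin_slope (b : R) : N * sin (b / N) @[N --> +oo] --> b.
Proof.
apply: (@cvg_slope_pinfty (fun h => sin (b * h))); first by rewrite mulr0 sin0.
have d1 : is_derive (0 : R) 1 (fun h : R => b * h) b.
  by apply: is_derive_eq; rewrite ?scaler0 ?addr0 ?add0r /GRing.scale/=; ring.
have := @is_derive1_comp _ (@sin R) _ _ _ _ (is_derive_sin _) d1.
set d := (X in is_derive _ _ _ X -> _).
have -> : d = b by rewrite /d mulr0 cos0 /GRing.scale/=; ring.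
exact: etrans_derive.
Qed.

Lemma cvg_exp_slope (a : R) : N * (1 - expR (- (a / N))) @[N --> +oo] --> a.
Proof.
apply: (@cvg_slope_pinfty (fun h => 1 - expR (- (a * h)))).
  by rewrite mulr0 oppr0 expR0 subrr.
have d1 : is_derive (0 : R) 1 (fun h : R => - (a * h)) (- a).
  by apply: is_derive_eq; rewrite ?scaler0 ?addr0 ?add0r /GRing.scale/=; ring.
have d2 := @is_derive1_comp _ (@expR R) _ _ _ _ (is_derive_expR _) d1.
have := is_deriveB (is_derive_cst (1 : R) (0 : R) (1 : R)) d2.
set d := (X in is_derive _ _ _ X -> _).
have -> : d = a by rewrite /d mulr0 oppr0 expR0 /GRing.scale/=; ring.
exact: etrans_derive.
Qed.


(** N^2 times the argument of the logarithm tends to (2 pi)^2 |v|^2, by the slopes at 0 of the sine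
    and the exponential. *)
Lemma cvg_logker_scale (v : R * R) : v.1 != 0 -> v.2 != 0 ->
  logker (v.1 / N) (`|v.2| / N) - 2 * ln (enorm v / N) @[N --> +oo] --> 2 * ln (2 * pi : R).
Proof.
move=> v1 v2.
have D0 : 0 < v.1 ^+ 2 + v.2 ^+ 2 by rewrite ltr_pwDl ?exprn_even_gt0// sqr_ge0.
have p0 : 0 < 2 * pi :> R by rewrite mulr_gt0// pi_gt0.
pose D (N : R) := (N * (1 - decay (`|v.2| / N))) ^+ 2 +
   4 * decay (`|v.2| / N) * (N * sin (pi * (v.1 / N))) ^+ 2.
have cD : D N @[N --> +oo] --> (2 * pi) ^+ 2 * (v.1 ^+ 2 + v.2 ^+ 2).
  have -> : (2 * pi) ^+ 2 * (v.1 ^+ 2 + v.2 ^+ 2) =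
      (2 * pi * `|v.2|) ^+ 2 + 4 * 1 * (pi * v.1) ^+ 2.
    rewrite !exprMn real_normK ?num_real//; move: (pi : R) => p; ring.
  have c1 : N * (1 - decay (`|v.2| / N)) @[N --> +oo] --> 2 * pi * `|v.2|.
    by under eq_fun do rewrite /decay mulrA; exact: cvg_exp_slope.
  have c2 : N * sin (pi * (v.1 / N)) @[N --> +oo] --> pi * v.1.
    by under eq_fun do rewrite mulrA; exact: cvg_sin_slope.
  have c3 : decay (`|v.2| / N) @[N --> +oo] --> (1 : R).
    have -> : 1 = expR (- (2 * pi * 0)) :> R by rewrite mulr0 oppr0 expR0.
    apply: (@cvg_comp _ _ _ (fun N => - (2 * pi * (`|v.2| / N))) expR _
      (nbhs (- (2 * pi * 0)))); last exact: continuous_expR.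
    by apply: cvgN; apply: cvgM; [exact: cvg_cst|exact: cvg_div_pinfty0].
  have cX (f : R -> R) (l : R) : f N @[N --> +oo] --> l -> f N ^+ 2 @[N --> +oo] --> l ^+ 2.
    by move=> h; exact: cvgM.
  apply: cvgD; first exact: cX.
  by apply: cvgM; [apply: cvgM => //; exact: cvg_cst|exact: cX].
have L0 : 0 < (2 * pi) ^+ 2 * (v.1 ^+ 2 + v.2 ^+ 2) by rewrite mulr_gt0// exprn_gt0.
have cl : ln (D N) - ln (v.1 ^+ 2 + v.2 ^+ 2) @[N --> +oo] --> 2 * ln (2 * pi : R).
  have -> : 2 * ln (2 * pi) = ln ((2 * pi) ^+ 2 * (v.1 ^+ 2 + v.2 ^+ 2)) - ln (v.1 ^+ 2 + v.2 ^+ 2).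
    by rewrite [in RHS]lnM ?posrE ?exprn_gt0// addrK lnXn// mulr_natl.
  apply: cvgB; last exact: cvg_cst.
  by apply: (@cvg_comp _ _ _ D (@ln R) _ _ _ cD); exact: continuous_ln.
apply: cvg_trans cl; apply: near_eq_cvg; near=> N.
have N0 : 0 < N by near: N; exact: nbhs_pinfty_gt.
have r0 := @decay_gt0 R (`|v.2| / N).
have r1 : decay (`|v.2| / N) < 1 by apply: decay_lt1; rewrite divr_gt0 ?normr_gt0.
have -> : D N = N ^+ 2 * logarg (decay (`|v.2| / N)) (2 * pi * (v.1 / N)).
  by rewrite /D logarg_sin !exprMn; ring.
have e0 : 0 < enorm v by rewrite sqrtr_gt0.
have -> : ln (N ^+ 2 * logarg (decay (`|v.2| / N)) (2 * pi * (v.1 / N))) =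
    2 * ln N + logker (v.1 / N) (`|v.2| / N).
  by rewrite lnM ?posrE ?exprn_gt0 ?logarg_gt0 ?(ltW r0)// lnXn// -[ln N *+ 2]mulr_natl.
have -> : ln (enorm v / N) = ln (enorm v) - ln N by rewrite ln_div ?posrE.
have -> : ln (v.1 ^+ 2 + v.2 ^+ 2) = 2 * ln (enorm v).
  by rewrite mulr_natl -lnXn// sqr_sqrtr// ltW.
by move: (ln _) (ln _) (logker _ _) => *; ring.
Unshelve. all: by end_near. Qed.

Lemma cvg_ksum0 n (z : R -> R * R) : z N @[N --> +oo] --> ((0, 0) : R * R) ->
  ksum n (z N).1 (z N).2 @[N --> +oo] --> (ksum n 0 0 : R).
Proof.
move=> zc.
have c1 c s : 0 < c -> logker (z N).1 (c + s * (z N).2) @[N --> +oo] --> (logker 0 (c + s * 0) : R).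
  move=> c0; apply: (@cvg_comp _ _ _ z (fun z : R * R => logker z.1 (c + s * z.2)) _ _ _ zc).
  by apply: (@continuous_logker2 R c s (0, 0)); rewrite /= mulr0 addr0.
elim: n => [|n IH].
  by rewrite /ksum big_ord0; under eq_fun do rewrite big_ord0; exact: cvg_cst.
rewrite /ksum big_ord_recr; under eq_fun do rewrite big_ord_recr/=.
apply: cvgD => //; rewrite /kterm; apply: cvgD.
  have := c1 n.+1%:R 1 (ltr0Sn _ _); rewrite mulr0.
  by under eq_fun do rewrite mul1r.
have := c1 n.+1%:R (-1) (ltr0Sn _ _); rewrite mulr0 -[0]oppr0 -{2}(oppr0).
by under eq_fun do rewrite mulN1r; rewrite !oppr0.
Qed.

Lemma cvg_klim0 (z : R -> R * R) : z N @[N --> +oo] --> ((0, 0) : R * R) ->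
  klim (z N).1 (z N).2 @[N --> +oo] --> (klim 0 0 : R).
Proof.
move=> zc; apply/cvgrPdist_le => e e0.
have e3 : 0 < e / 3 by rewrite divr_gt0.
have /cvgrPdist_lt/(_ _ e3)[n _ hn] := half_expn_cvg (16 : R).
have hb : 16 * 2^-1 ^+ n.+1 <= e / 3.
  have /= := hn n.+1 (leqnSn n); rewrite sub0r normrN ger0_norm; first exact: ltW.
  by rewrite mulr_ge0// exprn_ge0// invr_ge0.
have /cvgrPdist_lt/(_ _ e3) ck := @cvg_ksum0 n.+1 _ zc.
have c2 : (z N).2 @[N --> +oo] --> (0 : R).
  by apply: (@cvg_comp _ _ _ z snd _ _ _ zc); exact: cvg_snd.
have /cvgrPdist_lt/(_ _ ltr01) cz := c2.
near=> N.
have h1 : `|(z N).2| <= 1.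
  by apply: ltW; have : `|0 - (z N).2| < 1 by [near: N]; rewrite sub0r normrN.
have h2 : `|ksum n.+1 0 0 - ksum n.+1 (z N).1 (z N).2| < e / 3 by near: N.
have k1 := le_trans (klim_err n (z N).1 h1) hb.
have k0 : `|klim 0 0 - ksum n.+1 0 0| <= e / 3.
  by apply: le_trans (klim_err n _ _) hb; rewrite normr0.
move: h2 k1 k0.
move: (klim _ _) (klim 0 0) (ksum _ _ _) (ksum _ 0 0) => b a d c h2 k1 k0.
have -> : a - b = (a - c) + (c - d) - (b - d) by ring.
apply: le_trans (ler_normB _ _) _; apply: le_trans (lerD (ler_normD _ _) (lexx _)) _.
by move: h2 k1 k0; move: `|a - c| `|c - d| `|b - d| => *; lra.
Unshelve. all: by end_near. Qed.

(** This is ln(2 pi eta(i)^2), as [dedekind_eta_i] shows; -2 pi times it is the constant term of E_N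
    at the origin. *)
Definition torus_const : R := ln (2 * pi) - pi / 6 + klim 0 0 / 2.

Lemma kfun_cvg (v : R * R) : v.1 != 0 -> v.2 != 0 ->
  kfun (v.1 / N) (`|v.2| / N) + 2 * pi * ln (enorm v / N) @[N --> +oo] --> - (2 * pi * torus_const).
Proof.
move=> v1 v2.
have c1 := cvg_logker_scale v1 v2.
have zc : (v.1 / N, `|v.2| / N) @[N --> +oo] --> ((0, 0) : R * R).
  exact: (cvg_pair (cvg_div_pinfty0 v.1) (cvg_div_pinfty0 `|v.2|)).
have c2 := cvg_klim0 zc.
have c3 : kpoly (`|v.2| / N) @[N --> +oo] --> (kpoly 0 : R).
  apply: (@cvg_comp _ _ _ (fun N => `|v.2| / N) (@kpoly R) _ _ _ (cvg_div_pinfty0 _)).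
  exact: continuous_kpoly.
have -> : - (2 * pi * torus_const) = kpoly 0 - pi * (2 * ln (2 * pi) + klim 0 0).
  by rewrite /torus_const /kpoly; move: (ln _) (klim 0 0) => l k; move: (pi : R) => p; field.
have -> : (fun N => kfun (v.1 / N) (`|v.2| / N) + 2 * pi * ln (enorm v / N)) =
  (fun N => kpoly (`|v.2| / N) - pi * ((logker (v.1 / N) (`|v.2| / N) - 2 * ln (enorm v / N)) +
    klim (v.1 / N) (`|v.2| / N))).
  apply/funext => N; rewrite /kfun.
  by move: (kpoly _) (ln _) (klim _ _) (logker _ _) => a b c d; move: (pi : R) => p; ring.
apply: cvgB => //; apply: cvgM; first exact: cvg_cst.
exact: cvgD.
Qed.

End kfun_asymptotics.

(** * The value eta(i) and the additive constant of the energy *)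

Section eta.
Context {R : realType}.

Lemma cexp_real (x : R) : cexp x%:C%C = (expR x)%:C%C.
Proof. by rewrite /cexp /= cos0 sin0 mulr1 mulr0. Qed.

Lemma phase_i (t : R) : 2 * 'i%C * pi%:C%C * ('i%C * t%:C%C) = (- (2 * pi * t))%:C%C :> R[i].
Proof.
have -> : 2 * 'i%C * pi%:C%C * ('i%C * t%:C%C) = 'i%C ^+ 2 * (2 * pi%:C%C * t%:C%C) :> R[i] by ring.
rewrite sqr_i mulN1r rmorphN/= !rmorphM/=; congr (- (_ * _ * _)).
by rewrite rmorph_nat.
Qed.

Lemma cvg_realc (u : nat -> R) (l : R) : u n @[n --> \oo] --> l ->
  ((u n)%:C%C : (R[i] : numFieldType)) @[n --> \oo] --> (l%:C%C : (R[i] : numFieldType)).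
Proof.
move=> /cvgrPdist_lt h; apply/cvgrPdist_lt => e.
case: e => a b; rewrite ltcE/= => /andP[/eqP -> a0].
near=> n; rewrite -rmorphB/= normc_def/= expr0n/= addr0 sqrtr_sqr ltcE/= eqxx/=.
by near: n; apply: h.
Unshelve. all: by end_near. Qed.

(** At the origin each [kterm] is four times ln(1 - q^(n+1)), so a quarter of [ksum] is the
    logarithm of the partial Euler product. *)
Lemma ksum_prod n : \prod_(1 <= k < n.+1) (1 - decay 1 ^+ k) = expR (ksum n 0 0 / 4) :> R.
Proof.
elim: n => [|n IH].
  by rewrite big_nil /ksum big_ord0 mul0r expR0.
have q1 : decay n.+1%:R < 1 :> R by apply: decay_lt1.
have h0 : 0 < 1 - decay n.+1%:R :> R by rewrite subr_gt0.
rewrite big_nat_recr//= IH /ksum big_ord_recr/= -/(ksum n 0 0) mulrDl expRD; congr (_ * _).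
rewrite -decay_nat /kterm addr0 subr0.
have -> : logker 0 n.+1%:R = 2 * ln (1 - decay n.+1%:R) :> R.
  rewrite /logker /logarg mulr0 cos0 [RHS]mulr_natl -lnXn//; congr ln; ring.
have -> : (2 * ln (1 - decay n.+1%:R) + 2 * ln (1 - decay n.+1%:R)) / 4 = ln (1 - decay n.+1%:R) :> R.
  by move: (ln _) => l; field.
by rewrite lnK ?posrE.
Qed.

(** At tau = i all factors are real: q^(1/24) = e^(-pi/12), and the complex limit is the image of
    the real one. *)
Lemma dedekind_eta_i : dedekind_eta ('i%C : R[i]) = (expR (- (pi / 12) + klim 0 0 / 4))%:C%C.
Proof.
rewrite /dedekind_eta.
have e1 : cexp (2 * 'i%C * pi%:C%C * ('i%C / 24)) = (expR (- (pi / 12)))%:C%C :> R[i].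
  have -> : ('i%C / 24 : R[i]) = 'i%C * (24^-1 : R)%:C%C by rewrite fmorphV/= rmorph_nat.
  by rewrite phase_i cexp_real; congr (expR _)%:C%C; move: (pi : R) => p; field.
have e2 : cexp (2 * 'i%C * pi%:C%C * 'i%C) = (decay 1)%:C%C :> R[i].
  have -> : (2 * 'i%C * pi%:C%C * 'i%C : R[i]) = 2 * 'i%C * pi%:C%C * ('i%C * 1%:C%C) by rewrite mulr1.
  by rewrite phase_i cexp_real.
rewrite e1 e2 expRD rmorphM/=; congr (_ * _).
have cK : expR (ksum n 0 0 / 4) @[n --> \oo] --> (expR (klim 0 0 / 4) : R).
  apply: (@cvg_comp _ _ _ (fun n => ksum n 0 0 / 4) (@expR R) _ (nbhs (klim 0 0 / 4 : R))).
    by apply: cvgM; [apply: is_cvg_ksum; rewrite normr0|exact: cvg_cst].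
  exact: continuous_expR.
have H : (\prod_(1 <= k < n) (1 - (decay 1)%:C%C ^+ k) : (R[i] : numFieldType)) @[n --> \oo] -->
    ((expR (klim 0 0 / 4))%:C%C : (R[i] : numFieldType)).
  rewrite -(cvg_shiftS (fun n => \prod_(1 <= k < n) (1 - (decay 1)%:C%C ^+ k) : (R[i] : numFieldType))).
  have -> : (fun n => \prod_(1 <= k < n.+1) (1 - (decay 1)%:C%C ^+ k) : (R[i] : numFieldType)) =
      (fun n => (expR (ksum n 0 0 / 4))%:C%C).
    apply/funext => n; rewrite -ksum_prod rmorph_prod/=; apply: eq_bigr => k _.
    by rewrite rmorphB/= rmorph1 rmorphXn.
  exact: cvg_realc.
exact: (cvg_lim (@norm_hausdorff _ _) H).
Qed.

Lemma ln_torus_const (N : R) : 0 < N ->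
  ln (N / (2 * pi * complex.Re (dedekind_eta ('i%C : R[i]) ^+ 2))) = ln N - torus_const.
Proof.
move=> N0; have p0 : 0 < 2 * pi :> R by rewrite mulr_gt0// pi_gt0.
rewrite dedekind_eta_i -rmorphXn/= -expRM_natl.
rewrite ln_div ?posrE ?mulr_gt0 ?expR_gt0 ?pi_gt0// lnM ?posrE ?expR_gt0// expRK.
congr (_ - _); rewrite /torus_const; by move: (klim 0 0) (ln _) => k l; move: (pi : R) => p; field.
Qed.

End eta.

(** * Integration with hypotheses on a set of full measure *)

Section almost_everywhere.
Context {R : realType} {d : measure_display} {T : measurableType d}.
Variables (nu : {measure set T -> \bar R}) (G : T -> Prop).
Hypothesis aeG : {ae nu, forall v, G v}.

Lemma ae_le_integrable (f g : T -> R) : measurable_fun setT f -> nu.-integrable setT (EFin \o g) ->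
  (forall v, G v -> `|f v| <= `|g v|) -> nu.-integrable setT (EFin \o f).
Proof.
move=> mf /integrableP[mg ig] h; apply/integrableP; split; first exact/measurable_EFinP.
apply: le_lt_trans ig; apply: ae_ge0_le_integral => //.
- by apply: measurableT_comp => //; exact/measurable_EFinP.
- exact: measurableT_comp.
- by apply: filterS aeG => v /h; rewrite lee_fin.
Qed.

Lemma ae_eq_Rintegral (f g : T -> R) : measurable_fun setT f -> measurable_fun setT g ->
  (forall v, G v -> f v = g v) -> \int[nu]_v f v = \int[nu]_v g v.
Proof.
move=> mf mg h; congr fine; apply: ae_eq_integral => //; try exact/measurable_EFinP.
by apply: filterS aeG => v /h ->.
Qed.

(** The real parameter is reduced to sequences tending to +oo, shifted by n0 so that all their terms
    are at least 1. *)
Lemma ae_dominated_pinfty (f : R -> T -> R) (g h : T -> R) :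
  (forall N, 1 <= N -> measurable_fun setT (f N)) -> measurable_fun setT g ->
  nu.-integrable setT (EFin \o h) ->
  (forall N v, 1 <= N -> G v -> `|f N v| <= h v) ->
  (forall v, G v -> f N v @[N --> +oo] --> g v) ->
  \int[nu]_v f N v @[N --> +oo] --> \int[nu]_v g v.
Proof.
move=> mf mg ih fh fg.
apply/cvg_pinftyP => u uy.
have [n0 _ hn0] : \forall n \near \oo, 1 <= u n.
  by move/cvgryPge : uy => /(_ 1).
have uy' : u (n + n0)%N @[n --> \oo] --> +oo by rewrite cvg_shiftn.
rewrite -(cvg_shiftn n0).
have u1 n : 1 <= u (n + n0)%N by apply: hn0; exact: leq_addl.
have mf' n : measurable_fun setT (EFin \o f (u (n + n0)%N)) by apply/measurable_EFinP; exact: mf.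
have mg' : measurable_fun setT (EFin \o g) by exact/measurable_EFinP.
have fg' : {ae nu, forall v, setT v -> (EFin \o f (u (n + n0)%N)) v @[n --> \oo] --> (EFin \o g) v}.
  apply: filterS aeG => v /fg /cvg_pinftyP/(_ _ uy') h1 _.
  by apply: cvg_comp h1 _.
have fh' : {ae nu, forall v n, setT v -> (`|(EFin \o f (u (n + n0)%N)) v| <= (EFin \o h) v)%E}.
  by apply: filterS aeG => v Gv n _; rewrite /= lee_fin; exact: fh.
have [ig _ D] := dominated_convergence measurableT mf' mg' fg' ih fh'.
have fin k : nu.-integrable setT (EFin \o k) -> (\int[nu]_v (k v)%:E)%E = (\int[nu]_v k v)%:E.
  by move=> ik; rewrite /Rintegral fineK//; exact: (integrable_fin_num measurableT ik).
have iF n : nu.-integrable setT (EFin \o f (u (n + n0)%N)).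
  apply: (ae_le_integrable (mf _ (u1 n)) ih) => v Gv.
  by apply: le_trans (fh _ _ (u1 n) Gv) _; exact: ler_norm.
have D' : (\int[nu]_v f (u (n + n0)%N) v)%:E @[n --> \oo] --> (\int[nu]_v g v)%:E.
  have e := fin _ ig; rewrite -e.
  have -> : (fun n => (\int[nu]_v f (u (n + n0)%N) v)%:E) = (fun n => \int[nu]_v (f (u (n + n0)%N) v)%:E)%E.
    by apply/funext => n; rewrite (fin _ (iF n)).
  exact: D.
exact: (fine_cvg D').
Qed.

End almost_everywhere.

Section axes.
Context {R : realType}.
Local Notation mu2 := (leb2 R).

(** The closed form of E is available only for nonzero coordinates; the axes are null. *)
Definition off_axes (v : R * R) : Prop := v.1 != 0 /\ v.2 != 0.

Lemma ae_off_axes : {ae mu2, forall v, off_axes v}.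
Proof.
have null0 : mu2 ([set (0 : R)] `*` (setT : set R)) = 0%E.
  rewrite product_measure1E//.
  by rewrite [X in (X * _)%E](_ : _ = 0%E) ?mul0e//; exact: lebesgue_measure_set1.
exists ([set (0 : R)] `*` (setT : set R) `|` (setT : set R) `*` [set (0 : R)]); split.
- by apply: measurableU; exact: measurableX.
- by apply: null_set_setU; [exact: measurableX..|exact: null0|exact: leb2_null_slice].
move=> v /= h; case: (eqVneq v.1 0) => h1; first by left.
by case: (eqVneq v.2 0) => h2; [right|case: h].
Qed.

End axes.

(** * The tent annihilates the mean-zero periodic energy *)

Section zero_mode.
Context {R : realType}.
Local Notation mu2 := (leb2 R).
Variables (N : R) (E : R * R -> R).
Hypotheses (N1 : 1 <= N) (hE : is_torus_energy N E).

(** The piece of the tent translated to s, seen on the fundamental square; s runs over the four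
    corners. *)
Let cell (s v : R * R) : R := \1_(square 0 N) v * (tent2 N (v - s) * E v).

Let cell_integrable s : mu2.-integrable setT (EFin \o cell s).
Proof.
have N0 : 0 < N := lt_le_trans ltr01 N1.
have mS := @measurable_square R 0 N.
have [iE _] := integrable_mkcond (mu := mu2) (EFin \o E) mS.
have iE' := integrable_scaler (nu := mu2) (f := fun v => \1_(square 0 N) v * E v) (N ^+ 2) measurableT.
have mE := measurable_torus hE.
apply: (@le_integrable _ _ _ mu2 _ measurableT _ (EFin \o (fun v => N ^+ 2 * (\1_(square 0 N) v * E v)))).
- apply/measurable_EFinP; apply: measurable_funM; first exact: measurable_indic.
  apply: measurable_funM => //.
  apply: (measurableT_comp (@measurable_tent2 R N)).
  by apply: measurable_fun_pair; apply: measurable_funB => //.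
- move=> v _; rewrite /cell/= lee_fin [leRHS]normrM (ger0_norm (sqr_ge0 N)) mulrCA normrM.
  apply: ler_wpM2r => //.
  by rewrite ger0_norm ?tent2_ge0// tent2_le.
apply: iE'.
have -> : EFin \o (fun v => \1_(square 0 N) v * E v) = (EFin \o E) \_ (square 0 N).
  apply/funext => v; rewrite patchE /= indicE.
  by case: ifP => _; rewrite ?mul1r ?mul0r.
exact: iE (integrable_torus N1 hE).
Qed.

(** The two translates of the tent that meet [0,N] add up to the constant N. *)
Lemma tent_fold (t : R) : 0 <= t <= N -> tent N t + tent N (t - N) = N.
Proof.
move=> /andP[t0 tN]; rewrite /tent ger0_norm// ler0_norm ?subr_le0//.
by rewrite !max_r; lra.
Qed.

Lemma tent_eq0 (t : R) : N <= `|t| -> tent N t = 0.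
Proof. by move=> h; rewrite /tent max_l// subr_le0. Qed.

(** The support [-N,N]^2 is cut into four quadrants, each moved into [0,N]^2 by a period of E. On
    the axes the closed squares would count points twice. *)
Lemma tent_square v : off_axes v ->
  tent2 N v * E v = (cell (0, 0) v + cell (N, 0) (v + (N, 0))) +
    (cell (0, N) (v + (0, N)) + cell (N, N) (v + (N, N))).
Proof.
move=> [v1 v2].
have N0 : 0 < N := lt_le_trans ltr01 N1.
have ind (t s : R) : (t \in `[0, N]) = (0 <= t <= N) by rewrite in_itv.
have cE (a b : int) : cell (a%:~R * N, b%:~R * N) (v + (a%:~R * N, b%:~R * N)) =
    \1_(square 0 N) (v + (a%:~R * N, b%:~R * N)) * (tent2 N v * E v).
  by rewrite /cell addrK (torus_periodic hE).
have e00 : (0, 0) = (0%:~R * N, 0%:~R * N) :> R * R by rewrite mul0r.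
have e10 : (N, 0) = (1%:~R * N, 0%:~R * N) :> R * R by rewrite mul0r mul1r.
have e01 : (0, N) = (0%:~R * N, 1%:~R * N) :> R * R by rewrite mul0r mul1r.
have e11 : (N, N) = (1%:~R * N, 1%:~R * N) :> R * R by rewrite mul1r.
have -> : cell (0, 0) v = cell (0, 0) (v + (0, 0)) by rewrite [(0, 0)]/(0 : R * R) addr0.
rewrite [in RHS]e00 [in RHS]e10 [in RHS]e01 [in RHS]e11 !cE -!mulrDl.
have one (t : R) : t != 0 -> `|t| <= N -> (\1_(`[0, N] : set R) t + \1_(`[0, N] : set R) (t + N)) = 1 :> R.
  move=> t0; rewrite ler_norml => /andP[h1 h2]; rewrite !indicE !mem_setE !in_itv/=.
  case: (ltgtP t 0) t0 => // ht _.
    have -> : (0 <= t + N <= N) by apply/andP; split; lra.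
    by rewrite add0r.
  have -> : (0 <= t + N <= N) = false by apply/negbTE; rewrite negb_and -!ltNge; apply/orP; right; lra.
  by rewrite h2 addr0.
have prod (z : R * R) : \1_(square 0 N) z = \1_(`[0, N] : set R) z.1 * \1_(`[0, N] : set R) z.2 :> R.
  by rewrite !indicE -natrM mulnb /square in_setX.
case: (lerP `|v.1| N) => h1; last by rewrite /tent2 (tent_eq0 (ltW h1)) !mul0r mulr0.
case: (lerP `|v.2| N) => h2; last by rewrite /tent2 (tent_eq0 (ltW h2)) mulr0 !mul0r mulr0.
rewrite !prod /= !mul0r !mul1r !addr0.
have := one _ v1 h1; have := one _ v2 h2.
move: (\1__ v.1 : R) (\1__ (v.1 + N) : R) (\1__ v.2 : R) (\1__ (v.2 + N) : R) (tent2 N v * E v) => a b c e f h h'.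
have -> : (a * c + b * c + (a * e + b * e)) * f = (a + b) * (c + e) * f by ring.
by rewrite h h' !mul1r.
Qed.

Lemma Rintegral_shift2 (s : R * R) (f : R * R -> R) : mu2.-integrable setT (EFin \o f) ->
  mu2.-integrable setT (EFin \o (fun v => f (v + s))) /\
  \int[mu2]_v f (v + s) = \int[mu2]_v f v.
Proof.
move=> fi.
have e : (fun z : R * R => (EFin \o f) (1 * z.1 + s.1, 1 * z.2 + s.2)) = EFin \o (fun v => f (v + s)).
  by apply/funext => z /=; congr (EFin (f _)); rewrite !mul1r.
split; first by rewrite -e; exact: integrable_affine2.
rewrite /Rintegral (integral_affine2 s.1 s.2 ltr01 fi) expr1n mul1e; congr fine.
by apply: eq_integral => z _ /=; congr (EFin (f _)); rewrite !mul1r.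
Qed.

Lemma integrable_tent_torus : mu2.-integrable setT (EFin \o (fun v => tent2 N v * E v)).
Proof.
have sh s := (Rintegral_shift2 s (cell_integrable s)).1.
have i2 := integrable_addr (nu := mu2) measurableT
  (integrable_addr (nu := mu2) measurableT (cell_integrable (0, 0)) (sh (N, 0)))
  (integrable_addr (nu := mu2) measurableT (sh (0, N)) (sh (N, N))).
apply: (ae_le_integrable ae_off_axes _ i2).
  by apply: measurable_funM; [exact: measurable_tent2|exact: measurable_torus hE].
by move=> v hv; rewrite (tent_square hv).
Qed.

(** After folding, the four tents sum to N^2 on the fundamental square, so the integral is N^2 times
    the (0,0) Fourier coefficient up to normalization, which is zero. *)
Lemma integral_tent_torus : \int[mu2]_v (tent2 N v * E v) = 0.
Proof.
have N0 : 0 < N := lt_le_trans ltr01 N1.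
have mS := @measurable_square R 0 N.
have mE := measurable_torus hE.
have c00 := cell_integrable (0, 0); have c10 := cell_integrable (N, 0).
have c01 := cell_integrable (0, N); have c11 := cell_integrable (N, N).
have [s10 e10] := Rintegral_shift2 (N, 0) c10.
have [s01 e01] := Rintegral_shift2 (0, N) c01.
have [s11 e11] := Rintegral_shift2 (N, N) c11.
have a1 := integrable_addr (nu := mu2) measurableT c00 s10.
have a2 := integrable_addr (nu := mu2) measurableT s01 s11.
have b1 := integrable_addr (nu := mu2) measurableT c00 c10.
have b2 := integrable_addr (nu := mu2) measurableT c01 c11.
have a3 := integrable_addr (nu := mu2) measurableT a1 a2.
have m3 : measurable_fun setT (fun v => (cell (0, 0) v + cell (N, 0) (v + (N, 0))) +
    (cell (0, N) (v + (0, N)) + cell (N, N) (v + (N, N)))).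
  by apply/measurable_EFinP; move/integrableP : a3 => [].
have mt : measurable_fun setT (fun v => tent2 N v * E v).
  by apply: measurable_funM => //; exact: measurable_tent2.
transitivity (\int[mu2]_v ((cell (0, 0) v + cell (N, 0) (v + (N, 0))) +
    (cell (0, N) (v + (0, N)) + cell (N, N) (v + (N, N))))).
  exact: (ae_eq_Rintegral ae_off_axes mt m3 tent_square).
rewrite (RintegralD (mu := mu2) measurableT a1 a2) (RintegralD (mu := mu2) measurableT c00 s10)
  (RintegralD (mu := mu2) measurableT s01 s11) e10 e01 e11.
rewrite -(RintegralD (mu := mu2) measurableT c00 c10) -(RintegralD (mu := mu2) measurableT c01 c11).
rewrite -(RintegralD (mu := mu2) measurableT b1 b2).
transitivity (\int[mu2]_(v in square 0 N) (N ^+ 2 * E v)).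
  rewrite [RHS]Rintegral_mkcond; apply: (@eq_Rintegral _ _ _ mu2) => v _.
  rewrite /cell -!mulrDr -!mulrDl indicE patchE; case: ifP => hv; last by rewrite !mul0r.
  rewrite mul1r; congr (_ * _).
  move: hv; rewrite inE => -[/=]; rewrite !in_itv/= => hv1 hv2.
  rewrite !subr0 -mulrDr.
  by rewrite (tent_fold hv1) (tent_fold hv2).
have [_ _ _ _ /(_ 0 0)[+ _]] := hE; rewrite /= => z.
have z' : \int[mu2]_(x in square 0 N) (E x * cos (fourier_phase N 0 0 x)) = 0.
  by apply/eqP; move/eqP: z; rewrite mulf_eq0 invr_eq0 expf_eq0/= (gt_eqF N0) orbF.
rewrite (RintegralZl (mu := mu2) (N ^+ 2) mS (integrable_torus N1 hE)).
rewrite (_ : \int[mu2]_(x in square 0 N) E x = 0) ?mulr0// -[RHS]z'.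
apply: (@eq_Rintegral _ _ _ mu2) => v _.
by rewrite /fourier_phase !mul0r addr0 mulr0 cos0 mulr1.
Qed.

End zero_mode.

(** * Expectation of a difference whose first term may have infinite mean *)

Section expect_difference.
Context {R : realType} {d : measure_display} {Omega : measurableType d}.
Variables (P : probability Omega R) (A B : Omega -> R) (k L : R).
Hypotheses (mA : measurable_fun setT A) (mB : measurable_fun setT B)
  (A0 : forall w, 0 <= A w) (B0 : forall w, 0 <= B w) (k0 : 0 < k)
  (fB : (\int[P]_w (B w)%:E < +oo)%E).

Let PT : (P setT < +oo)%E.
Proof. by rewrite probability_setT ltry. Qed.

Let ge0_integrable (f : Omega -> R) : measurable_fun setT f -> (forall w, 0 <= f w) ->
  (\int[P]_w (f w)%:E < +oo)%E -> P.-integrable setT (EFin \o f).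
Proof.
move=> mf f0 h; apply/integrableP; split; first exact/measurable_EFinP.
by under eq_integral => w _ do rewrite gee0_abs ?lee_fin//.
Qed.

Lemma integral_affine_difference :
  (\int[P]_w (k * (A w - B w) + L)%:E =
   k%:E * (\int[P]_w (A w)%:E - \int[P]_w (B w)%:E) + L%:E)%E.
Proof.
have iB := ge0_integrable mB B0 fB.
have fBn : (\int[P]_w (B w)%:E)%E \is a fin_num := integrable_fin_num measurableT iB.
have iL := integrable_const (nu := P) L measurableT PT.
have iL' := integrable_const (nu := P) `|L| measurableT PT.
have [fA|] := ltP (\int[P]_w (A w)%:E)%E +oo%E.
  have iA := ge0_integrable mA A0 fA.
  have iAB := integrableB (mu := P) measurableT iA iB.
  transitivity (\int[P]_w (k%:E * ((EFin \o A) w - (EFin \o B) w) + (EFin \o (fun=> L)) w))%E.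
    by apply: eq_integral => w _; rewrite -EFinB -EFinM -EFinD.
  rewrite (integralD (mu := P) measurableT (integrableZl measurableT k iAB) iL).
  rewrite (integralZl (mu := P) measurableT iAB) (integralB (mu := P) measurableT iA iB).
  congr (_ + _)%E; apply: (etrans (integral_cst P measurableT L%:E)).
  exact: (etrans (congr1 (fun t => L%:E * t)%E (@probability_setT _ _ _ P)) (mule1 _)).
rewrite leye_eq => /eqP eA; rewrite eA.
have -> : (k%:E * (+oo - \int[P]_w (B w)%:E) + L%:E = +oo :> \bar R)%E.
  by rewrite -(fineK fBn) gt0_muley ?lte_fin.
pose f w := k * (A w - B w) + L.
have mf : measurable_fun setT (EFin \o f).
  apply/measurable_EFinP; apply: measurable_funD => //.
  by apply: measurable_funM => //; exact: measurable_funB.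
pose g w := k * B w + `|L|.
have ig : P.-integrable setT (EFin \o g).
  exact: (integrable_addr (nu := P) measurableT (integrable_scaler (nu := P) k measurableT iB) iL').
have g0 w : 0 <= g w by rewrite addr_ge0// mulr_ge0// ltW.
have fg : (\int[P]_w (g w)%:E < +oo)%E by rewrite ltey_eq (integrable_fin_num measurableT ig).
have mg : measurable_fun setT (EFin \o g) by move/integrableP : ig => [].
have neg : (\int[P]_w ((EFin \o f)^\- w) < +oo)%E.
  apply: le_lt_trans fg; apply: (ge0_le_integral P measurableT) => //.
    exact: measurable_funeneg.
  move=> w _; rewrite funenegE /= -EFin_max lee_fin ge_max g0 andbT /f /g.
  have := ler_norm (- L); rewrite normrN => h.
  have h2 : 0 <= k * A w by rewrite mulr_ge0// ltW.
  by move: h h2; rewrite mulrBr; move: (k * A w) (k * B w) `|L| => *; lra.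
(* k A <= f^+ + g with g integrable, so the positive part inherits the infinite mean of A. *)
have pos : (\int[P]_w ((EFin \o f)^\+ w) = +oo)%E.
  apply/eqP; rewrite -leye_eq leNgt; apply/negP => h.
  have : (\int[P]_w (k * A w)%:E < +oo)%E.
    have mp := measurable_funepos mf.
    apply: (@le_lt_trans _ _ (\int[P]_w ((EFin \o f)^\+ w + (EFin \o g) w))%E); last first.
      rewrite (ge0_integralD P measurableT)//; first by rewrite lte_add_pinfty.
      by move=> w _; rewrite lee_fin g0.
    apply: (ge0_le_integral P measurableT) => //.
    - by move=> w _; rewrite lee_fin mulr_ge0// ltW.
    - by apply/measurable_EFinP; apply: measurable_funM.
    - by apply: emeasurable_funD.
    move=> w _; rewrite funeposE /= -EFin_max -EFinD lee_fin.
    apply: (@le_trans _ _ (f w + g w)); last by rewrite lerD2r le_max lexx.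
    have := ler_norm (- L); rewrite normrN /f /g mulrBr => h1.
    by move: h1; move: (k * A w) (k * B w) `|L| => *; lra.
  under eq_integral => w _ do rewrite EFinM.
  rewrite (ge0_integralZl P measurableT)//.
  - by rewrite eA gt0_muley ?lte_fin// ltxx.
  - exact/measurable_EFinP.
  - by move=> w _; rewrite lee_fin.
  - by rewrite lee_fin ltW.
rewrite integralE pos; move: neg.
have : (0 <= \int[P]_w (EFin \o f)^\- w)%E by exact: integral_ge0.
by case: (\int[P]_w _)%E.
Qed.

End expect_difference.

(** * The normalized tent and the energy with its logarithm removed *)

Section taper.
Context {R : realType}.

Definition taper (N : R) (v : R * R) : R := tent2 N v / N ^+ 2.

(** The tapered regular part of E: adding 2 pi ln(|v|/N) cancels the singularity at the origin. *)
Definition defect (N : R) (E : R * R -> R) (v : R * R) : R :=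
  taper N v * (E v + 2 * pi * ln (enorm v / N)).

Lemma taper_ge0 N v : 0 <= taper N v.
Proof. by rewrite divr_ge0 ?tent2_ge0 ?sqr_ge0. Qed.

Lemma taper_le1 N v : 0 < N -> taper N v <= 1.
Proof. by move=> N0; rewrite ler_pdivrMr ?exprn_gt0// mul1r tent2_le. Qed.

Lemma measurable_taper N : measurable_fun setT (taper N).
Proof. by apply: measurable_funM => //; exact: measurable_tent2. Qed.

Lemma taper_out N v : N <= `|v.1| \/ N <= `|v.2| -> taper N v = 0.
Proof. by rewrite /taper /tent2 => -[/tent_eq0 ->|/tent_eq0 ->]; rewrite ?mulr0 !mul0r. Qed.

Lemma taper_in N v : 0 < N -> `|v.1| < N -> `|v.2| < N ->
  taper N v = (1 - `|v.1 / N|) * (1 - `|v.2| / N).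
Proof.
move=> N0 h1 h2; rewrite /taper /tent2 /tent !max_r ?subr_ge0 ?ltW//.
by rewrite normrM normfV (gtr0_norm N0); field; rewrite gt_eqF.
Qed.

Lemma enorm_scale (N : R) v : 0 < N -> enorm (v.1 / N, `|v.2| / N) = enorm v / N.
Proof.
move=> N0; rewrite /enorm/= !exprMn real_normK ?num_real// -mulrDl sqrtrM; last first.
  by rewrite addr_ge0 ?sqr_ge0.
by rewrite exprVn sqrtrV ?sqr_ge0// sqrtr_sqr gtr0_norm.
Qed.

Lemma enorm_gt0 (v : R * R) : off_axes v -> 0 < enorm v.
Proof. by move=> [v1 v2]; rewrite sqrtr_gt0 ltr_pwDl ?exprn_even_gt0// sqr_ge0. Qed.

(** Rescaling by N turns this into [kfun_bound], whose constant does not depend on N; where some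
    coordinate reaches N the taper is zero. *)
Lemma defect_bound : exists2 C : R, 0 <= C & forall N E v, 1 <= N -> is_torus_energy N E ->
  off_axes v -> `|defect N E v| <= C.
Proof.
have [C hC] := @kfun_bound R; exists `|C| => // N E v N1 hE [v1 v2].
have N0 : 0 < N := lt_le_trans ltr01 N1.
rewrite /defect; case: (ltP `|v.1| N) => h1; last first.
  by rewrite taper_out ?mul0r ?normr0//; left.
case: (ltP `|v.2| N) => h2; last first.
  by rewrite taper_out ?mul0r ?normr0//; right.
have h3 : 0 < `|v.1 / N| < 1.
  by rewrite normrM normfV (gtr0_norm N0) divr_gt0 ?normr_gt0//= ltr_pdivrMr// mul1r.
have h4 : 0 < `|v.2| / N < 1 by rewrite divr_gt0 ?normr_gt0//= ltr_pdivrMr// mul1r.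
have w0 := taper_ge0 N v.
rewrite normrM (ger0_norm w0) mulrC (torus_kfun_abs N1 hE v1 v2 h1 h2) (taper_in N0 h1 h2).
by rewrite -(enorm_scale v N0); apply: le_trans (hC _ _ h3 h4) _; exact: ler_norm.
Qed.

Lemma taper_cvg v : taper N v @[N --> +oo] --> (1 : R).
Proof.
have c : (1 - `|v.1| / N) * (1 - `|v.2| / N) @[N --> +oo] --> ((1 - 0) * (1 - 0) : R).
  by apply: cvgM; apply: cvgB; [exact: cvg_cst|exact: cvg_div_pinfty0|exact: cvg_cst|exact: cvg_div_pinfty0].
rewrite subr0 mulr1 in c; apply: cvg_trans c; apply: near_eq_cvg; near=> N.
have N0 : 0 < N by near: N; exact: nbhs_pinfty_gt.
have h1 : `|v.1| < N by near: N; exact: nbhs_pinfty_gt.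
have h2 : `|v.2| < N by near: N; exact: nbhs_pinfty_gt.
by rewrite taper_in// normrM normfV (gtr0_norm N0).
Unshelve. all: by end_near. Qed.

Lemma defect_cvg (E : R -> R * R -> R) v : (forall N, 1 <= N -> is_torus_energy N (E N)) ->
  off_axes v -> defect N (E N) v @[N --> +oo] --> - (2 * pi * @torus_const R).
Proof.
move=> hE [v1 v2].
have c : taper N v * (kfun (v.1 / N) (`|v.2| / N) + 2 * pi * ln (enorm v / N)) @[N --> +oo] -->
    1 * - (2 * pi * @torus_const R).
  by apply: cvgM; [exact: taper_cvg|exact: kfun_cvg].
rewrite mul1r in c; apply: cvg_trans c; apply: near_eq_cvg; near=> N.
have N1 : 1 <= N by near: N; exact: nbhs_pinfty_ge.
have h1 : `|v.1| < N by near: N; exact: nbhs_pinfty_gt.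
have h2 : `|v.2| < N by near: N; exact: nbhs_pinfty_gt.
by rewrite /defect (torus_kfun_abs N1 (hE _ N1) v1 v2 h1 h2).
Unshelve. all: by end_near. Qed.

Lemma measurable_enorm : measurable_fun setT (@enorm R).
Proof.
have ms : measurable_fun setT (@Num.sqrt R) by exact: continuous_measurable_fun (@sqrt_continuous R).
by apply: (measurableT_comp ms); apply: measurable_funD; apply: measurable_funX.
Qed.

Lemma measurable_defect N E : is_torus_energy N E -> measurable_fun setT (defect N E).
Proof.
move=> hE; apply: measurable_funM; first exact: measurable_taper.
apply: measurable_funD; first exact: measurable_torus hE.
apply: measurable_funM => //; apply: measurableT_comp; first exact: measurable_ln.
by apply: measurable_funM => //; exact: measurable_enorm.
Qed.

Lemma normr_le_enorm (v : R * R) : `|v.1| <= enorm v /\ `|v.2| <= enorm v.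
Proof.
by split; rewrite /enorm -sqrtr_sqr ler_sqrt ?addr_ge0 ?sqr_ge0// ?lerDl ?lerDr sqr_ge0.
Qed.

Lemma enorm_le_sum (v : R * R) : enorm v <= `|v.1| + `|v.2|.
Proof.
rewrite /enorm -[leRHS]ger0_norm ?addr_ge0// -sqrtr_sqr ler_sqrt ?sqr_ge0//.
by rewrite sqrrD !real_normK ?num_real// -addrA lerD2l lerDr mulrn_wge0// mulr_ge0.
Qed.

Lemma defectE N E v : 0 < N -> off_axes v ->
  tent2 N v * E v = N ^+ 2 * (defect N E v - 2 * pi * (taper N v * (ln (enorm v) - ln N))).
Proof.
move=> N0 hv; rewrite /defect ln_div ?posrE ?enorm_gt0//.
have -> : tent2 N v = N ^+ 2 * taper N v by rewrite /taper mulrC divfK// expf_neq0// gt_eqF.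
by move: (taper N v) (ln _) (ln _) (pi : R) => *; ring.
Qed.

(** On the support of the taper |v| <= 2 N, and ln 2 <= 1. *)
Lemma taper_ln_le N v : 0 < N -> off_axes v -> taper N v * (ln (enorm v) - ln N) <= 1.
Proof.
move=> N0 hv; case: (ltP `|v.1| N) => h1; last first.
  by rewrite taper_out ?mul0r//; left.
case: (ltP `|v.2| N) => h2; last first.
  by rewrite taper_out ?mul0r//; right.
have e0 := enorm_gt0 hv.
have h : ln (enorm v) - ln N <= 1.
  rewrite -ln_div ?posrE//.
  have := @le_ln1Dx R (enorm v / N - 1); rewrite subrKC => /(_ _) h.
  have e2 : enorm v / N <= 2.
    by rewrite ler_pdivrMr//; apply: le_trans (enorm_le_sum v) _; lra.
  have p0 : 0 < enorm v / N by rewrite divr_gt0.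
  by apply: le_trans (h _) _; lra.
apply: le_trans (ler_wpM2l (taper_ge0 N v) h) _.
by rewrite mulr1 taper_le1.
Qed.

(** For |v| >= 1/2 the logarithm is at most 2 |v| in absolute value; for |v| < 1/2 and N >= 1 the
    taper is at least 1/4. The first moment of T2 thus controls T2 ln|v| away from the origin. *)
Lemma ln_enorm_le N v : 1 <= N -> off_axes v ->
  `|ln (enorm v)| <= 4 * `|taper N v * ln (enorm v)| + 2 * enorm v.
Proof.
move=> N1 hv; have e0 := enorm_gt0 hv; have [n1 n2] := normr_le_enorm v.
have N0 : 0 < N := lt_le_trans ltr01 N1.
have big : 2^-1 <= enorm v -> `|ln (enorm v)| <= 2 * enorm v.
  move=> he; have lo := ln_ge e0.
  have hi := @le_ln1Dx R (enorm v - 1); rewrite subrKC in hi.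
  have i2 : (enorm v)^-1 <= 2 by rewrite -[leRHS]invrK lef_pV2 ?posrE.
  have hi' : ln (enorm v) <= enorm v - 1 by apply: hi; lra.
  by rewrite ler_norml; apply/andP; split; lra.
have t0 : 0 <= 4 * `|taper N v * ln (enorm v)| by rewrite mulr_ge0.
case: (leP 2^-1 (enorm v)) => he; first by apply: le_trans (big he) _; rewrite lerDr.
have w4 : 4^-1 <= taper N v.
  rewrite taper_in//; try lra.
  rewrite normrM normfV (gtr0_norm N0).
  have a1 : `|v.1| / N <= 2^-1 by rewrite ler_pdivrMr//; lra.
  have a2 : `|v.2| / N <= 2^-1 by rewrite ler_pdivrMr//; lra.
  have -> : 4^-1 = 2^-1 * 2^-1 :> R by field.
  by apply: ler_pM; lra.
rewrite normrM (ger0_norm (taper_ge0 N v)).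
have : 4^-1 * `|ln (enorm v)| <= taper N v * `|ln (enorm v)| by apply: ler_wpM2r.
by move: he e0 t0; move: `|ln (enorm v)| (enorm v) (taper N v) => l e t *; nra.
Qed.

End taper.

(** * The expected energy for a fixed N, finite or infinite *)

Lemma neg_part_le (R : realType) (t r M T : R) : 0 <= r -> r <= 1 + T -> 0 <= T -> 0 <= M ->
  - t <= M -> - (t * r) <= `|t| + M * T.
Proof.
move=> r0 r1 T0 M0 tM; have MT : 0 <= M * T by exact: mulr_ge0.
case: (lerP 0 t) => t0.
  have : 0 <= t * r by exact: mulr_ge0.
  by move: MT (normr_ge0 t); move: (M * T) (t * r) => *; lra.
have h1 : - t * r <= - t * (1 + T) by apply: ler_wpM2l; lra.
have h2 : - t * T <= M * T by exact: ler_wpM2r.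
by rewrite (ltr0_norm t0) -mulNr; move: h1; rewrite mulrDr mulr1; move: h2; move: (- t * T) (- t * r) (M * T) => *; lra.
Qed.

Lemma max_scale (R : realType) (t f r : R) : 0 <= t -> 0 <= r ->
  t * (Num.max f 0 * r) = Num.max (t * (f * r)) 0.
Proof.
move=> t0 r0; case: (lerP f 0) => h.
  by rewrite mul0r mulr0 max_r// mulr_ge0_le0// mulr_le0_ge0.
by rewrite max_l// !mulr_ge0// ltW.
Qed.

Section expected_energy.
Context {R : realType} {d : measure_display} {Omega : measurableType d}.
Local Notation mu2 := (leb2 R).
Variables (P : probability Omega R) (X : Omega -> set (R * R)) (T2 : R * R -> R)
  (E : R -> R * R -> R).
Hypotheses (hE : forall N : R, 1 <= N -> is_torus_energy N (E N))
  (hX : simple_point_process X)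
  (hrho2 : two_point_correlation P X (fun p => 1 - T2 (p.1 - p.2)))
  (hT2 : measurable_fun setT T2)
  (iT : mu2.-integrable setT (EFin \o T2))
  (im : mu2.-integrable setT (EFin \o (fun v => enorm v * `|T2 v|))).

(** The points of full measure where E has its closed form and [rho_pos] is 1 - T2. *)
Let generic (v : R * R) := off_axes v /\ T2 v <= 1.

Let ae_generic : {ae mu2, forall v, generic v}.
Proof.
have [A [mA A0 sA]] := @ae_off_axes R; have [B [mB B0 sB]] := ae_T2_le1 hrho2 hT2.
exists (A `|` B); split; first exact: measurableU.
  exact: null_set_setU.
move=> v /= h; apply: contrapT => /not_orP[nA nB]; apply: h; split.
  by apply: contrapT => h; apply: nA; exact: sA.
by apply: contrapT => h; apply: nB; exact: sB.
Qed.

Section window.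
Variable N : R.
Hypothesis N1 : 1 <= N.

Let N0 : 0 < N := lt_le_trans ltr01 N1.

(** Written with [rho_pos] so that its sign is that of E everywhere. *)
Let energy_density v := tent2 N v * (E N v * rho_pos T2 v).

Lemma measurable_energy_density : measurable_fun setT energy_density.
Proof.
apply: measurable_funM; first exact: measurable_tent2.
by apply: measurable_funM; [exact: measurable_torus (hE N1)|exact: measurable_rho_pos].
Qed.

Lemma rho_pos_le v : rho_pos T2 v <= 1 + `|T2 v|.
Proof.
have := ler_norm (- T2 v); rewrite normrN => h.
by rewrite /rho_pos ge_max; apply/andP; split; [rewrite addr_ge0|lra].
Qed.

(** tent2 E is bounded below by -M, from [defect_bound] and [taper_ln_le], and [rho_pos] is at most
    1 + |T2|; the negative part is then below |tent2 E| + M |T2|, which is integrable. *)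
Lemma energy_density_neg : (\int[mu2]_v (EFin \o energy_density)^\- v < +oo)%E.
Proof.
have [C C0 hC] := @defect_bound R.
pose M := N ^+ 2 * (C + 2 * pi).
have iTE := integrable_tent_torus N1 (hE N1).
pose g v := `|tent2 N v * E N v| + M * `|T2 v|.
have ig : mu2.-integrable setT (EFin \o g).
  apply: (integrable_addr (nu := mu2)) => //; first exact: (integrable_normr (nu := mu2)).
  by apply: (integrable_scaler (nu := mu2)) => //; exact: (integrable_normr (nu := mu2)).
have mD := measurable_energy_density.
pose h v := Num.max (- energy_density v) 0.
have mh : measurable_fun setT h by apply: measurable_maxr => //; exact: measurableT_comp.
have ih : mu2.-integrable setT (EFin \o h).
  apply: (ae_le_integrable ae_generic mh ig) => v [hv _].
  have p0 := pi_gt0 R.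
  have M0 : 0 <= M by rewrite mulr_ge0 ?sqr_ge0// addr_ge0// mulr_ge0// ltW.
  have g0 : 0 <= g v by rewrite addr_ge0// mulr_ge0.
  rewrite ger0_norm ?le_max ?lexx ?orbT// (ger0_norm g0) /h ge_max g0 andbT.
  have lo : - (tent2 N v * E N v) <= M.
    rewrite (defectE _ N0 hv) -mulrN /M ler_wpM2l ?sqr_ge0//.
    have := hC _ _ _ N1 (hE N1) hv; rewrite ler_norml => /andP[c1 _].
    have c2 := taper_ln_le N0 hv.
    have : 2 * pi * (taper N v * (ln (enorm v) - ln N)) <= 2 * pi.
      by apply: ler_piMr => //; rewrite mulr_ge0// ltW.
    by move: c1; move: (2 * pi) (2 * pi * _) (defect _ _ _) => *; lra.
  rewrite /energy_density mulrA /g.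
  exact: neg_part_le (rho_pos_ge0 T2 v) (rho_pos_le v) (normr_ge0 _) M0 lo.
have -> : ((EFin \o energy_density)^\- = EFin \o h)%E.
  by apply/funext => v; rewrite funenegE /= -EFin_max.
by rewrite ltey_eq (integrable_fin_num measurableT ih).
Qed.

(** Positive and negative parts of E give two nonnegative pair sums, each computed by
    [expect_pair_sum]. Only the negative one is known to have finite mean, so the identity holds in
    the extended reals. *)
Lemma expect_W_eq : ('E_P[fun w => W E N (X w)] =
  ((2 * pi * N ^+ 2)^-1)%:E * (\int[mu2]_v (energy_density v)%:E) + (ln N - @torus_const R)%:E)%E.
Proof.
have k0 : 0 < (2 * pi * N ^+ 2)^-1 by rewrite invr_gt0 !mulr_gt0 ?pi_gt0// exprn_gt0.
have mS := @measurable_square R 0 N.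
have fS := finite_window hX N0.
have mE := measurable_torus (hE N1).
pose Ep v := Num.max (E N v) 0; pose Em v := Num.max (- E N v) 0.
have mp : measurable_fun setT Ep by exact: measurable_maxr.
have mm : measurable_fun setT Em by apply: measurable_maxr => //; exact: measurableT_comp.
have p0 v : 0 <= Ep v by rewrite le_max lexx orbT.
have m0 v : 0 <= Em v by rewrite le_max lexx orbT.
have pm v : Ep v - Em v = E N v.
  by rewrite /Ep /Em; case: (lerP (E N v) 0) => h; [rewrite max_l|rewrite max_r]; lra.
pose A := pair_sum X (square 0 N) (fun p => Ep (p.1 - p.2)).
pose B := pair_sum X (square 0 N) (fun p => Em (p.1 - p.2)).
have mA : measurable_fun setT A.
  by apply: measurable_pair_sum_ge0 => //; exact: (measurableT_comp mp (@measurable_subp R)).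
have mB : measurable_fun setT B.
  by apply: measurable_pair_sum_ge0 => //; exact: (measurableT_comp mm (@measurable_subp R)).
have A0 w : 0 <= A w by exact: pair_sum_ge0.
have B0 w : 0 <= B w by exact: pair_sum_ge0.
have eA : (\int[P]_w (A w)%:E = \int[mu2]_v (EFin \o energy_density)^\+ v)%E.
  apply: (etrans (expect_pair_sum hX hrho2 hT2 N0 mp p0)); apply: eq_integral => v _.
  rewrite funeposE /= -EFin_max; congr EFin.
  exact: max_scale (tent2_ge0 _ _) (rho_pos_ge0 _ _).
have eB : (\int[P]_w (B w)%:E = \int[mu2]_v (EFin \o energy_density)^\- v)%E.
  apply: (etrans (expect_pair_sum hX hrho2 hT2 N0 mm m0)); apply: eq_integral => v _.
  rewrite funenegE /= -EFin_max; congr EFin.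
  rewrite /energy_density -mulrN -mulNr; exact: max_scale (tent2_ge0 _ _) (rho_pos_ge0 _ _).
have fB : (\int[P]_w (B w)%:E < +oo)%E by rewrite eB; exact: energy_density_neg.
rewrite unlock.
have := integral_affine_difference (ln N - torus_const) mA mB A0 B0 k0 fB.
rewrite eA eB -integralE => <-.
apply: eq_integral => w _; rewrite /W (ln_torus_const N0); congr (EFin (_ * _ + _)).
rewrite -(pair_sumB fS) /pair_sum.
by apply: eq_fsbigr => p _; rewrite pm.
Qed.

Let logT v := T2 v * ln (enorm v).

Let defectT v := defect N (E N) v * T2 v.

Lemma measurable_logT : measurable_fun setT logT.
Proof.
by apply: measurable_funM => //; apply: measurableT_comp; [exact: measurable_ln|exact: measurable_enorm].
Qed.

Lemma integrable_taperM f : mu2.-integrable setT (EFin \o f) ->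
  mu2.-integrable setT (EFin \o (fun v => taper N v * f v)).
Proof.
move=> fi; have mf : measurable_fun setT f by apply/measurable_EFinP; move/integrableP : fi => [].
apply: (le_integrable (mu := mu2) measurableT _ _ fi).
  by apply/measurable_EFinP; apply: measurable_funM => //; exact: measurable_taper.
move=> v _ /=; rewrite lee_fin normrM; apply: ler_piMl => //.
by rewrite ger0_norm ?taper_ge0// taper_le1.
Qed.

Lemma integrable_defectT : mu2.-integrable setT (EFin \o defectT).
Proof.
have [C C0 hC] := @defect_bound R.
have mD : measurable_fun setT defectT by apply: measurable_funM => //; exact: measurable_defect (hE N1).
apply: (ae_le_integrable ae_generic mD (integrable_scaler (nu := mu2) C measurableT iT)) => v [hv _].
rewrite normrM [leRHS]normrM (ger0_norm C0); apply: ler_wpM2r => //; exact: (hC _ _ _ N1 (hE N1) hv).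
Qed.

Lemma energy_densityE v : generic v -> energy_density v = tent2 N v * E N v -
  N ^+ 2 * (defectT v - 2 * pi * (taper N v * logT v - ln N * (taper N v * T2 v))).
Proof.
move=> [hv h1]; rewrite /energy_density /rho_pos max_r ?subr_ge0// mulrA mulrBr mulr1.
congr (_ - _); rewrite (defectE _ N0 hv) /defectT /logT.
by move: (defect _ _ _) (taper N v) (T2 v) (ln _) (ln _) => a b c e f; move: (pi : R) => p; ring.
Qed.

(** Solving [energy_densityE] for taper T2 ln|v| exhibits it as a combination of integrable
    functions; [ln_enorm_le] then removes the taper. *)
Lemma integrable_energy_logT : mu2.-integrable setT (EFin \o energy_density) ->
  mu2.-integrable setT (EFin \o logT).
Proof.
move=> iF; have iTE := integrable_tent_torus N1 (hE N1).
have p0 : 0 < 2 * pi :> R by rewrite mulr_gt0// pi_gt0.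
pose g v := 4 * (2 * pi)^-1 * (`|defectT v| + (2 * pi * `|ln N|) * `|taper N v * T2 v| +
   (N ^+ 2)^-1 * (`|tent2 N v * E N v| + `|energy_density v|)) + 2 * (enorm v * `|T2 v|).
have nI f (fi : mu2.-integrable setT (EFin \o f)) := integrable_normr (nu := mu2) measurableT fi.
have sI k f (fi : mu2.-integrable setT (EFin \o f)) := integrable_scaler (nu := mu2) k measurableT fi.
have aI f g' (fi : mu2.-integrable setT (EFin \o f)) (gi : mu2.-integrable setT (EFin \o g')) :=
  integrable_addr (nu := mu2) measurableT fi gi.
have ig : mu2.-integrable setT (EFin \o g).
  apply: (aI); last exact: (sI).
  apply: (sI); apply: (aI); first apply: (aI).
  - by apply: (nI); exact: integrable_defectT.
  - by apply: (sI); apply: (nI); exact: integrable_taperM.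
  - by apply: (sI); apply: (aI); exact: (nI).
apply: (ae_le_integrable ae_generic measurable_logT ig) => v hg.
have hd := energy_densityE hg; have [hv _] := hg.
have e0 := enorm_gt0 hv.
have N20 : 0 < N ^+ 2 by rewrite exprn_gt0.
have key : 2 * pi * (taper N v * logT v) =
    defectT v + 2 * pi * ln N * (taper N v * T2 v) - (N ^+ 2)^-1 * (tent2 N v * E N v - energy_density v).
  rewrite hd opprB addrCA subrr addr0 mulKf ?gt_eqF//.
  by move: (defectT v) (taper N v * logT v) (taper N v * T2 v) (ln N) => a b c e; move: (pi : R) => p; ring.
have keyn : 2 * pi * `|taper N v * logT v| <= `|defectT v| + 2 * pi * `|ln N| * `|taper N v * T2 v| +
    (N ^+ 2)^-1 * (`|tent2 N v * E N v| + `|energy_density v|).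
  rewrite -{1}(gtr0_norm p0) -normrM key.
  apply: le_trans (ler_normB _ _) _; apply: lerD.
    by apply: le_trans (ler_normD _ _) _; rewrite lerD2l !normrM (gtr0_norm (pi_gt0 R)) ger0_norm.
  by rewrite normrM (gtr0_norm (_ : 0 < (N ^+ 2)^-1)) ?invr_gt0// ler_wpM2l ?ler_normB// ltW ?invr_gt0.
have g0 : 0 <= g v.
  have i0 : 0 <= (2 * pi)^-1 :> R by rewrite invr_ge0 ltW.
  have t0 : 0 <= 2 * pi * `|ln N| by apply: mulr_ge0; [exact: ltW|exact: normr_ge0].
  have j0 : 0 <= (N ^+ 2)^-1 by rewrite invr_ge0 ltW.
  apply: addr_ge0; last by rewrite mulr_ge0// mulr_ge0// ltW.
  apply: mulr_ge0; first by rewrite mulr_ge0.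
  apply: addr_ge0; first apply: addr_ge0 => //; first exact: mulr_ge0.
  by apply: mulr_ge0 => //; exact: addr_ge0.
rewrite (ger0_norm g0) /g.
have h4 : `|logT v| <= 4 * `|taper N v * logT v| + 2 * (enorm v * `|T2 v|).
  have := ler_wpM2l (normr_ge0 (T2 v)) (ln_enorm_le N1 hv).
  rewrite /logT !normrM; move: (ln (enorm v)) => l h; apply: le_trans h _.
  by rewrite le_eqVlt; apply/orP; left; apply/eqP; ring.
by apply: le_trans h4 _; rewrite lerD2r -[leRHS]mulrA ler_pM2l// ler_pdivlMl.
Qed.

Lemma expect_W_infinite : ~ mu2.-integrable setT (EFin \o logT) ->
  'E_P[fun w => W E N (X w)]%E = +oo%E.
Proof.
move=> nI; rewrite expect_W_eq.
have k0 : 0 < (2 * pi * N ^+ 2)^-1 by rewrite invr_gt0 !mulr_gt0 ?pi_gt0// exprn_gt0.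
have mF : measurable_fun setT (EFin \o energy_density).
  by apply/measurable_EFinP; exact: measurable_energy_density.
have neg := energy_density_neg.
have -> : (\int[mu2]_v (energy_density v)%:E = +oo)%E.
  rewrite integralE.
  have [pos|] := ltP (\int[mu2]_v (EFin \o energy_density)^\+ v)%E +oo%E.
    (* The negative part is always integrable; a finite positive part would make the density, hence
       T2 ln|v|, integrable. *)
    exfalso; apply: nI; apply: integrable_energy_logT; apply/integrableP; split => //.
    rewrite (_ : (fun x => _) = ((EFin \o energy_density)^\+ \+ (EFin \o energy_density)^\-)%E).
      rewrite (ge0_integralD mu2 measurableT)//; first by rewrite lte_add_pinfty.
        exact: measurable_funepos.
      exact: measurable_funeneg.
    by apply/funext => v; rewrite /= -[LHS]/((abse \o (EFin \o energy_density)) v) fune_abse.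
  rewrite leye_eq => /eqP ->; move: neg.
  have : (0 <= \int[mu2]_v (EFin \o energy_density)^\- v)%E by exact: integral_ge0.
  by rewrite /comp; case: (\int[mu2]_v _)%E.
by rewrite gt0_muley ?lte_fin.
Qed.

(** Integrate [energy_densityE] term by term; the term tent2 E drops out by
    [integral_tent_torus]. *)
Lemma expect_W_finite : mu2.-integrable setT (EFin \o logT) ->
  'E_P[fun w => W E N (X w)]%E =
  (- (2 * pi)^-1 * (\int[mu2]_v defectT v) + \int[mu2]_v (taper N v * logT v) +
   ln N * (1 - \int[mu2]_v (taper N v * T2 v)) - @torus_const R)%:E.
Proof.
move=> il; rewrite expect_W_eq.
have iTE := integrable_tent_torus N1 (hE N1).
have sI k f (fi : mu2.-integrable setT (EFin \o f)) := integrable_scaler (nu := mu2) k measurableT fi.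
have iw := integrable_taperM iT; have ilw := integrable_taperM il; have iD := integrable_defectT.
have i1 : mu2.-integrable setT (EFin \o (fun v => taper N v * logT v - ln N * (taper N v * T2 v))).
  exact: (integrableB (mu := mu2) measurableT ilw (sI (ln N) _ iw)).
have i2 : mu2.-integrable setT (EFin \o (fun v => defectT v -
    2 * pi * (taper N v * logT v - ln N * (taper N v * T2 v)))).
  exact: (integrableB (mu := mu2) measurableT iD (sI _ _ i1)).
pose H v := tent2 N v * E N v -
  N ^+ 2 * (defectT v - 2 * pi * (taper N v * logT v - ln N * (taper N v * T2 v))).
have iH : mu2.-integrable setT (EFin \o H) := integrableB (mu := mu2) measurableT iTE (sI _ _ i2).
have mH : measurable_fun setT H by apply/measurable_EFinP; move/integrableP : iH => [].
have iF : mu2.-integrable setT (EFin \o energy_density).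
  by apply: (ae_le_integrable ae_generic measurable_energy_density iH) => v hv; rewrite energy_densityE.
have -> : (\int[mu2]_v (energy_density v)%:E = (\int[mu2]_v energy_density v)%:E)%E.
  by rewrite /Rintegral fineK//; exact: (integrable_fin_num measurableT iF).
rewrite (ae_eq_Rintegral ae_generic measurable_energy_density mH energy_densityE).
rewrite (RintegralB (mu := mu2) measurableT iTE (sI _ _ i2)) (integral_tent_torus N1 (hE N1)).
rewrite (RintegralZl (mu := mu2) _ measurableT i2) (RintegralB (mu := mu2) measurableT iD (sI _ _ i1)).
rewrite (RintegralZl (mu := mu2) _ measurableT i1) (RintegralB (mu := mu2) measurableT ilw (sI _ _ iw)).
rewrite (RintegralZl (mu := mu2) _ measurableT iw) -EFinM -EFinD; congr EFin.
have p0 := pi_gt0 R.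
move: (\int[mu2]_v _) (\int[mu2]_v _) (\int[mu2]_v _) (ln N) torus_const => a b c l t.
by move: (pi : R) p0 => p p0; field; rewrite !gt_eqF.
Qed.

End window.
End expected_energy.

(** * The limit of large N *)

Section logarithm.
Context {R : realType}.

Lemma ln_pinfty : ln N @[N --> +oo] --> (+oo : set_system R).
Proof.
apply/cvgryPge => A; near=> N.
have h : expR A <= N by near: N; apply: nbhs_pinfty_ge; exact: num_real.
by rewrite -[A]expRK ler_ln ?posrE ?expR_gt0// (lt_le_trans (expR_gt0 A) h).
Unshelve. all: by end_near. Qed.

Lemma ln_div_pinfty : ln N / N @[N --> +oo] --> (0 : R).
Proof.
apply/cvgrPdist_le => e e0; near=> N.
have N1 : 1 <= N by near: N; apply: nbhs_pinfty_ge; exact: num_real.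
have N0 : 0 < N := lt_le_trans ltr01 N1.
have hN : (2 / e) ^+ 2 <= N by near: N; apply: nbhs_pinfty_ge; exact: num_real.
pose s := Num.sqrt N; have s0 : 0 < s by rewrite sqrtr_gt0.
have sN : s ^+ 2 = N by rewrite sqr_sqrtr// ltW.
have l0 : 0 <= ln N by rewrite ln_ge0.
rewrite sub0r normrN ger0_norm; last by rewrite divr_ge0// ltW.
rewrite ler_pdivrMr//.
have hs : 2 / e <= s by rewrite -(@ler_pXn2r _ 2)// ?nnegrE ?divr_ge0 ?(ltW e0) ?(ltW s0)// sN.
have h1 : ln s <= s - 1 by have := @le_ln1Dx R (s - 1); rewrite subrKC; apply; lra.
have h2 : ln N = 2 * ln s by rewrite -sN lnXn// mulr_natl.
have h3 : 2 <= e * s by rewrite mulrC -ler_pdivrMr.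
have h4 : 2 * s <= e * s * s by apply: ler_wpM2r => //; exact: ltW.
by rewrite h2 -sN expr2 mulrA; lra.
Unshelve. all: by end_near. Qed.

End logarithm.

(** The integral is the difference of the integrals of the two parts, and this difference is finite
    only if both are. *)
Lemma finite_integral_integrable (R : realType) (d : measure_display) (T : measurableType d)
    (nu : {measure set T -> \bar R}) (f : T -> R) (c : R) : measurable_fun setT f ->
  (\int[nu]_v (f v)%:E = c%:E)%E -> nu.-integrable setT (EFin \o f).
Proof.
move=> mf hc; have mF : measurable_fun setT (EFin \o f) by exact/measurable_EFinP.
apply/integrableP; split => //.
rewrite (_ : (fun x => _) = ((EFin \o f)^\+ \+ (EFin \o f)^\-)%E); last first.
  by apply/funext => v; rewrite -[LHS]/((abse \o (EFin \o f)) v) fune_abse.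
have mp := measurable_funepos mF; have mn := measurable_funeneg mF.
rewrite (ge0_integralD nu measurableT)//.
move: hc; rewrite integralE /comp.
have : (0 <= \int[nu]_v (fun v => (f v)%:E)^\+ v)%E by exact: integral_ge0.
have : (0 <= \int[nu]_v (fun v => (f v)%:E)^\- v)%E by exact: integral_ge0.
by case: (\int[nu]_v _)%E => [a| |]; case: (\int[nu]_v _)%E => [b| |]//= _ _; rewrite -EFinD ltry.
Qed.

Section limits.
Context {R : realType} {d : measure_display} {Omega : measurableType d}.
Local Notation mu2 := (leb2 R).
Variables (P : probability Omega R) (X : Omega -> set (R * R)) (T2 : R * R -> R)
  (E : R -> R * R -> R).
Hypotheses (hE : forall N : R, 1 <= N -> is_torus_energy N (E N))
  (hX : simple_point_process X)
  (hrho1 : one_point_correlation P X (fun=> 1))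
  (hrho2 : two_point_correlation P X (fun p => 1 - T2 (p.1 - p.2)))
  (hT2 : measurable_fun setT T2)
  (iT : mu2.-integrable setT (EFin \o T2))
  (im : mu2.-integrable setT (EFin \o (fun v => enorm v * `|T2 v|))).

Let c := \int[mu2]_v T2 v.
Let logT v := T2 v * ln (enorm v).

Lemma cvg_taper_integral (f : R * R -> R) : mu2.-integrable setT (EFin \o f) ->
  \int[mu2]_v (taper N v * f v) @[N --> +oo] --> \int[mu2]_v f v.
Proof.
move=> fi; have mf : measurable_fun setT f by apply/measurable_EFinP; move/integrableP : fi => [].
apply: (ae_dominated_pinfty (@ae_off_axes R) _ mf (integrable_normr (nu := mu2) measurableT fi)).
- by move=> N _; apply: measurable_funM => //; exact: measurable_taper.
- move=> N v N1 _; rewrite normrM (ger0_norm (taper_ge0 _ _)) ler_piMl//.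
  by rewrite taper_le1// (lt_le_trans ltr01).
- move=> v _; rewrite -[X in _ --> X]mul1r.
  by apply: cvgM; [exact: taper_cvg|exact: cvg_cst].
Qed.

Lemma cvg_defect_integral :
  \int[mu2]_v (defect N (E N) v * T2 v) @[N --> +oo] --> - (2 * pi * @torus_const R) * c.
Proof.
have [C C0 hC] := @defect_bound R.
rewrite /c -(RintegralZl (mu := mu2) _ measurableT iT).
have ih := integrable_scaler (nu := mu2) C measurableT (integrable_normr (nu := mu2) measurableT iT).
apply: (ae_dominated_pinfty (@ae_off_axes R) _ _ ih).
- by move=> N N1; apply: measurable_funM => //; exact: measurable_defect (hE N1).
- exact: measurable_funM.
- by move=> N v N1 hv; rewrite normrM ler_wpM2r//; exact: (hC _ _ _ N1 (hE N1) hv).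
- by move=> v hv; apply: cvgM; [exact: defect_cvg|exact: cvg_cst].
Qed.

(** The variance inequality [tent_correlation_le], divided by N^2, says that the tapered integral of
    T2 is at most 1; let N grow. *)
Lemma total_correlation_le1 : c <= 1.
Proof.
apply: (cvgr_to_le (cvg_taper_integral iT)); near=> N.
have N0 : 0 < N by near: N; apply: nbhs_pinfty_gt; exact: num_real.
have := tent_correlation_le hX hrho1 hrho2 hT2 N0 iT.
have -> : (fun v => taper N v * T2 v) = (fun v => (N ^+ 2)^-1 * (tent2 N v * T2 v)).
  by apply/funext => v; rewrite /taper; move: (N ^+ 2)^-1 (tent2 N v) (T2 v) => *; ring.
rewrite (RintegralZl (mu := mu2) _ measurableT (integrable_tent2M N0 iT)) => h.
by rewrite mulrC ler_pdivrMr ?exprn_gt0// mul1r.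
Unshelve. all: by end_near. Qed.

Let finite_part N := - (2 * pi)^-1 * (\int[mu2]_v (defect N (E N) v * T2 v)) +
   \int[mu2]_v (taper N v * logT v) - @torus_const R.

Let finite_part_cvg : mu2.-integrable setT (EFin \o logT) ->
  finite_part N @[N --> +oo] --> @torus_const R * c + \int[mu2]_v logT v - @torus_const R.
Proof.
move=> il; apply: cvgB; last exact: cvg_cst.
apply: cvgD; last exact: cvg_taper_integral.
have -> : torus_const * c = - (2 * pi)^-1 * (- (2 * pi * torus_const) * c).
  by have := pi_gt0 R; move: (pi : R) torus_const c => p t k p0; field; rewrite gt_eqF.
by apply: cvgM; [exact: cvg_cst|exact: cvg_defect_integral].
Qed.

Let near_W : mu2.-integrable setT (EFin \o logT) ->
  \forall N \near +oo, 'E_P[fun w => W E N (X w)]%E =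
    (finite_part N + ln N * (1 - \int[mu2]_v (taper N v * T2 v)))%:E.
Proof.
move=> il; near=> N.
have N1 : 1 <= N by near: N; apply: nbhs_pinfty_ge; exact: num_real.
rewrite (expect_W_finite hE hX hrho2 hT2 iT N1 il) /finite_part; congr EFin.
by rewrite addrAC.
Unshelve. all: by end_near. Qed.

Lemma expect_W_pinfty : ~ mu2.-integrable setT (EFin \o logT) ->
  'E_P[fun w => W E N (X w)]%E @[N --> +oo] --> +oo%E.
Proof.
move=> nI; apply: (@cvg_trans _ ((fun=> +oo%E : \bar R) @ +oo)); last exact: cvg_cst.
apply: near_eq_cvg; near=> N.
have N1 : 1 <= N by near: N; apply: nbhs_pinfty_ge; exact: num_real.
by rewrite (expect_W_infinite hE hX hrho2 hT2 iT im N1 nI).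
Unshelve. all: by end_near. Qed.

(** Either the expectation is already +oo for all N >= 1, or it is a convergent part plus ln N times
    a quantity tending to 1 - c > 0. *)
Lemma expect_W_neq1 : c <> 1 -> 'E_P[fun w => W E N (X w)]%E @[N --> +oo] --> +oo%E.
Proof.
move=> c1; have [il|] := pselect (mu2.-integrable setT (EFin \o logT)); last exact: expect_W_pinfty.
have c_lt1 : c < 1 by rewrite lt_neqAle total_correlation_le1 andbT; exact/eqP.
apply: (@cvg_trans _ ((fun N => (finite_part N + ln N * (1 - \int[mu2]_v (taper N v * T2 v)))%:E) @ +oo)).
  by apply: near_eq_cvg; apply: filterS (near_W il) => N ->.
apply/cvgeryP/cvgryPge => A.
pose l := torus_const * c + \int[mu2]_v logT v - @torus_const R.
have /cvgrPdist_le/(_ _ ltr01) hl := finite_part_cvg il.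
have e0 : 0 < (1 - c) / 2 by rewrite divr_gt0// subr_gt0.
have /cvgrPdist_le/(_ _ e0) ht := cvg_taper_integral iT.
(* Eventually the convergent part is at least l - 1 and the coefficient of ln N at least (1 - c) /
   2; this threshold makes their combination at least A. *)
have /cvgryPge/(_ (Num.max 0 (2 / (1 - c) * (A - l + 1)))) hln := @ln_pinfty R.
near=> N.
have h1 : `|l - finite_part N| <= 1 by near: N.
have h2 : `|c - \int[mu2]_v (taper N v * T2 v)| <= (1 - c) / 2 by near: N.
have : Num.max 0 (2 / (1 - c) * (A - l + 1)) <= ln N by near: N.
rewrite ge_max => /andP[l0 h3].
move: h1 h2; rewrite !ler_norml => /andP[_ h1] /andP[h2 _].
have h4 : ln N * ((1 - c) / 2) <= ln N * (1 - \int[mu2]_v (taper N v * T2 v)).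
  by apply: ler_wpM2l => //; lra.
have h5 : A - l + 1 <= ln N * ((1 - c) / 2).
  have -> : A - l + 1 = 2 / (1 - c) * (A - l + 1) * ((1 - c) / 2).
    by field; rewrite subr_eq0 gt_eqF.
  by apply: ler_wpM2r => //; exact: ltW.
by lra.
Unshelve. all: by end_near. Qed.

(** On the square 1 - taper lies between 0 and 2 |v| / N, and outside it both integrands vanish; the
    first moment of T2 bounds the rest. *)
Lemma taper_square_close N : 1 <= N ->
  `|\int[mu2]_(v in square (- N) N) T2 v - \int[mu2]_v (taper N v * T2 v)| <=
  2 * (\int[mu2]_v (enorm v * `|T2 v|)) / N.
Proof.
move=> N1; have N0 : 0 < N := lt_le_trans ltr01 N1.
have mS := @measurable_square R (- N) N.
have i1 : mu2.-integrable setT (EFin \o (T2 \_ (square (- N) N))).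
  have [H _] := integrable_mkcond (mu := mu2) (EFin \o T2) mS.
  rewrite (_ : EFin \o _ = (EFin \o T2) \_ (square (- N) N)); last first.
    by apply/funext => v; rewrite /= !patchE; case: ifP.
  by apply: H; apply: integrableS iT.
have i2 : mu2.-integrable setT (EFin \o (fun v => taper N v * T2 v)) := integrable_taperM N1 iT.
have i3 : mu2.-integrable setT (EFin \o (fun v => (T2 \_ (square (- N) N)) v - taper N v * T2 v)).
  exact: (integrableB (mu := mu2) measurableT i1 i2).
have i4 := integrable_scaler (nu := mu2) (2 / N) measurableT im.
rewrite Rintegral_mkcond -(RintegralB (mu := mu2) measurableT i1 i2).
apply: le_trans (le_normr_Rintegral (mu := mu2) measurableT i3) _.
have -> : 2 * (\int[mu2]_v (enorm v * `|T2 v|)) / N = \int[mu2]_v (2 / N * (enorm v * `|T2 v|)).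
  by rewrite (RintegralZl (mu := mu2) _ measurableT im) mulrAC.
apply: (le_Rintegral (mu := mu2) measurableT (integrable_normr (nu := mu2) measurableT i3) i4) => v _.
have r0 : 0 <= 2 / N * (enorm v * `|T2 v|).
  by apply: mulr_ge0; [rewrite divr_ge0// ltW|rewrite mulr_ge0// sqrtr_ge0].
rewrite patchE; case: ifPn => hv; last first.
  rewrite taper_out ?mul0r ?subrr ?normr0//.
  case: (ltP `|v.1| N) => h1; [right|by left].
  rewrite leNgt; apply/negP => h2; move/negP: hv; apply; rewrite inE; split => /=.
    by rewrite in_itv/= -ler_norml ltW.
  by rewrite in_itv/= -ler_norml ltW.
move: hv; rewrite inE => -[/=]; rewrite !in_itv/= -!ler_norml => h1 h2.
rewrite -{1}(mul1r (T2 v)) -mulrBl normrM mulrA; apply: ler_wpM2r => //.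
rewrite ger0_norm ?subr_ge0 ?taper_le1//.
have [n1 n2] := normr_le_enorm v.
have -> : taper N v = (1 - `|v.1| / N) * (1 - `|v.2| / N).
  by rewrite /taper /tent2 /tent !max_r ?subr_ge0//; field; rewrite gt_eqF.
have a1 : `|v.1| / N <= enorm v / N by rewrite ler_pM2r ?invr_gt0.
have a2 : `|v.2| / N <= enorm v / N by rewrite ler_pM2r ?invr_gt0.
have a3 : 0 <= (`|v.1| / N) * (`|v.2| / N) by rewrite !mulr_ge0 ?invr_ge0 ?(ltW N0).
have -> : 2 / N * enorm v = 2 * (enorm v / N) by rewrite mulrAC mulrA.
move: a1 a2 a3; move: (`|v.1| / N) (`|v.2| / N) (enorm v / N) => x y z a1 a2 a3.
by rewrite mulrBr mulr1 mulrBl mul1r; move: (x * y) a3 => t a3; lra.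
Qed.

(** The hypothesis controls the integral over the square, and passing from the square to the taper
    costs O(1/N), which beats ln N. *)
Lemma cvg_log_defect : c = 1 ->
  (fun N : R => 1 - \int[mu2]_(v in square (- N) N) T2 v : R^o)
     =o_ +oo (fun N : R => (ln N)^-1 : R^o) ->
  ln N * (1 - \int[mu2]_v (taper N v * T2 v)) @[N --> +oo] --> (0 : R).
Proof.
move=> c1 /eqoP ho; apply/cvgrPdist_le => e e0.
have e2 : 0 < e / 2 by rewrite divr_gt0.
pose K := \int[mu2]_v (enorm v * `|T2 v|).
have hK : ln N / N * (2 * K) @[N --> +oo] --> (0 : R).
  by rewrite -[X in _ --> X](mul0r (2 * K)); apply: cvgM; [exact: ln_div_pinfty|exact: cvg_cst].
have /cvgrPdist_le/(_ _ e2) hK' := hK.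
near=> N.
have N1 : 1 < N by near: N; apply: nbhs_pinfty_gt; exact: num_real.
have l0 : 0 < ln N by rewrite ln_gt0.
have h1 : `|1 - \int[mu2]_(v in square (- N) N) T2 v| <= e / 2 * `|(ln N)^-1|.
  by near: N; exact: ho.
have h2 := taper_square_close (ltW N1).
have h3 : `|0 - ln N / N * (2 * K)| <= e / 2 by near: N.
rewrite sub0r normrN normrM (gtr0_norm l0).
rewrite (_ : 1 - _ = (1 - \int[mu2]_(v in square (- N) N) T2 v) +
  (\int[mu2]_(v in square (- N) N) T2 v - \int[mu2]_v (taper N v * T2 v))); last by ring.
apply: le_trans (ler_wpM2l (ltW l0) (ler_normD _ _)) _; rewrite mulrDr.
have -> : e = e / 2 + e / 2 by field.
apply: lerD.
  apply: le_trans (ler_wpM2l (ltW l0) h1) _.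
  by rewrite normfV (gtr0_norm l0) mulrCA divff ?gt_eqF// mulr1.
apply: le_trans (ler_wpM2l (ltW l0) h2) _; rewrite -/K.
apply: le_trans h3; rewrite sub0r normrN; apply: le_trans (ler_norm _).
by rewrite mulrCA mulrA [ln N / N * _]mulrC mulrA [_ * ln N]mulrC mulrA.
Unshelve. all: by end_near. Qed.

(** With c = 1 the limit of the defect term contributes exactly +[torus_const], which cancels the
    constant of the energy. *)
Lemma expect_W_eq1 : c = 1 ->
  (fun N : R => 1 - \int[mu2]_(v in square (- N) N) T2 v : R^o)
     =o_ +oo (fun N : R => (ln N)^-1 : R^o) ->
  mu2.-integrable setT (EFin \o logT) ->
  'E_P[fun w => W E N (X w)]%E @[N --> +oo] --> (\int[mu2]_v logT v)%:E.
Proof.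
move=> c1 ho il.
apply: (@cvg_trans _ ((fun N => (finite_part N + ln N * (1 - \int[mu2]_v (taper N v * T2 v)))%:E) @ +oo)).
  by apply: near_eq_cvg; apply: filterS (near_W il) => N ->.
apply: cvg_EFin; first exact: nearW.
have -> : \int[mu2]_v logT v = (torus_const * c + \int[mu2]_v logT v - @torus_const R) + 0.
  by rewrite c1; move: torus_const (\int[mu2]_v _) => *; ring.
by apply: cvgD; [exact: finite_part_cvg|exact: cvg_log_defect].
Qed.

End limits.

Theorem theorem2 (R : realType) (d : measure_display) (Omega : measurableType d)
    (P : probability Omega R) (X : Omega -> set (R * R)) (T2 : R * R -> R)
    (E : R -> R * R -> R)
    (hE : forall N : R, 1 <= N -> is_torus_energy N (E N))
    (hX : simple_point_process X)
    (hinv : translation_invariant P X)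
    (hrho1 : one_point_correlation P X (fun=> 1))
    (hrho2 : two_point_correlation P X (fun p => 1 - T2 (p.1 - p.2)))
    (hT2 : measurable_fun setT T2)
    (hmom : forall k : nat, (1 <= k <= 3)%N ->
      (\int[leb2 R]_v (enorm v ^+ k * `|T2 v|)%:E < +oo)%E) :
  (forall c : R, (\int[leb2 R]_v (T2 v)%:E = c%:E)%E -> c <> 1 ->
     'E_P[fun w => W E N (X w)]%E @[N --> +oo] --> +oo%E) /\
  ((\int[leb2 R]_v (T2 v)%:E = 1)%E ->
   (fun N : R => 1 - \int[leb2 R]_(v in square (- N) N) T2 v : R^o)
     =o_ +oo (fun N : R => (ln N)^-1 : R^o) ->
   ((exists l : R, 'E_P[fun w => W E N (X w)]%E @[N --> +oo] --> l%:E) <->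
    (leb2 R).-integrable setT (fun v => (T2 v * ln (enorm v))%:E)) /\
   ((leb2 R).-integrable setT (fun v => (T2 v * ln (enorm v))%:E) ->
    'E_P[fun w => W E N (X w)]%E @[N --> +oo] -->
      (\int[leb2 R]_v (ln (enorm v) * T2 v)%:E)%E)).
Proof.
have im : (leb2 R).-integrable setT (EFin \o (fun v => enorm v * `|T2 v|)).
  have m1 : measurable_fun setT (fun v => enorm v * `|T2 v|).
    by apply: measurable_funM; [exact: measurable_enorm|exact: measurableT_comp].
  apply/integrableP; split; first exact/measurable_EFinP.
  apply: le_lt_trans (hmom 1%N isT); apply: (ge0_le_integral (leb2 R) measurableT) => //.
  - by apply: measurableT_comp => //; exact/measurable_EFinP.
  - by apply/measurable_EFinP.
  by move=> v _; rewrite /= ger0_norm// mulr_ge0// sqrtr_ge0.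
have fin c : (\int[leb2 R]_v (T2 v)%:E = c%:E)%E ->
    (leb2 R).-integrable setT (EFin \o T2) /\ \int[leb2 R]_v T2 v = c.
  move=> hc; split; first exact: (finite_integral_integrable (nu := leb2 R) hT2 hc).
  exact: (congr1 fine hc).
split=> [c hc c1|h1 ho].
  have [iT ec] := fin _ hc.
  by apply: (expect_W_neq1 hE hX hrho1 hrho2 hT2 iT im); rewrite ec.
have [iT ec] := fin _ h1.
have lim := expect_W_eq1 hE hX hrho2 hT2 iT im ec ho.
split; last first.
  move=> il; have -> : (\int[leb2 R]_v (ln (enorm v) * T2 v)%:E = (\int[leb2 R]_v (T2 v * ln (enorm v)))%:E)%E.
    rewrite /Rintegral fineK; last exact: (integrable_fin_num measurableT il).
    by apply: eq_integral => v _; rewrite mulrC.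
  exact: lim.
split=> [[l hl]|il]; last by exists (\int[leb2 R]_v (T2 v * ln (enorm v))); exact: lim.
(* Without integrability the expectations tend to +oo, and limits in the extended reals are
   unique. *)
apply: contrapT => nI.
have := expect_W_pinfty hE hX hrho2 hT2 iT im nI => hy.
have := cvg_lim (@ereal_hausdorff R) hl; by rewrite (cvg_lim (@ereal_hausdorff R) hy) => /(_ proper_pinfty_nbhs).
Qed.
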